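(* Let $\Omega\subset\mathbb{C}^n$ be a bounded domain and let $1\le p<\infty$. Then $K_p(\cdot)\in C^{1,1}_{\rm loc}(\Omega)$. Moreover, for every $z\in\Omega$, $$\frac{\partial K_p}{\partial x_j}(z)=p\,\mathrm{Re}\,\frac{\partial K_p(\cdot,z)}{\partial x_j}\bigg|_z\quad(1\le j\le 2n),\qquad \frac{\partial K_p}{\partial z_k}(z)=\frac p2\cdot\frac{\partial K_p(\cdot,z)}{\partial z_k}\bigg|_z\quad(1\le k\le n),$$ where $(x_1,\dots,x_{2n})$ and $(z_1,\dots,z_n)$ denote the real and complex coordinates in $\mathbb{R}^{2n}=\mathbb{C}^n$ respectively, with $z_j=x_j+ix_{n+j}$.
   Context: For a bounded domain $\Omega\subset\mathbb{C}^n$ and $1\le p<\infty$, let $A^p(\Omega)=\{f\in\mathcal{O}(\Omega):\|f\|_p^p=\int_\Omega|f|^p<\infty\}$ (Lebesgue measure; $\mathcal O(\Omega)$ is the set of holomorphic functions). The $p$-Bergman kernel is $K_p(z):=\sup\{|f(z)|^p: f\in A^p(\Omega),\ \|f\|_p=1\}$, $z\in\Omega$. Let $m_p(z):=\inf\{\|f\|_p: f\in A^p(\Omega),\ f(z)=1\}$; for $1\le p<\infty$ it is known that this infimum is attained by a unique function $m_p(\cdot,z)\in A^p(\Omega)$, and $K_p(z)=m_p(z)^{-p}$. The off-diagonal $p$-Bergman kernel is $K_p(\zeta,z):=K_p(z)\,m_p(\zeta,z)$, $\zeta,z\in\Omega$; it is holomorphic in $\zeta$ and $K_p(z,z)=K_p(z)$.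 The notation $\partial K_p(\cdot,z)/\partial x_j|_z$ means $\partial K_p(\zeta,z)/\partial \mathrm{x}_j$ differentiated in the first variable $\zeta$ and evaluated at $\zeta=z$; similarly for $\partial/\partial z_k$. $C^{1,1}_{\rm loc}(\Omega)$ is the set of $C^1$ functions on $\Omega$ whose first-order partial derivatives are locally Lipschitz continuous. *)

(* Defs.v *)
From HB Require Import structures.
From mathcomp Require Import all_boot all_order all_algebra.
From mathcomp Require Import all_classical all_reals all_analysis.
From mathcomp Require Import complex.

Set Implicit Arguments.
Unset Strict Implicit.
Unset Printing Implicit Defensive.

Import Order.TTheory GRing.Theory Num.Theory.
Import numFieldNormedType.Exports.

Local Open Scope classical_set_scope.
Local Open Scope ring_scope.

Section LebesgueMeasure.
Variable R : realType.
Local Notation RT := (measurableTypeR R).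

Section Step.
Variables (m : nat) (mu : {sigma_finite_measure set (m.-tuple RT) -> \bar R}).

Let tcons (x : RT * m.-tuple RT) : m.+1.-tuple RT := [tuple of x.1 :: x.2].

Let measurable_tcons : measurable_fun [set: RT * m.-tuple RT] tcons.
Proof. exact: measurable_cons. Qed.

Let leb : {sigma_finite_measure set RT -> \bar R} := lebesgue_measure.

Let prodmu : {measure set (RT * m.-tuple RT)%type -> \bar R} :=
  (leb \x mu)%E.

Definition lebesgue_step : set (m.+1.-tuple RT) -> \bar R :=
  pushforward prodmu tcons.

Let step0 : lebesgue_step set0 = 0.
Proof. exact: measure0. Qed.

Let step_ge0 A : (0 <= lebesgue_step A)%E.
Proof. exact: measure_ge0. Qed.

Let step_sigma_additive : semi_sigma_additive lebesgue_step.
Proof.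
move=> F mF tF mUF; rewrite /lebesgue_step /pushforward preimage_bigcup.
apply: (measure_semi_sigma_additive (s:=prodmu)).
- by move=> k; rewrite -[X in measurable X]setTI; exact: measurable_tcons.
- apply/trivIsetP => /= i j _ _ ij; rewrite -preimage_setI.
  by move/trivIsetP : tF => /(_ _ _ _ _ ij) ->//; rewrite preimage_set0.
- by rewrite -preimage_bigcup -[X in measurable X]setTI; exact: measurable_tcons.
Qed.

HB.instance Definition _ := isMeasure.Build _ _ _ lebesgue_step
  step0 step_ge0 step_sigma_additive.

Let step_sigma_finite : sigma_finite setT lebesgue_step.
Proof.
have [F UF mF] : sigma_finite setT prodmu.
  have /sigma_finiteP[F [TF ndF Foo]] := sigma_finiteT leb.
  have /sigma_finiteP[G [TG ndG Goo]] := sigma_finiteT mu.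
  exists (fun k => F k `*` G k).
    rewrite -setXTT TF TG predeqE => -[x y]; split=> [|[k _ []/= ? ?]].
      move=> [/= [i _ Fix] [j _ Gjy]]; exists (maxn i j) => //; split.
        by move: x Fix; exact/subsetPset/ndF/leq_maxl.
      by move: y Gjy; exact/subsetPset/ndG/leq_maxr.
    by split; exists k.
  move=> k; have [? ?] := Foo k; have [? ?] := Goo k.
  split; first exact: measurableX.
  by rewrite /prodmu /= product_measure1E// lte_mul_pinfty// ge0_fin_numE.
pose uncons (t : m.+1.-tuple RT) : RT * m.-tuple RT :=
  (thead t, [tuple of behead t]).
have munc : measurable_fun setT uncons.
  apply/measurable_fun_pair; first exact: measurable_tnth.
  exact: measurable_behead.
have unconsK x : uncons (tcons x) = x.
  by case: x => x t; congr pair; apply/val_inj.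
exists (fun k => uncons @^-1` F k).
  by rewrite -preimage_bigcup -UF preimage_setT.
move=> k; have [mFk Fk] := mF k; split.
  by rewrite -[X in measurable X]setTI; exact: munc.
rewrite /lebesgue_step /pushforward -comp_preimage.
by rewrite (_ : uncons \o tcons = id) //; apply/funext => x; exact: unconsK.
Qed.

HB.instance Definition _ := Measure_isSigmaFinite.Build _ _ _ lebesgue_step
  step_sigma_finite.

End Step.

(* Lebesgue measure on the Borel sets of [R^m]: the [m]-fold product of the
   one-dimensional Lebesgue measure, [R^m.+1] being read as [R * R^m]. *)
Fixpoint lebesgueT (m : nat) : {sigma_finite_measure set (m.-tuple RT) -> \bar R} :=
  if m is k.+1 then lebesgue_step (lebesgueT k)
  else (\d_([tuple of [::]] : 0.-tuple RT)).

Lemma lebesgueT_box (m : nat) (B : 'I_m -> set RT) :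
  (forall i, measurable (B i)) ->
  lebesgueT m [set t | forall i, B i (tnth t i)] =
  (\prod_(i < m) lebesgue_measure (B i))%E.
Proof.
elim: m B => [|m IHm] B mB.
  by rewrite big_ord0 /= diracE mem_set// => -[].
have mbox : measurable
    [set t : m.-tuple RT | forall i, B (lift ord0 i) (tnth t i)].
  rewrite (_ : mkset _ =
      \bigcap_(i in [set: 'I_m]) ((@tnth m RT)^~ i @^-1` B (lift ord0 i))).
    apply: fin_bigcap_measurable => // i _.
    by rewrite -[X in measurable X]setTI; exact: measurable_tnth.
  by apply/seteqP; split=> [t tB i _|t tB i]; exact: tB.
rewrite big_ord_recl -(IHm (fun i => B (lift ord0 i)))//=.
rewrite -product_measure1E//=.
congr product_measure1.
apply/seteqP; split=> -[x t] /=.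
  by move=> xt; split=> [|i]; [exact: (xt ord0)|have := xt (lift ord0 i); rewrite tnthS].
move=> [Bx Bt] i; have [j ->|->//] := unliftP ord0 i.
by rewrite tnthS.
Qed.

End LebesgueMeasure.

(* The field of complex numbers, packed as a [numClosedFieldType] so that the
   topology, norm and differentiability that the library attaches to an
   arbitrary [numFieldType] apply to it and to row vectors over it. *)
Definition CC (R : realType) : numClosedFieldType := R[i].

Section Coordinates.
Variables (R : realType) (n : nat).

(* The identification of R^2n with C^n: z_j = x_j + i x_(n+j). *)
Definition to_complex (x : 'rV[R]_(n + n)) : 'rV[CC R]_n :=
  \row_k Complex (x 0 (lshift n k)) (x 0 (rshift n k)).

Definition of_complex (z : 'rV[CC R]_n) : 'rV[R]_(n + n) :=
  row_mx (map_mx (@complex.Re R) z) (map_mx (@complex.Im R) z).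

Lemma to_complexK : cancel to_complex of_complex.
Proof.
move=> x; apply/rowP => j; rewrite !mxE.
by case: splitP => k jk; rewrite !mxE /=; congr (x 0 _); apply/val_inj.
Qed.

Lemma of_complexK : cancel of_complex to_complex.
Proof.
move=> z; apply/rowP => k; rewrite mxE row_mxEl row_mxEr !mxE.
by case: (z 0 k).
Qed.

Definition partial (g : 'rV[R]_(n + n) -> R) (j : 'I_(n + n))
    (x : 'rV[R]_(n + n)) : R :=
  'D_(delta_mx 0 j) g x.

(* d/dx_j of a real-valued function on C^n. *)
Definition dx (u : 'rV[CC R]_n -> R) (j : 'I_(n + n)) (z : 'rV[CC R]_n) : R :=
  partial (u \o to_complex) j (of_complex z).

(* d/dx_j of a complex-valued function on C^n. *)
Definition dxC (f : 'rV[CC R]_n -> CC R) (j : 'I_(n + n))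
    (z : 'rV[CC R]_n) : CC R :=
  Complex (dx (fun w => complex.Re (f w)) j z)
          (dx (fun w => complex.Im (f w)) j z).

(* d/dz_k = (d/dx_k - i d/dx_(n+k)) / 2. *)
Definition dz (f : 'rV[CC R]_n -> CC R) (k : 'I_n) (z : 'rV[CC R]_n) : CC R :=
  (dxC f (lshift n k) z - 'i%C * dxC f (rshift n k) z) / 2.

(* C^1 functions on the open set [D] whose first-order partial derivatives are
   locally Lipschitz continuous on [D]. *)
Definition C11_loc (D : set 'rV[CC R]_n) (u : 'rV[CC R]_n -> R) : Prop :=
  let E := to_complex @^-1` D in let g := u \o to_complex in
  forall j : 'I_(n + n),
    [/\ forall x, E x -> derivable g x (delta_mx 0 j),
        forall x, E x -> {for x, continuous (partial g j)} &
        forall x, E x -> exists2 U, nbhs x U &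
          [lipschitz partial g j y | y in U `&` E]].

End Coordinates.

Section Bergman.
Variables (R : realType) (n : nat) (Omega : set 'rV[CC R]_n) (p : R).
Implicit Types (f : 'rV[CC R]_n -> CC R) (z zeta : 'rV[CC R]_n).

Definition bounded_domain : Prop :=
  [/\ open Omega, connected Omega, Omega !=set0 & bounded_set Omega].

(* [differentiable] is Frechet differentiability over the complex field. *)
Definition holomorphic f : Prop := forall z, Omega z -> differentiable f z.

Definition tuple_to_complex (t : (n + n).-tuple (measurableTypeR R)) :
    'rV[CC R]_n :=
  to_complex (\row_j tnth t j).

Definition int_powp f : \bar R :=
  (\int[lebesgueT R (n + n)]_(t in tuple_to_complex @^-1` Omega)
     (Normc.normc (f (tuple_to_complex t)) `^ p)%:E)%E.

(* Functions are total: an element of A^p(Omega) matters only through its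
   values on [Omega]. *)
Definition Ap : set ('rV[CC R]_n -> CC R) :=
  [set f | holomorphic f /\ (int_powp f < +oo)%E].

Definition normp f : R := fine (int_powp f) `^ p^-1.

Definition Kp z : R :=
  sup [set Normc.normc (f z) `^ p | f in [set f | Ap f /\ normp f = 1]].

Definition mp z : R :=
  inf [set normp f | f in [set f | Ap f /\ f z = 1]].

(* The minimizer m_p(., z) : the element of A^p(Omega), unique on [Omega],
   which attains the infimum [mp z]. *)
Definition minimizer z : 'rV[CC R]_n -> CC R :=
  xget (cst 0) [set f | [/\ Ap f, f z = 1 & normp f = mp z]].

Definition Kp_off zeta z : CC R := (Kp z)%:C%C * minimizer z zeta.

End Bergman.

(* Main.v *)
(* Write J(z) for the p-th power of the least norm at z, so that K_p = 1 / J, and m_z for a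
   minimizer.  Any f in A^p satisfies |f(w)|^p J(w) <= |f|_p^p; with f = m_z, and with z and w
   exchanged, this determines K_p(w) - K_p(z) up to the error p K_p(z) Re (m_z(w) + m_w(z) - 2)
   plus a quadratic one.  As m_z(z) = m_w(w) = 1, that error is a difference of the holomorphic
   function m_z - m_w between w and z, hence is O(|w - z|^2) as soon as m_z - m_w = O(|w - z|)
   locally uniformly.

   For this Lipschitz bound, put d = |z - w| and let G be the excess of (J(z) + J(w)) / 2 over
   the energy of (m_z + m_w) / 2.  The pointwise gain in the midpoint inequality, integrated near
   a point where Im (m_z / m_w) is nearly maximal, gives sup |Im (m_z / m_w)|^2 <= C G; as
   m_z / m_w is 1 + O(d) at z, this yields sup |m_z - m_w| <= C (G^(1/2) + d).  In the other
   direction, comparing (m_z + m_w) / 2 with the minimizer at (z + w) / 2 gives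
   G <= C (d^2 + d sup |m_z - m_w|).  No variational equation is used, so p = 1 is not special.

   Finally, a function with expansions u(w) = u(z) + P_z(w - z) + O(|w - z|^2), locally uniform
   in z, is C^{1,1} with differential P; here P_z = p K_p(z) Re (d m_z)(z). *)

Require Import Defs.
From HB Require Import structures.
From mathcomp Require Import all_boot all_order all_algebra.
From mathcomp Require Import all_classical all_reals all_analysis.
From mathcomp Require Import complex.
From mathcomp Require Import measurable_realfun.
From mathcomp Require Import ring lra.

Import Order.TTheory GRing.Theory Num.Theory.
Import numFieldNormedType.Exports.

Local Open Scope classical_set_scope.
Local Open Scope ring_scope.

Set Implicit Arguments.
Unset Strict Implicit.
Unset Printing Implicit Defensive.
#[local] Arguments Normc.normc : simpl never.

(** * The maximum principle *)

(** Complex Frechet differentiability is the only starting point, and all derivative estimates go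
    through the maximum principle. Goursat's bisection is run in the logarithmic coordinate of a
    punctured disc, where a circle becomes a vertical period and the centre goes to [-oo]. Since the
    centre is a puncture, difference quotients are admissible; they bound derivatives, and
    Lipschitz, second-difference and Taylor bounds follow by iteration. Energies control pointwise
    values through one concentration principle: [|f|] and [|Im q|] vary at a rate governed by their
    own local upper bound, so a weighted near-maximum is surrounded by a ball where at least half
    the value persists. With exponent [p] this bounds point values by energies, hence gives locally
    uniform bounds and the existence of minimizers; with exponent [2] it turns an energy gap into a
    bound on [Im (m_z / m_w)]. The obstacle is [p = 1]: the midpoint inequality is then an equality
    wherever [m_z / m_w] is positive. The gap can only be asked to control the imaginary part of the
    quotient; holomorphy and the normalization at the base point recover the rest. *)

Section Box.
Variable R : realType.
Implicit Types (W : R -> R -> R) (x y e : R).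

(** When [W] is a primitive along vertical lines minus one along horizontal lines, this is a contour
    integral over the boundary of a rectangle. *)
Definition mixed_diff W x1 x2 y1 y2 : R :=
  W x2 y2 - W x1 y2 - W x2 y1 + W x1 y1.

(** Mixed differences add up under subdivision, so the four quarters cannot all stay below a fourth
    of the whole. The booleans [s] tell which half is kept in each coordinate. *)
Lemma mixed_diff_quarter W x y w h :
  exists s : bool * bool,
    let x' := x + s.1%:R * (w / 2) in let y' := y + s.2%:R * (h / 2) in
    `|mixed_diff W x (x + w) y (y + h)|
      <= 4 * `|mixed_diff W x' (x' + w / 2) y' (y' + h / 2)|.
Proof.
apply: contrapT => /forallNP H.
pose b (s : bool * bool) :=
  mixed_diff W (x + s.1%:R * (w / 2)) (x + s.1%:R * (w / 2) + w / 2)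
               (y + s.2%:R * (h / 2)) (y + s.2%:R * (h / 2) + h / 2).
have Hs s : 4 * `|b s| < `|mixed_diff W x (x + w) y (y + h)|.
  by rewrite ltNge; apply/negP; exact: H.
have E : mixed_diff W x (x + w) y (y + h) =
    b (false, false) + b (true, false) + b (false, true) + b (true, true).
  rewrite /b /mixed_diff /= !mul0r !addr0 !mul1r -!addrA -!splitr; ring.
have := Hs (false, false); have := Hs (true, false).
have := Hs (false, true); have := Hs (true, true).
have : `|mixed_diff W x (x + w) y (y + h)| <=
   `|b (false, false)| + `|b (true, false)| + `|b (false, true)| + `|b (true, true)|.
  rewrite E; do 3 (apply: le_trans (ler_normD _ _) _; rewrite lerD2r//).
lra.
Qed.

(** [X k] is the left end of the k-th bisected interval; the supremum of the left ends lies in all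
    of them. *)
Lemma nested_dyadic (X : R^nat) w : 0 <= w ->
  (forall k, X k <= X k.+1) -> (forall k, X k.+1 + w / 2 ^+ k.+1 <= X k + w / 2 ^+ k) ->
  exists l, forall k, X k <= l <= X k + w / 2 ^+ k.
Proof.
move=> w0 Xn Xd.
have Xnd : {homo X : m n / (m <= n)%N >-> m <= n}.
  by apply: homo_leq => //; exact: le_trans.
have Xnd' : {homo (fun k => X k + w / 2 ^+ k) : m n / (m <= n)%N >-> n <= m}.
  apply: (homo_leq (r := fun a b => b <= a)) => //; move=> y x z xy yz; exact: le_trans yz xy.
have wk k : 0 <= w / 2 ^+ k by rewrite divr_ge0// exprn_ge0.
have ub k : ubound (range X) (X k + w / 2 ^+ k).
  move=> _ [m _ <-].
  apply: le_trans (Xnd _ _ (leq_maxl m k)) _.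
  apply: le_trans (Xnd' _ _ (leq_maxr m k)); rewrite lerDl//.
exists (sup (range X)) => k; apply/andP; split.
  apply: ub_le_sup; last by exists k.
  by exists (X 0%N + w / 2 ^+ 0); exact: ub.
apply: ge_sup; [by exists (X 0%N); exists 0%N | exact: ub].
Qed.

(* Goursat's bisection: some quarter of the rectangle carries at least a fourth of the
   mixed difference, which is [o(diameter ^ 2)] at the point the rectangles shrink to. *)
Lemma mixed_diff_eq0 W a b c d : a <= b -> c <= d ->
  (forall x y, a <= x <= b -> c <= y <= d -> forall e, 0 < e ->
    exists2 del, 0 < del & forall x1 x2 y1 y2,
      a <= x1 <= x -> x <= x2 <= b -> c <= y1 <= y -> y <= y2 <= d ->
      x2 - x1 < del -> y2 - y1 < del ->
      `|mixed_diff W x1 x2 y1 y2| <= e * ((x2 - x1) + (y2 - y1)) ^+ 2) ->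
  mixed_diff W a b c d = 0.
Proof.
move=> ab cd H; apply/eqP; apply: contrapT => /negP; rewrite -normr_gt0 => m0.
set m := `|_| in m0.
pose w := b - a; pose h := d - c.
have w0 : 0 <= w by rewrite subr_ge0.
have h0 : 0 <= h by rewrite subr_ge0.
pose P k x y (s : bool * bool) :=
  let w' := w / 2 ^+ k in let h' := h / 2 ^+ k in
  let x' := x + s.1%:R * (w' / 2) in let y' := y + s.2%:R * (h' / 2) in
    `|mixed_diff W x (x + w') y (y + h')|
      <= 4 * `|mixed_diff W x' (x' + w' / 2) y' (y' + h' / 2)|.
have [S HS] : {S : nat -> R -> R -> bool * bool & forall k x y, P k x y (S k x y)}.
  exists (fun k x y => sval (cid (mixed_diff_quarter W x y (w / 2 ^+ k) (h / 2 ^+ k)))).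
  by move=> k x y; exact: (svalP (cid (mixed_diff_quarter W x y _ _))).
(* [F k] is the lower left corner of the k-th rectangle, of sides [w / 2 ^+ k] and [h / 2 ^+ k]. *)
pose F := fix F k : R * R := if k is j.+1 then
   let p := F j in let s := S j p.1 p.2 in
   (p.1 + s.1%:R * (w / 2 ^+ j / 2), p.2 + s.2%:R * (h / 2 ^+ j / 2)) else (a, c).
have half (u : R) k : u / 2 ^+ k.+1 = u / 2 ^+ k / 2.
  by rewrite exprSr invfM mulrA.
have b01 (t : bool) (u : R) : 0 <= u -> 0 <= t%:R * u <= u.
  by case: t => u0 /=; rewrite ?mul1r ?mul0r; apply/andP; split.
have wk k : 0 <= w / 2 ^+ k by rewrite divr_ge0// exprn_ge0.
have hk k : 0 <= h / 2 ^+ k by rewrite divr_ge0// exprn_ge0.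
have [l Hl] : exists l, forall k, (F k).1 <= l <= (F k).1 + w / 2 ^+ k.
  apply: nested_dyadic => // k /=.
    by rewrite lerDl; have /andP[] := b01 (S k (F k).1 (F k).2).1 _ (wk k.+1); rewrite half.
  have /andP[_] := b01 (S k (F k).1 (F k).2).1 _ (wk k.+1).
  rewrite half; move: (w / _) => u; lra.
have [g Hg] : exists l, forall k, (F k).2 <= l <= (F k).2 + h / 2 ^+ k.
  apply: nested_dyadic => // k /=.
    by rewrite lerDl; have /andP[] := b01 (S k (F k).1 (F k).2).2 _ (hk k.+1); rewrite half.
  have /andP[_] := b01 (S k (F k).1 (F k).2).2 _ (hk k.+1).
  rewrite half; move: (h / _) => u; lra.
have Fin k : [/\ a <= (F k).1, (F k).1 + w / 2 ^+ k <= b, c <= (F k).2 &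
    (F k).2 + h / 2 ^+ k <= d].
  elim: k => [|k [H1 H2 H3 H4]] /=.
    by rewrite expr0 !divr1 /w /h; split => //; lra.
  have := b01 (S k (F k).1 (F k).2).2 _ (hk k.+1).
  have := b01 (S k (F k).1 (F k).2).1 _ (wk k.+1).
  move: H2 H4; rewrite !half; move: (h / _) (w / _) (_%:R * _) (_%:R * _) => u v s t *.
  by split; lra.
have mF k : m <= 4 ^+ k * `|mixed_diff W (F k).1 ((F k).1 + w / 2 ^+ k) (F k).2 ((F k).2 + h / 2 ^+ k)|.
  elim: k => [|k IH].
    by rewrite !expr0 mul1r !divr1 /= /w /h !subrKC.
  apply: le_trans IH _; rewrite exprSr -mulrA ler_pM2l ?exprn_gt0//.
  by move: (HS k (F k).1 (F k).2); rewrite /P /= !half.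
have abl : a <= l <= b.
  by have /andP[l1 l2] := Hl 0%N; have [H1 H2 _ _] := Fin 0%N; rewrite (le_trans H1)// (le_trans l2).
have cdg : c <= g <= d.
  by have /andP[l1 l2] := Hg 0%N; have [_ _ H1 H2] := Fin 0%N; rewrite (le_trans H1)// (le_trans l2).
(* Chosen so that [e * (w + h) ^+ 2] stays below [m / 2]; the [1 +] covers a degenerate
   rectangle. *)
pose e := m / 2 / (1 + (w + h) ^+ 2).
have D0 : 0 < 1 + (w + h) ^+ 2 by rewrite ltr_wpDr// sqr_ge0.
have e0 : 0 < e by rewrite !divr_gt0.
have [del del0 Hdel] := H l g abl cdg e e0.
have [k kd] : exists k, (w + h) / 2 ^+ k < del.
  have : (fun k => (w + h) * (2^-1 ^+ k)) @ \oo --> (w + h) * 0.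
    by apply: cvgMr; apply: cvg_expr; rewrite ger0_norm ?invr_ge0// invf_lt1// ltr1n.
  rewrite mulr0 => /cvgrPdist_lt /(_ _ del0) [k _ /(_ k (leqnn _))].
  rewrite sub0r normrN => /(le_lt_trans (ler_norm _)) Hk.
  by exists k; rewrite -exprVn.
have mFk := mF k.
have [H1 H2 H3 H4] := Fin k.
have /andP[l1 l2] := Hl k; have /andP[g1 g2] := Hg k.
have wd : w / 2 ^+ k < del.
  by apply: le_lt_trans kd; rewrite ler_wpM2r ?invr_ge0 ?exprn_ge0 ?lerDl.
have hd : h / 2 ^+ k < del.
  by apply: le_lt_trans kd; rewrite ler_wpM2r ?invr_ge0 ?exprn_ge0 ?lerDr.
have := Hdel (F k).1 ((F k).1 + w / 2 ^+ k) (F k).2 ((F k).2 + h / 2 ^+ k).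
have sK (u v : R) : u + v - u = v by rewrite addrC addKr.
rewrite H1 H2 H3 H4 l1 l2 g1 g2 !sK => /(_ isT isT isT isT wd hd) B.
(* The factor [4 ^+ k] lost in passing to quarters is exactly compensated by the squared size of the
   k-th rectangle. *)
have E : 4 ^+ k * (e * (w / 2 ^+ k + h / 2 ^+ k) ^+ 2) = e * (w + h) ^+ 2.
  have -> : 4 ^+ k = (2 ^+ k) ^+ 2 :> R by rewrite exprAC; congr (_ ^+ _); rewrite expr2; lra.
  have : 2 ^+ k != 0 :> R by rewrite expf_neq0// pnatr_eq0.
  by move: (2 ^+ k) => u u0; field.
move: B => /(ler_wpM2l (exprn_ge0 k (ler0n R 4))).
rewrite E => /(le_trans mFk).
have : e * (1 + (w + h) ^+ 2) = m / 2 by rewrite divfK// gt_eqF.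
rewrite mulrDr mulr1.
lra.
Qed.
End Box.

(** * Cauchy-Riemann equations and the mean value over a period *)

Section CauchyRiemann.
Variable R : realType.
Implicit Types (u v : R -> R -> R) (x y e : R).

Lemma MVT_closed (f df : R -> R) a b : a <= b ->
  (forall x, a <= x <= b -> is_derive x 1 f (df x)) ->
  exists2 c, a <= c <= b & f b - f a = df c * (b - a).
Proof.
move=> ab fdf; have [||c cab ->] := @MVT_segment R f df a b ab.
- by move=> x /subset_itv_oo_cc; rewrite /= in_itv; exact: fdf.
- apply: derivable_within_continuous => x; rewrite in_itv => /fdf H.
  exact: ex_derive.
- by exists c.
Qed.

Lemma primitive_exists (f : R -> R) (A B : R) :
  (forall x, A <= x < B -> {for x, continuous f}) ->
  exists F : R -> R, forall x, A < x < B -> is_derive x 1 F (f x).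
Proof.
move=> cf; exists (fun x => Rintegral lebesgue_measure [set` `[A, x]] f).
move=> x /andP[Ax xB].
have [||||dF <-] := @continuous_FTC1_closed R f A x ((x + B) / 2); try lra.
- apply: continuous_compact_integrable; first exact: segment_compact.
  apply: continuous_in_subspaceT => y; rewrite inE /= in_itv /= => /andP[Ay yB].
  by apply: cf; apply/andP; split; lra.
- by apply: cf; apply/andP; split; lra.
by rewrite derive1E; exact: DeriveDef dF _.
Qed.

(** Complex differentiability of [u + iv] with derivative [al + i be], in real and imaginary parts.
    Goursat's argument needs the full two-variable expansion, not just the partial derivatives. *)
Definition cauchy_riemann u v x y :=
  exists al be, forall e, 0 < e -> exists2 d, 0 < d &
    forall s t, `|s| < d -> `|t| < d ->
    `|u (x + s) (y + t) - u x y - (al * s - be * t)| <= e * (`|s| + `|t|) /\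
    `|v (x + s) (y + t) - v x y - (be * s + al * t)| <= e * (`|s| + `|t|).

Lemma local_lipschitz_continuous (f : R -> R) x K d : 0 < d ->
  (forall h, `|h| < d -> `|f (x + h) - f x| <= K * `|h|) -> {for x, continuous f}.
Proof.
move=> d0 H; apply/cvgrPdist_lt => /= e e0.
have D0 : 0 < 1 + `|K| by rewrite ltr_wpDr.
exists (Num.min d (e / (1 + `|K|))) => [|z].
  by rewrite /= lt_min d0 divr_gt0.
rewrite /ball /= distrC lt_min => /andP[zd ze].
have := H _ zd; rewrite subrKC distrC => /le_lt_trans; apply.
apply: (@le_lt_trans _ _ (`|z - x| * (1 + `|K|))); last by rewrite -ltr_pdivlMr.
rewrite mulrC ler_wpM2l// (le_trans (ler_norm _))// lerDr//.
Qed.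

Lemma cauchy_riemann_continuous u v x y : cauchy_riemann u v x y ->
  {for y, continuous (u x)} /\ {for x, continuous (v ^~ y)}.
Proof.
move=> [al [be /(_ 1 ltr01)[d d0 H]]].
have n0 : `|0 : R| < d by rewrite normr0.
split; apply: (@local_lipschitz_continuous _ _ (1 + `|be|) d) => // h hd.
  have [+ _] := H 0 h n0 hd.
  rewrite addr0 mulr0 sub0r opprK normr0 add0r mul1r => H1.
  rewrite mulrDl mul1r -normrM -[X in `|X|](addrK (be * h)).
  by rewrite (le_trans (ler_normB _ _))// lerD2r.
have [_] := H h 0 hd n0.
rewrite addr0 mulr0 addr0 normr0 addr0 mul1r => H1.
rewrite mulrDl mul1r -normrM -[X in `|X|](subrK (be * h)).
by rewrite (le_trans (ler_normD _ _))// lerD2r.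
Qed.

(** The contour integral of a small rectangle around [(s, y)], each pair of opposite sides being
    evaluated at a mean-value point, [y3] or [x3]. The linear parts contribute
    [al * (x2 - x1) * (y2 - y1)] twice with opposite signs; only remainders survive. *)
Lemma cauchy_riemann_increment u v s y : cauchy_riemann u v s y ->
  forall e, 0 < e -> exists2 d, 0 < d & forall x1 x2 x3 y1 y2 y3,
    s \in `[x1, x2] -> x3 \in `[x1, x2] -> y \in `[y1, y2] -> y3 \in `[y1, y2] ->
    x2 - x1 < d -> y2 - y1 < d ->
    `|(u x2 y3 - u x1 y3) * (y2 - y1) - (v x3 y2 - v x3 y1) * (x2 - x1)|
    <= e * ((x2 - x1) + (y2 - y1)) ^+ 2.
Proof.
move=> [al [be H]] e e0; have [|d d0 {}H] := H (e / 4); first by rewrite divr_gt0.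
exists d => // x1 x2 x3 y1 y2 y3 sx x3x yy y3y xd yd.
have dist (a b c z : R) : c \in `[a, b] -> z \in `[a, b] -> `|c - z| <= b - a.
  rewrite !in_itv /= => /andP[h1 h2] /andP[h3 h4].
  by rewrite ler_norml; apply/andP; split; clear -h1 h2 h3 h4; lra.
have [w0 h0] : 0 <= x2 - x1 /\ 0 <= y2 - y1.
  by split; [apply: le_trans (dist _ _ _ _ sx x3x)|apply: le_trans (dist _ _ _ _ yy y3y)].
have [x1x2 y1y2] : x1 <= x2 /\ y1 <= y2 by rewrite !subr_ge0 in w0 h0.
have x1x : x1 \in `[x1, x2] by rewrite in_itv /= lexx.
have x2x : x2 \in `[x1, x2] by rewrite in_itv /= lexx andbT.
have y1y : y1 \in `[y1, y2] by rewrite in_itv /= lexx.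
have y2y : y2 \in `[y1, y2] by rewrite in_itv /= lexx andbT.
have {}H a b : a \in `[x1, x2] -> b \in `[y1, y2] ->
    `|u a b - u s y - (al * (a - s) - be * (b - y))|
      <= e / 4 * ((x2 - x1) + (y2 - y1)) /\
    `|v a b - v s y - (be * (a - s) + al * (b - y))|
      <= e / 4 * ((x2 - x1) + (y2 - y1)).
  move=> ax bx; have As := dist _ _ _ _ ax sx; have Bs := dist _ _ _ _ bx yy.
  have := H _ _ (le_lt_trans As xd) (le_lt_trans Bs yd).
  rewrite !subrKC => -[h1 h2].
  by split; [apply: le_trans h1 _|apply: le_trans h2 _]; rewrite ler_wpM2l ?lerD// divr_ge0// ltW.
have [E2 _] := H _ _ x2x y3y; have [E1 _] := H _ _ x1x y3y.
have [_ E4] := H _ _ x3x y2y; have [_ E3] := H _ _ x3x y1y.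
clear -w0 h0 E1 E2 E3 E4 e0.
set w := x2 - x1 in w0 E1 E2 E3 E4 *; set h := y2 - y1 in h0 E1 E2 E3 E4 *.
have -> : (u x2 y3 - u x1 y3) * h - (v x3 y2 - v x3 y1) * w =
   ((u x2 y3 - u s y - (al * (x2 - s) - be * (y3 - y))) -
    (u x1 y3 - u s y - (al * (x1 - s) - be * (y3 - y)))) * h -
   ((v x3 y2 - v s y - (be * (x3 - s) + al * (y2 - y))) -
    (v x3 y1 - v s y - (be * (x3 - s) + al * (y1 - y)))) * w.
  by rewrite /w /h; ring.
apply: le_trans (ler_normB _ _) _; rewrite !normrM (ger0_norm w0) (ger0_norm h0).
have K (p q : R) : `|p| <= e / 4 * (w + h) -> `|q| <= e / 4 * (w + h) ->
   `|p - q| <= e / 2 * (w + h).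
  by move=> Hp Hq; apply: le_trans (ler_normB _ _) _; clear -Hp Hq; lra.
have K1 := ler_wpM2r h0 (K _ _ E2 E1).
have K2 := ler_wpM2r w0 (K _ _ E4 E3).
apply: le_trans (lerD K1 K2) _.
have -> : e / 2 * (w + h) * h + e / 2 * (w + h) * w = e / 2 * (w + h) ^+ 2 by clear; ring.
rewrite ler_wpM2r ?sqr_ge0//.
by rewrite ler_pdivrMr// ler_peMr ?ltW// ltr1n.
Qed.

(* In the coordinates [z = exp (x + i y)] of a punctured disc, the mean of [u] over a period
   in [y] does not depend on [x] and tends to [u0] as [x] tends to [-oo]. *)
Lemma mean_value_periodic u v (B T u0 M x : R) : 0 < T -> x < B ->
  (forall x y, x < B -> cauchy_riemann u v x y) ->
  (forall x, x < B -> v x T = v x 0) ->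
  (forall y, u x y <= M) ->
  (forall e, 0 < e -> exists A, forall x y, x <= A -> `|u x y - u0| <= e) ->
  u0 <= M.
Proof.
move=> T0 xB CR vT uM ulim; rewrite leNgt; apply/negP => Mu0.
have [|A HA] := ulim ((u0 - M) / 2); first by rewrite divr_gt0// subr_gt0.
(* Far enough to the left for [u] to be close to [u0] there, and strictly left of [x]. *)
pose a := Num.min A (x - 1).
have aA : a <= A by rewrite ge_min lexx.
have ax : a < x by rewrite (@le_lt_trans _ _ (x - 1)) ?ge_min ?lexx ?orbT//; lra.
have /choice[U HU] : forall s, exists Us : R -> R, s < B -> forall y, -1 < y < T + 1 ->
    is_derive y 1 Us (u s y).
  move=> s; have [sB|_] := ltP s B; last by exists (cst 0).
  have [|Us HUs] := @primitive_exists (u s) (- 1) (T + 1).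
    by move=> y _; have [] := cauchy_riemann_continuous (CR s y sB).
  by exists Us.
have /choice[V HV] : forall y, exists Vy : R -> R, forall s, a - 1 < s < B ->
    is_derive s 1 Vy (v s y).
  move=> y; have [|Vy HVy] := @primitive_exists (v ^~ y) (a - 1) B.
    by move=> s /andP[_ sB]; have [] := cauchy_riemann_continuous (CR s y sB).
  by exists Vy.
(* [U s] is a primitive of [u] in [y], [V y] one of [v] in [s]: the mixed difference is the
   imaginary part of the contour integral of [u + iv], and this is Cauchy's theorem for a
   rectangle. *)
have box0 : mixed_diff (fun s y => U s y - V y s) a x 0 T = 0.
  apply: mixed_diff_eq0; [exact: ltW|exact: ltW|].
  move=> s y /andP[as_ sx] /andP[y0 yT] e e0.
  have sB : s < B by exact: le_lt_trans sx xB.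
  have [d d0 H] := cauchy_riemann_increment (CR s y sB) e0.
  exists d => // x1 x2 y1 y2 /andP[ax1 x1s] /andP[sx2 x2x] /andP[y10 y1y] /andP[yy2 y2T] xd yd.
  have x1B : x1 < B by exact: le_lt_trans x1s sB.
  have x2B : x2 < B by exact: le_lt_trans x2x xB.
  have [||y3 y13 Uy] := @MVT_closed (U x2 - U x1) (u x2 - u x1) y1 y2.
  - exact: le_trans yy2.
  - move=> z /andP[z1 z2].
    have zT : -1 < z < T + 1 by apply/andP; split; clear -z1 z2 y10 y2T; lra.
    by apply: is_deriveB; exact: HU.
  have [||x3 x13 Vx] := @MVT_closed (V y2 - V y1) (v ^~ y2 - v ^~ y1) x1 x2.
  - exact: le_trans sx2.
  - move=> z /andP[z1 z2].
    have zB : a - 1 < z < B by apply/andP; split; clear -z1 z2 ax1 x2x xB; lra.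
    by apply: is_deriveB; exact: HV.
  have -> : mixed_diff (fun s y => U s y - V y s) x1 x2 y1 y2 =
    ((U x2 - U x1) y2 - (U x2 - U x1) y1) - ((V y2 - V y1) x2 - (V y2 - V y1) x1).
    by rewrite /mixed_diff !fctE; clear; ring.
  rewrite Uy Vx !fctE; apply: H => //; rewrite in_itv/=; exact/andP.
(* Periodicity of [v] makes the two horizontal sides cancel, so the integrals of [u] over the
   vertical sides agree. *)
have V0 : V T x - V T a = V 0 x - V 0 a.
  have [||z /andP[_ zx]] := @MVT_closed (V T - V 0) (v ^~ T - v ^~ 0) a x.
  - exact: ltW.
  - by move=> z /andP[az zx]; apply: is_deriveB; apply: HV; apply/andP; split; lra.
  rewrite !fctE vT ?(le_lt_trans zx)// subrr mul0r => E.
    by clear -E; lra.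
have [||ya _ Ea] := @MVT_closed (U a) (u a) 0 T.
- exact: ltW.
- by move=> z /andP[z1 z2]; apply: HU; [lra|apply/andP; split; clear -z1 z2; lra].
have [||yx _ Ex] := @MVT_closed (U x) (u x) 0 T.
- exact: ltW.
- by move=> z /andP[z1 z2]; apply: HU; [lra|apply/andP; split; clear -z1 z2; lra].
move: box0; rewrite /mixed_diff => box0.
have E : (u x yx - u a ya) * T = 0.
  move: Ea Ex; rewrite subr0 mulrBl => <- <-; move: box0 V0; clear; lra.
move/eqP: E; rewrite mulf_eq0 (gt_eqF T0) orbF subr_eq0 => /eqP E.
have := uM yx; have := HA a ya aA; rewrite ler_norml -E => /andP[]; move: Mu0; clear; lra.
Qed.
End CauchyRiemann.

(** * Directional derivatives as first-order expansions *)

Section DirectionalDerivative.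
Variables (R : realType) (V : normedModType R).
Implicit Types (f : V -> R) (x v : V).

Lemma is_derive_expansion f x v l : is_derive x v f l ->
  forall e, 0 < e -> exists2 d, 0 < d &
    forall h : R, `|h| < d -> `|f (x + h *: v) - f x - l * h| <= e * `|h|.
Proof.
move=> [dfx lE] e e0; move: dfx => /derivable_nbhs /eqaddoP/(_ _ e0).
move=> /nbhs_ballP[d /= d0 H]; exists d => // h hd.
have := H h; rewrite /ball /= sub0r normrN => /(_ hd) /=.
by rewrite !fctE /= lE [h *: v + x]addrC opprD addrA [l * h]mulrC.
Qed.

Lemma expansion_is_derive f x v l :
  (forall e, 0 < e -> exists2 d, 0 < d &
    forall h : R, `|h| < d -> `|f (x + h *: v) - f x - l * h| <= e * `|h|) ->
  is_derive x v f l.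
Proof.
move=> H.
have Hc : h^-1 *: (f (h *: v + x) - f x) @[h --> 0^'] --> l.
  apply/cvgrPdist_le => /= e e0; have [d d0 {}H] := H e e0.
  exists d => //= h; rewrite /ball /= sub0r normrN => hd h0.
  rewrite distrC -(ler_pM2r (x := `|h|)) ?normr_gt0// -normrM mulrBl.
  by rewrite /GRing.scale /= mulrAC mulVf// mul1r [_ *: v + x]addrC; exact: H.
apply: DeriveDef; first by apply/cvg_ex; exists l.
exact/cvg_lim.
Qed.

End DirectionalDerivative.

(** * The real-valued modulus *)

Section ComplexNorm.
Variable R : realType.
Notation C := (CC R).
Notation nc := (@Normc.normc R).
Implicit Types (x y z : C).

Lemma ncM x y : nc (x * y) = nc x * nc y.
Proof. exact: Normc.normcM. Qed.
Lemma ncV x : nc x^-1 = (nc x)^-1.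
Proof. exact: Normc.normcV. Qed.
Lemma ncD x y : nc (x + y) <= nc x + nc y.
Proof. exact: le_normcD. Qed.
Lemma ncN x : nc (- x) = nc x.
Proof. exact: normcN. Qed.
Lemma ncB x y : nc (x - y) <= nc x + nc y.
Proof. by rewrite -(ncN y) ncD. Qed.
Lemma nc_distrC x y : nc (x - y) = nc (y - x).
Proof. by rewrite -ncN opprB. Qed.
Lemma nc0 : nc (0 : C) = 0.
Proof. exact: Normc.normc0. Qed.
Lemma nc1 : nc (1 : C) = 1.
Proof. exact: Normc.normc1. Qed.
Lemma nc_ge0 x : 0 <= nc x.
Proof. by case: x => a b; exact: sqrtr_ge0. Qed.
Lemma nc_eq0 x : (nc x == 0) = (x == 0).
Proof. by apply/eqP/eqP => [/Normc.eq0_normc|->]; rewrite ?nc0. Qed.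
Lemma nc_gt0 x : (0 < nc x) = (x != 0).
Proof. by rewrite lt_def nc_ge0 andbT nc_eq0. Qed.
Lemma nc_sqr x : nc x ^+ 2 = complex.Re x ^+ 2 + complex.Im x ^+ 2.
Proof. by case: x => a b; rewrite /Normc.normc sqr_sqrtr// addr_ge0// sqr_ge0. Qed.
Lemma nc_Re x : `|complex.Re x| <= nc x.
Proof.
rewrite -(@ler_pXn2r _ 2) ?nnegrE ?nc_ge0// nc_sqr -normrX ger0_norm ?sqr_ge0//.
by rewrite lerDl sqr_ge0.
Qed.
Lemma nc_Im x : `|complex.Im x| <= nc x.
Proof.
rewrite -(@ler_pXn2r _ 2) ?nnegrE ?nc_ge0// nc_sqr -normrX ger0_norm ?sqr_ge0//.
by rewrite lerDr sqr_ge0.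
Qed.
Lemma nc_real (a : R) : nc (a%:C%C : C) = `|a|.
Proof. by rewrite /Normc.normc /= expr0n /= addr0 sqrtr_sqr. Qed.
Lemma nc_imag (a : R) : nc (Complex 0 a : C) = `|a|.
Proof. by rewrite /Normc.normc /= expr0n /= add0r sqrtr_sqr. Qed.
Lemma nc_le_ReIm x : nc x <= `|complex.Re x| + `|complex.Im x|.
Proof.
have -> : x = (complex.Re x)%:C%C + Complex 0 (complex.Im x).
  by case: x => a b; apply/eqP; rewrite eq_complex /= addr0 add0r !eqxx.
by apply: le_trans (ncD _ _) _; rewrite nc_real nc_imag /= addr0 add0r.
Qed.
Lemma ReB x y : complex.Re (x - y) = complex.Re x - complex.Re y.
Proof. by case: x => a b; case: y. Qed.
Lemma ReD x y : complex.Re (x + y) = complex.Re x + complex.Re y.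
Proof. by case: x => a b; case: y. Qed.
Lemma ImB x y : complex.Im (x - y) = complex.Im x - complex.Im y.
Proof. by case: x => a b; case: y. Qed.
Lemma ImD x y : complex.Im (x + y) = complex.Im x + complex.Im y.
Proof. by case: x => a b; case: y. Qed.
Lemma norm_nc x : `|x| = (nc x)%:C%C.
Proof. by []. Qed.

End ComplexNorm.

(** * The maximum modulus principle in a punctured disc *)

Section OneVariable.
Variable R : realType.
Notation C := (CC R).
Notation nc := (@Normc.normc R).
Implicit Types (f g : C -> C) (z w : C).

(** Stated with real [e], [d] and moduli because the norm on [CC R] takes values in [CC R];
    [cderivP] identifies it with the library derivative. *)
Definition cderiv f z (l : C) := forall e, 0 < e -> exists2 d, 0 < d &
  forall h : C, nc h < d -> nc (f (z + h) - f z - l * h) <= e * nc h.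

Definition cexp (x y : R) : C := Complex (expR x * cos y) (expR x * sin y).

Lemma nc_cexp x y : nc (cexp x y) = expR x.
Proof.
have -> : nc (cexp x y) = Num.sqrt (expR x ^+ 2).
  by rewrite /cexp /Normc.normc /= !exprMn -mulrDr (cos2Dsin2 y) mulr1.
by rewrite sqrtr_sqr ger0_norm ?expR_ge0.
Qed.

Lemma cexpD x y s t : cexp (x + s) (y + t) = cexp x y * cexp s t.
Proof.
apply/eqP; rewrite eq_complex /= expRD cosD sinD; apply/andP; split; apply/eqP.
  by ring.
by ring.
Qed.

Lemma cexp_2pi x : cexp x (pi *+ 2) = cexp x 0.
Proof. by rewrite /cexp -[_ *+ _]add0r cosD2pi sinD2pi. Qed.

Lemma cexp_expansion0 e : 0 < e -> exists2 d, 0 < d &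
  forall s t : R, `|s| < d -> `|t| < d ->
    nc (cexp s t - 1 - Complex s t : C) <= e * (`|s| + `|t|).
Proof.
move=> e0.
(* The four error terms below total at most [e1 * |s| + 8 * e1 * |t|], whence the [8]. *)
have [e1 [e10 e11 e1e]] : exists e1 : R, [/\ 0 < e1, e1 <= 1 & e1 * 8 <= e].
  exists (Num.min 1 (e / 8)); split; first by rewrite lt_min ltr01 divr_gt0.
    by rewrite ge_min lexx.
  by rewrite -ler_pdivlMr// ge_min lexx orbT.
have [d1 d10 H1] := is_derive_expansion (is_derive_expR (0 : R)) e10.
have [d2 d20 H2] := is_derive_expansion (is_derive_sin (0 : R)) e10.
have [d3 d30 H3] := is_derive_expansion (is_derive_cos (0 : R)) e10.
exists (Num.min e1 (Num.min d1 (Num.min d2 d3))).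
  by rewrite !lt_min e10 d10 d20.
move=> s t; rewrite !lt_min => /and4P[se sd1 _ _] /and4P[te _ td2 td3].
have {H1} := H1 _ sd1; have {H2} := H2 _ td2; have {H3} := H3 _ td3.
rewrite expR0 sin0 cos0 !oppr0 /GRing.scale /= !mulr1 !add0r mul0r !mul1r !subr0 ?addr0.
rewrite /cexp; move: (expR s) (sin t) (cos t) => x u c Hc Hu Hx.
have Hx1 : `|x - 1| <= 2 * `|s|.
  have -> : x - 1 = (x - 1 - s) + s by ring.
  apply: le_trans (ler_normD _ _) _; rewrite mulrDl mul1r lerD2r (le_trans Hx)//.
  by rewrite ler_piMl.
have Hx3 : `|x| <= 3.
  have -> : x = (x - 1) + 1 by ring.
  apply: le_trans (ler_normD _ _) _; rewrite normr1.
  by move: Hx1 (ltW se) e11; clear; lra.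
have T : nc (Complex (x * c) (x * u) - 1 - Complex s t : C) <=
    `|x - 1 - s| + `|x * (c - 1)| + (`|x * (u - t)| + `|(x - 1) * t|).
  apply: le_trans (nc_le_ReIm _) _; rewrite !ReB !ImB /=.
  have -> : x * c - 1 - s = (x - 1 - s) + x * (c - 1) by ring.
  have -> : x * u - 0 - t = x * (u - t) + (x - 1) * t by ring.
  by rewrite lerD// ler_normD.
apply: le_trans T _.
have B1 : `|x * (c - 1)| <= 3 * (e1 * `|t|) by rewrite normrM ler_pM.
have B2 : `|x * (u - t)| <= 3 * (e1 * `|t|). by rewrite normrM ler_pM.
have B3 : `|(x - 1) * t| <= 2 * e1 * `|t|.
  rewrite normrM ler_wpM2r// (le_trans Hx1)// ler_wpM2l//; exact: ltW.
have B4 : 8 * (e1 * `|s|) + 8 * (e1 * `|t|) <= e * (`|s| + `|t|).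
  have -> : 8 * (e1 * `|s|) + 8 * (e1 * `|t|) = (e1 * 8) * (`|s| + `|t|) by ring.
  by rewrite ler_wpM2r// addr_ge0.
have B5 : 0 <= e1 * `|s| by rewrite mulr_ge0// ltW.
by move: Hx B1 B2 B3 B4 B5; clear; lra.
Qed.

(** Chain rule: the exponential has derivative [z] at [x + iy], so the composite has complex
    derivative [l * z]. *)
Lemma cderiv_cexp_cauchy_riemann f l x y : cderiv f (cexp x y) l ->
  cauchy_riemann (fun s t => complex.Re (f (cexp s t)))
    (fun s t => complex.Im (f (cexp s t))) x y.
Proof.
move=> fl; set z := cexp x y in fl *.
exists (complex.Re (l * z)), (complex.Im (l * z)) => e e0.
have nz : nc z = expR x by exact: nc_cexp.
have nz0 : 0 < nc z by rewrite nz expR_gt0.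
pose K := nc z * 2 + 1.
have K0 : 0 < K by rewrite /K addr_gt0// mulr_gt0.
have [|d1 d10 H1] := fl (e / 2 / K); first by rewrite !divr_gt0.
pose e2 := Num.min 1 (e / 2 / (nc l * nc z + 1)).
have L0 : 0 < nc l * nc z + 1 by rewrite ltr_wpDl// mulr_ge0// nc_ge0.
have e20 : 0 < e2 by rewrite lt_min ltr01 !divr_gt0.
have [d2 d20 H2] := cexp_expansion0 e20.
exists (Num.min d2 (d1 / K / 2)); first by rewrite lt_min d20 !divr_gt0.
move=> s t; rewrite !lt_min => /andP[s2 sd] /andP[t2 td].
have {H2} := H2 s t s2 t2; set E := cexp s t => HE.
have H2 : nc (z * E - z - z * Complex s t) <= nc z * (e2 * (`|s| + `|t|)).
  have -> : z * E - z - z * Complex s t = z * (E - 1 - Complex s t) by ring.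
  by rewrite ncM ler_wpM2l// nc_ge0.
have st0 : 0 <= `|s| + `|t| by rewrite addr_ge0.
have nst : nc (Complex s t : C) <= `|s| + `|t| by apply: le_trans (nc_le_ReIm _) _.
have H3 : nc (z * E - z) <= K * (`|s| + `|t|).
  have -> : z * E - z = (z * E - z - z * Complex s t) + z * Complex s t by ring.
  apply: le_trans (ncD _ _) _; rewrite [nc (_ * Complex s t)]ncM.
  have A1 : nc z * nc (Complex s t : C) <= nc z * (`|s| + `|t|) by rewrite ler_wpM2l// nc_ge0.
  have A2 : nc z * (e2 * (`|s| + `|t|)) <= nc z * (`|s| + `|t|).
    by rewrite ler_wpM2l ?nc_ge0// ler_piMl// ge_min lexx.
  by rewrite /K; move: H2 A1 A2 st0; clear; lra.
have H4 : nc (z * E - z) < d1.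
  apply: (le_lt_trans H3); rewrite mulrC -ltr_pdivlMr// [X in _ < X]splitr.
  by rewrite ltrD.
have {H4} := H1 _ H4.
rewrite subrKC => H4.
have Ez : cexp (x + s) (y + t) = z * E by exact: cexpD.
have M : nc (f (z * E) - f z - l * z * Complex s t) <= e * (`|s| + `|t|).
  have -> : f (z * E) - f z - l * z * Complex s t =
    (f (z * E) - f z - l * (z * E - z)) + l * (z * E - z - z * Complex s t) by ring.
  apply: le_trans (ncD _ _) _.
  have -> : e * (`|s| + `|t|) = e / 2 * (`|s| + `|t|) + e / 2 * (`|s| + `|t|) by rewrite -mulrDl -splitr.
  apply: lerD.
    apply: le_trans H4 _; apply: le_trans (ler_wpM2l _ H3) _; first by rewrite !divr_ge0// ltW.
    by rewrite mulrA divfK// gt_eqF.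
  rewrite ncM; apply: le_trans (ler_wpM2l (nc_ge0 _) H2) _.
  rewrite !mulrA ler_wpM2r//.
  apply: (@le_trans _ _ ((nc l * nc z + 1) * (e / 2 / (nc l * nc z + 1)))).
    by rewrite ler_pM// ?mulr_ge0 ?nc_ge0// ?(ltW e20)// ?lerDl// ge_min lexx orbT.
  by rewrite mulrC divfK// gt_eqF.
have RI : complex.Re (l * z * Complex s t) = complex.Re (l * z) * s - complex.Im (l * z) * t.
  by case: (l * z).
have II : complex.Im (l * z * Complex s t) = complex.Im (l * z) * s + complex.Re (l * z) * t.
  by case: (l * z) => p q /=; ring.
rewrite Ez -RI -II -!ReB -!ImB; split; apply: le_trans M; [exact: nc_Re|exact: nc_Im].
Qed.

(** In the coordinate [ln |z|] the circle of radius [r] lies strictly inside the half-plane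
    [x < ln (r *+ 2)], and the centre sits at [-oo], where only the limit [g0] is seen. The value of
    [f] at [0] is therefore irrelevant, as for a difference quotient. *)
Lemma max_modulus_Re f (g0 : C) (r M : R) : 0 < r ->
  (forall z, 0 < nc z < r *+ 2 -> exists l, cderiv f z l) ->
  (forall e, 0 < e -> exists2 d, 0 < d & forall z, 0 < nc z < d -> nc (f z - g0) <= e) ->
  (forall z, nc z = r -> nc (f z) <= M) -> complex.Re g0 <= M.
Proof.
move=> r0 fd f0 fM.
pose B := ln (r *+ 2).
have r20 : 0 < r *+ 2 by rewrite pmulrn_rgt0.
have rE : expR (ln r) = r by rewrite lnK.
have xB : ln r < B by rewrite ltr_ln// mulr2n ltrDl.
apply: (@mean_value_periodic R (fun s t => complex.Re (f (cexp s t)))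
    (fun s t => complex.Im (f (cexp s t))) B (pi *+ 2) _ _ (ln r)) => //.
- by rewrite pmulrn_rgt0// pi_gt0.
- move=> x y xltB; have [|l fl] := fd (cexp x y).
    by rewrite nc_cexp expR_gt0 -[r *+ 2]lnK// ltr_expR.
  exact: cderiv_cexp_cauchy_riemann fl.
- by move=> x _; rewrite cexp_2pi.
- move=> y; apply: le_trans (ler_norm _) _; apply: le_trans (nc_Re _) _.
  by apply: fM; rewrite nc_cexp.
- move=> e e0; have [d d0 H] := f0 e e0.
  exists (ln d - 1) => x y xd; rewrite -ReB; apply: le_trans (nc_Re _) _.
  apply: H; rewrite nc_cexp expR_gt0 /= -[ltRHS]lnK// ltr_expR.
  by rewrite (le_lt_trans xd)// ltrBlDr ltrDl.
Qed.

Lemma cderivM f z l (c : C) : cderiv f z l -> cderiv (fun w => c * f w) z (c * l).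
Proof.
move=> fl e e0.
have c0 : 0 < nc c + 1 by rewrite ltr_wpDl// nc_ge0.
have [|d d0 H] := fl (e / (nc c + 1)); first by rewrite divr_gt0.
exists d => // h hd; have -> : c * f (z + h) - c * f z - c * l * h = c * (f (z + h) - f z - l * h) by ring.
rewrite ncM; apply: (@le_trans _ _ ((nc c + 1) * (e / (nc c + 1) * nc h))).
  by rewrite ler_pM ?nc_ge0// ?H// lerDl.
by rewrite mulrA mulrCA divff ?mulr1// gt_eqF.
Qed.

(* Multiplying by the conjugate of the central value turns the bound on its real part into
   one on its modulus. *)
Lemma max_modulus f (g0 : C) (r M : R) : 0 < r ->
  (forall z, 0 < nc z < r *+ 2 -> exists l, cderiv f z l) ->
  (forall e, 0 < e -> exists2 d, 0 < d & forall z, 0 < nc z < d -> nc (f z - g0) <= e) ->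
  (forall z, nc z = r -> nc (f z) <= M) -> nc g0 <= M.
Proof.
move=> r0 fd f0 fM.
have [g00|g00] := eqVneq g0 0.
  rewrite g00 nc0; apply: le_trans (nc_ge0 _) (fM r%:C%C _).
  by rewrite nc_real gtr0_norm.
have n0 : 0 < nc g0 by rewrite nc_gt0.
pose c : C := (g0^*)%C.
have nJ : nc c = nc g0 by rewrite /c; case: (g0) => a b; rewrite /Normc.normc /= sqrrN.
have := @max_modulus_Re (fun z => c * f z) (c * g0) r (nc c * M) r0.
have -> : complex.Re (c * g0) = nc g0 * nc g0.
  rewrite -expr2 nc_sqr /c; case: (g0) => a b /=; ring.
rewrite nJ ler_pM2l//; apply.
- by move=> z /fd[l fl]; exists (c * l); exact: cderivM.
- move=> e e0; have [|d d0 H] := f0 (e / nc g0); first by rewrite divr_gt0.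
  exists d => // z zd; rewrite -mulrBr ncM nJ mulrC -ler_pdivlMr//; exact: H.
- by move=> z zr; rewrite ncM nJ ler_pM2l//; exact: fM.
Qed.

End OneVariable.

(** * Holomorphic functions of several variables *)

Lemma ltr0c (R : realType) (r : R) : ((0 : CC R) < r%:C%C) = (0 < r).
Proof. exact: (ltcR 0 r). Qed.

Section RealNorm.
Variables (R : realType) (n : nat).
Notation C := (CC R).
Notation nc := (@Normc.normc R).
Implicit Types (v w : 'rV[C]_n) (t : C).

Lemma CC_gt0E (e : C) : 0 < e -> exists2 r : R, 0 < r & e = r%:C%C.
Proof. by case: e => a b; rewrite ltcE /= => /andP[/eqP -> a0]; exists a. Qed.

(* The library norm of a vector over [CC R] is a complex number. *)
Definition rnorm v : R := complex.Re `|v|.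

Lemma rnormE v : `|v| = (rnorm v)%:C%C.
Proof.
rewrite /rnorm; have := normr_ge0 v; case: `|v| => a b.
by rewrite lecE /= => /andP[/eqP -> _].
Qed.

Lemma rnorm_ge0 v : 0 <= rnorm v.
Proof. by have := normr_ge0 v; rewrite rnormE ler0c. Qed.

Lemma rnorm0 : rnorm 0 = 0.
Proof. by rewrite /rnorm normr0. Qed.

Lemma rnormD v w : rnorm (v + w) <= rnorm v + rnorm w.
Proof. by have := ler_normD v w; rewrite !rnormE -rmorphD lecR. Qed.

Lemma rnormN v : rnorm (- v) = rnorm v.
Proof. by rewrite /rnorm normrN. Qed.

Lemma rnorm_distrC v w : rnorm (v - w) = rnorm (w - v).
Proof. by rewrite -rnormN opprB. Qed.

Lemma rnormZ t v : rnorm (t *: v) = nc t * rnorm v.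
Proof. by apply: complexI; rewrite -rnormE normrZ rnormE rmorphM. Qed.

Lemma rnorm_eq0 v : rnorm v = 0 -> v = 0.
Proof. by move=> v0; apply/normr0_eq0; rewrite rnormE v0. Qed.

Lemma rnorm_ltP v r : rnorm v < r <-> 0 < r /\ forall k, nc (v 0 k) < r.
Proof.
have <- : ball (0 : 'rV[C]_n) r%:C%C v = (rnorm v < r) :> Prop.
  by rewrite mx_norm_ball /ball_ /= sub0r normrN rnormE ltcR.
have E k : ball ((0 : 'rV[C]_n) 0 k) r%:C%C (v 0 k) = (nc (v 0 k) < r) :> Prop.
  by rewrite /ball /= mxE sub0r normrN norm_nc ltcR.
split=> [[r0 H]|[r0 H]].
  by split=> [|k]; [rewrite ltr0c in r0|rewrite -E; exact: H].
by split=> [|i k]; [rewrite ltr0c|rewrite (ord1 i) E].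
Qed.

Lemma rnorm_coord v k : nc (v 0 k) <= rnorm v.
Proof.
apply/ler_addgt0Pr => e e0; apply: ltW.
have /rnorm_ltP[_] : rnorm v < rnorm v + e by rewrite ltrDl.
exact.
Qed.

Lemma nbhs_rnorm (a : 'rV[C]_n) (U : set 'rV[C]_n) :
  nbhs a U <-> exists2 r : R, 0 < r & forall w, rnorm (w - a) < r -> U w.
Proof.
split=> [/nbhs_ballP[e /CC_gt0E[r r0 ->] H]|[r r0 H]].
  by exists r => // w wr; apply: H; rewrite mx_norm_ball /ball_ /= distrC rnormE ltcR.
apply/nbhs_ballP; exists r%:C%C => [|w]; first by rewrite /= ltr0c.
by rewrite mx_norm_ball /ball_ /= distrC rnormE ltcR; exact: H.
Qed.

Lemma differentiable_expansion (f : 'rV[C]_n -> C) a :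
  differentiable (f : _ -> C^o) a ->
  forall e : R, 0 < e -> exists2 d : R, 0 < d & forall h, rnorm h < d ->
    nc (f (a + h) - f a - 'd (f : _ -> C^o) a h) <= e * rnorm h.
Proof.
move=> df e e0; have [_] := (diff_locallyP _ _).1 df.
move=> /eqaddoP /(_ e%:C%C); rewrite ltr0c => /(_ e0) /nbhs_rnorm[d d0 H].
exists d => // h hd; have := H h; rewrite subr0 => /(_ hd).
rewrite !fctE /= rnormE -rmorphM /= [h + a]addrC opprD addrA.
by rewrite [`|_|]norm_nc lecR.
Qed.

(** The differential is supplied through a comparison function [g], so a limit of differentials can
    be given by an explicit formula without first being packaged as a continuous linear map. *)
Lemma expansion_differentiable (f g : 'rV[C]_n -> C) a :
  differentiable (g : _ -> C^o) a ->
  (forall e : R, 0 < e -> exists2 d : R, 0 < d & forall h, rnorm h < d ->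
    nc ((f (a + h) - f a) - (g (a + h) - g a)) <= e * rnorm h) ->
  differentiable (f : _ -> C^o) a.
Proof.
move=> dg H.
have dgc : continuous ('d (g : _ -> C^o) a) by exact: diff_continuous.
have E : (f : _ -> C^o) \o shift a = cst (f a) + 'd (g : _ -> C^o) a +o_ 0 id.
  apply/eqaddoP => e' /CC_gt0E[e e0 ->].
  have [|d1 d10 H1] := differentiable_expansion dg (e := e / 2); first by rewrite divr_gt0.
  have [|d2 d20 H2] := H (e / 2); first by rewrite divr_gt0.
  apply/nbhs_rnorm; exists (Num.min d1 d2) => [|h]; first by rewrite lt_min d10.
  rewrite subr0 lt_min => /andP[/H1 {}H1 /H2 {}H2].
  rewrite !fctE /= rnormE -rmorphM /= [h + a]addrC [`|_|]norm_nc lecR.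
  have -> : f (a + h) - (f a + 'd (g : _ -> C^o) a h) =
    (f (a + h) - f a - (g (a + h) - g a)) + (g (a + h) - g a - 'd (g : _ -> C^o) a h) by ring.
  apply: le_trans (ncD _ _) _; rewrite [e]splitr mulrDl; exact: lerD.
by apply/diff_locallyP; rewrite (diff_unique dgc E).
Qed.

End RealNorm.

(** * Comparison with the library derivative on [CC R] *)

Section Bridge.
Variable R : realType.
Notation C := (CC R).
Notation nc := (@Normc.normc R).

Lemma nbhs_nc (a : C) (U : set C) :
  nbhs a U <-> exists2 r : R, 0 < r & forall w, nc (w - a) < r -> U w.
Proof.
split=> [/nbhs_ballP[e /CC_gt0E[r r0 ->] H]|[r r0 H]].
  by exists r => // w wr; apply: H; rewrite /ball /= distrC norm_nc ltcR.
apply/nbhs_ballP; exists r%:C%C => [|w]; first by rewrite /= ltr0c.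
by rewrite /ball /= distrC norm_nc ltcR; exact: H.
Qed.

Lemma cderivP (f : C -> C) z l : cderiv f z l <-> is_derive (z : C^o) 1 (f : C^o -> C^o) l.
Proof.
split => [H|[df dl] e e0].
  have Hc : h^-1 *: ((f : C^o -> C^o) (h *: (1 : C^o) + z) - f z) @[h --> 0^'] --> (l : C^o).
    apply/cvgrPdist_le => /= e' /CC_gt0E[e e0 ->].
    have [d d0 {}H] := H _ e0.
    exists d%:C%C => /=; first by rewrite ltr0c.
    move=> h; rewrite /ball /= sub0r normrN norm_nc ltcR => hd h0.
    rewrite distrC [`|_|]norm_nc lecR -(ler_pM2r (x := nc h)) ?nc_gt0// -ncM mulrBl.
    by rewrite /GRing.scale /= mulrAC mulVf// mul1r mulr1 [h + z]addrC; exact: H.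
  apply: DeriveDef; first by apply/cvg_ex; exists l.
  exact/cvg_lim.
have := df => /derivable_nbhs /eqaddoP/(_ e%:C%C); rewrite ltr0c => /(_ e0) /nbhs_nc[d d0 H].
exists d => // h hd; have := H h; rewrite subr0 => /(_ hd).
rewrite !fctE /= dl norm_nc -rmorphM /= /GRing.scale /= mulr1 [h + z]addrC opprD addrA.
by rewrite lecR [l * h]mulrC.
Qed.

End Bridge.

(** * Derivative bounds in one variable *)

Section OneVariableBounds.
Variable R : realType.
Notation C := (CC R).
Notation nc := (@Normc.normc R).

(* The maximum principle, with a puncture, for the difference quotient at [0]. *)
Lemma cderiv_le (f : C -> C) (l : C) (r M : R) : 0 < r ->
  (forall z, nc z < r *+ 2 -> exists l, cderiv f z l) ->
  (forall z, nc z < r *+ 2 -> nc (f z) <= M) ->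
  cderiv f 0 l -> nc l <= M *+ 2 / r.
Proof.
move=> r0 fd fM f0.
have r2 : r < r *+ 2 by rewrite mulr2n ltrDl.
apply: (@max_modulus R (fun z => (f z - f 0) / z) l r) => //.
- move=> z /andP[z0 zr]; have [l' /cderivP fl'] := fd _ zr.
  have zn0 : z != 0 by rewrite -nc_gt0.
  exists ('D_1 (fun w : C^o => (f w - f 0) / w : C^o) z); apply/cderivP/derivableP.
  have df : derivable (f : C^o -> C^o) z 1 by exact: ex_derive.
  apply: (@derivableM _ _ (fun w : C^o => f w - f 0) (fun w : C^o => w^-1)).
    by apply: (@derivableB _ _ _ (f : C^o -> C^o) (cst (f 0))); [exact: df|exact: derivable_cst].
  by apply: (@derivableV _ _ (@id C^o)); [exact: zn0|exact: derivable_id].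
- move=> e e0; have [d d0 H] := f0 e e0; exists d => // z /andP[z0 zd].
  rewrite -(ler_pM2r (x := nc z))// -ncM mulrBl divfK -?nc_gt0//.
  by have := H z zd; rewrite add0r.
- move=> z zr; have n0 : z != 0 by rewrite -nc_gt0 zr.
  rewrite ncM ncV zr ler_wpM2r ?invr_ge0 ?(ltW r0)//.
  apply: le_trans (ncB _ _) _; rewrite mulr2n lerD ?fM ?zr// nc0 mulrn_wgt0//.
Qed.

(** The real mean value theorem for the real part of [cj * f], with [cj] the conjugate of the total
    increment [c]: the increment of that function is [|c|] squared. *)
Lemma MVT_complex (f df : C -> C) (M : R) :
  (forall t : R, 0 <= t <= 1 -> cderiv f t%:C%C (df t%:C%C)) ->
  (forall t : R, 0 <= t <= 1 -> nc (df t%:C%C) <= M) -> nc (f 1 - f 0) <= M.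
Proof.
move=> fd dfM; set c := f 1 - f 0.
have [->|c0] := eqVneq c 0.
  by rewrite nc0; apply: le_trans (nc_ge0 _) (dfM 0 _); rewrite lexx ler01.
have n0 : 0 < nc c by rewrite nc_gt0.
pose cj : C := (c^*)%C.
have ncj : nc cj = nc c by rewrite /cj; case: (c) => a b; rewrite /Normc.normc /= sqrrN.
have [|s s01] := @MVT_closed R (fun t => complex.Re (cj * f t%:C%C))
    (fun t => complex.Re (cj * df t%:C%C)) 0 1 ler01.
  move=> t t01; apply: expansion_is_derive => e e0.
  have [d d0 H] := cderivM cj (fd t t01) e0.
  exists d => // h hd; have := H h%:C%C; rewrite nc_real => /(_ hd); apply: le_trans.
  rewrite /GRing.scale /= mulr1 -[X in `|_ - X|]/(complex.Re (cj * df t%:C%C) * h).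
  have -> : complex.Re (cj * df t%:C%C) * h = complex.Re (cj * df t%:C%C * h%:C%C).
    by case: (cj * _) => a b /=; rewrite mulr0 subr0.
  by rewrite -!ReB rmorphD; exact: nc_Re.
rewrite subr0 mulr1 -ReB -mulrBr -/c => E.
have E2 : complex.Re (cj * c) = nc c * nc c.
  by rewrite -expr2 nc_sqr /cj; case: (c) => a b /=; ring.
rewrite -(ler_pM2l n0) -E2 E; apply: le_trans (ler_norm _) _.
by apply: le_trans (nc_Re _) _; rewrite ncM ncj ler_wpM2l ?dfM// ltW.
Qed.

End OneVariableBounds.

(** * Lipschitz and Taylor estimates in several variables *)

Section SeveralVariables.
Variables (R : realType) (n : nat).
Notation C := (CC R).
Notation nc := (@Normc.normc R).
Notation V := 'rV[C]_n.
Implicit Types (f : V -> C) (a x y v : V).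

Lemma cderiv_line f x v t : differentiable (f : V -> C^o) (x + t *: v) ->
  cderiv (fun t => f (x + t *: v)) t ('d (f : V -> C^o) (x + t *: v) v).
Proof.
move=> df e e0.
have v0 : 0 < rnorm v + 1 by rewrite ltr_wpDl// rnorm_ge0.
have [|d d0 H] := differentiable_expansion df (e := e / (rnorm v + 1)).
  by rewrite divr_gt0.
exists (d / (rnorm v + 1)) => [|h hd]; first by rewrite divr_gt0.
have hvd : rnorm (h *: v) < d.
  rewrite rnormZ; rewrite ltr_pdivlMr// in hd; apply: le_lt_trans hd.
  by rewrite ler_wpM2l ?nc_ge0// lerDl.
have {H} := H _ hvd.
rewrite scalerDl addrA linearZ /=; set l := 'd _ _ v.
rewrite -[X in nc (_ - X)]/(h * l) [h * l]mulrC => /le_trans; apply.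
rewrite rnormZ.
have -> : e / (rnorm v + 1) * (nc h * rnorm v) = (e * nc h) * (rnorm v / (rnorm v + 1)) by ring.
rewrite ler_piMr ?mulr_ge0 ?nc_ge0// ?(ltW e0)//.
by rewrite ler_pdivrMr// mul1r lerDl.
Qed.

Definition holo_ball f a (r : R) :=
  forall w, rnorm (w - a) < r -> differentiable (f : V -> C^o) w.

(** At each point [z] of the segment, the slice [s |-> f (z + s v)] is holomorphic on the disc of
    radius [2q] with [q = r / (4 |v|)], which stays in the ball; its derivative is at most
    [2M / q]. *)
Lemma holo_lipschitz f a (r M : R) : 0 < r -> holo_ball f a r ->
  (forall w, rnorm (w - a) < r -> nc (f w) <= M) ->
  forall x y, rnorm (x - a) < r / 2 -> rnorm (y - a) < r / 2 ->
  nc (f y - f x) <= 8 * M / r * rnorm (y - x).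
Proof.
move=> r0 fh fM x y xa ya; set v := y - x.
have r20 : 0 < r / 2 by rewrite divr_gt0.
have [v0|v0] := eqVneq (rnorm v) 0.
  by rewrite v0 mulr0; have /subr0_eq -> := rnorm_eq0 v0; rewrite subrr nc0.
have vgt : 0 < rnorm v by rewrite lt_def v0 rnorm_ge0.
have seg (t : R) : 0 <= t <= 1 -> rnorm (x + t%:C%C *: v - a) < r / 2.
  move=> /andP[t0 t1].
  have -> : x + t%:C%C *: v - a = (1 - t)%:C%C *: (x - a) + t%:C%C *: (y - a).
    rewrite /v rmorphB /= scalerBl scale1r; move: (t%:C%C : C) => c.
    apply/rowP => k; rewrite !mxE; ring.
  apply: le_lt_trans (rnormD _ _) _; rewrite !rnormZ !nc_real !ger0_norm ?subr_ge0//.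
  have -> : r / 2 = (1 - t) * (r / 2) + t * (r / 2) by ring.
  have [->|t0'] := eqVneq t 0; first by rewrite !mul0r !addr0 subr0 !mul1r.
  apply: ler_ltD; first by rewrite ler_wpM2l ?subr_ge0// ltW.
  by rewrite ltr_pM2l// lt_def t0'.
have E1 : f y = f (x + 1 *: v) by rewrite scale1r /v subrKC.
have E0 : f x = f (x + 0 *: v) by rewrite scale0r addr0.
rewrite E1 E0.
apply: (@MVT_complex R (fun t => f (x + t *: v)) (fun t => 'd (f : V -> C^o) (x + t *: v) v)).
  by move=> t /seg t01; apply: cderiv_line; apply: fh; rewrite (lt_trans t01)// gtr_pMr// invf_lt1// ltr1n.
move=> t /seg t01; set z := x + t%:C%C *: v in t01 *.
pose q := r / 4 / rnorm v.
have q0 : 0 < q by rewrite !divr_gt0.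
have inb s : nc s < q *+ 2 -> rnorm (z + s *: v - a) < r.
  move=> sq; rewrite [z + _]addrC -addrA; apply: le_lt_trans (rnormD _ _) _.
  rewrite [r]splitr ltrD// rnormZ -ltr_pdivlMr// (lt_le_trans sq)// /q.
  have -> : (r / 4 / rnorm v) *+ 2 = r / 2 / rnorm v by field.
  by [].
have -> : 8 * M / r * rnorm v = M *+ 2 / q by rewrite /q; field; rewrite v0 gt_eqF.
apply: (@cderiv_le R (fun s => f (z + s *: v)) _ q M q0).
- move=> s /inb sb; eexists; apply: cderiv_line; exact: fh.
- move=> s /inb sb; exact: fM.
- have := @cderiv_line f z v 0; rewrite scale0r addr0; apply; apply: fh.
  by rewrite (lt_trans t01)// gtr_pMr// invf_lt1// ltr1n.
Qed.

End SeveralVariables.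

Section HolomorphicEstimates.
Variables (R : realType) (n : nat).
Notation C := (CC R).
Notation nc := (@Normc.normc R).
Notation V := 'rV[C]_n.
Implicit Types (f : V -> C) (a x y v : V).

Lemma differentiable_shift f u x : differentiable (f : V -> C^o) (x + u) ->
  differentiable ((fun z => f (z + u)) : V -> C^o) x.
Proof.
move=> df; apply: (@differentiable_comp _ _ _ _ (fun z : V => z + u) (f : V -> C^o)); last exact: df.
by apply: differentiableD; [exact: ex_diff|exact: differentiable_cst].
Qed.

(** The Lipschitz bound used twice: [z |-> f (z + u) - f z] is bounded by [8M |u| / r] on the ball
    of radius [r / 4], and is then Lipschitz with constant [8 * (8M |u| / r) / (r / 4)]. *)
Lemma holo_second_difference f a (r M : R) : 0 < r -> holo_ball f a r ->
  (forall w, rnorm (w - a) < r -> nc (f w) <= M) ->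
  forall x y u, rnorm (x - a) < r / 8 -> rnorm (y - a) < r / 8 -> rnorm u < r / 4 ->
  nc ((f (y + u) - f y) - (f (x + u) - f x)) <= 256 * M / r ^+ 2 * rnorm u * rnorm (y - x).
Proof.
move=> r0 fh fM x y u xa ya ua.
have sh w : rnorm (w - a) < r / 4 -> rnorm (w + u - a) < r / 2.
  move=> wa; rewrite addrAC; apply: le_lt_trans (rnormD _ _) _.
  have -> : r / 2 = r / 4 + r / 4 by field.
  exact: ltrD.
have le4 w : rnorm (w - a) < r / 4 -> rnorm (w - a) < r / 2.
  by move=> /lt_le_trans; apply; rewrite ler_pM2l// lef_pV2 ?posrE// ler_nat.
have le2 w : rnorm (w - a) < r / 2 -> rnorm (w - a) < r.
  by move=> /lt_le_trans; apply; rewrite ler_pdivrMr// ler_peMr ?ler1n// ltW.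
have H := @holo_lipschitz R n (fun z => f (z + u) - f z) a (r / 4) (8 * M / r * rnorm u).
have -> : 256 * M / r ^+ 2 * rnorm u * rnorm (y - x) =
  8 * (8 * M / r * rnorm u) / (r / 4) * rnorm (y - x) by field; rewrite gt_eqF.
have r8 : r / 4 / 2 = r / 8 by field.
apply: H; rewrite ?r8; first by rewrite divr_gt0.
- move=> w wa; apply: (@differentiableB _ _ _ ((fun z => f (z + u)) : V -> C^o)).
    by apply: differentiable_shift; apply: fh; apply: le2; exact: sh.
  by apply: fh; apply/le2/le4.
- move=> w wa; have := @holo_lipschitz R n f a r M r0 fh fM w (w + u) (le4 _ wa) (sh _ wa).
  by rewrite addrAC subrr add0r.
- exact: xa.
- exact: ya.
Qed.

(** The second difference gives [|rem h| <= 2 |rem (h / 2)| + K |h|^2]. Iterating, the quadratic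
    terms form a geometric series of sum at most [2K |h|^2], while [2^k |rem (h / 2^k)|] tends to
    [0] because [f] is differentiable at [x]. *)
Lemma holo_taylor f a (r M : R) : 0 < r -> holo_ball f a r ->
  (forall w, rnorm (w - a) < r -> nc (f w) <= M) ->
  forall x h, rnorm (x - a) < r / 16 -> rnorm h < r / 16 ->
  nc (f (x + h) - f x - 'd (f : V -> C^o) x h) <= 128 * M / r ^+ 2 * rnorm h ^+ 2.
Proof.
move=> r0 fh fM x h0 xa ha; set L := 'd _ x.
pose K := 64 * M / r ^+ 2.
pose rem h := f (x + h) - f x - L h.
pose half h : V := (2^-1)%:C%C *: h.
have halfE h : h = half h + half h.
  rewrite /half -scalerDl -[LHS]scale1r; congr (_ *: _).
  by rewrite -rmorphD /= -[X in X + X]div1r -splitr.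
have Nhalf h : rnorm (half h) = rnorm h / 2.
  by rewrite rnormZ nc_real ger0_norm ?invr_ge0// mulrC.
have step h : rnorm h < r / 16 -> nc (rem h) <= 2 * nc (rem (half h)) + K * rnorm h ^+ 2.
  move=> hr; set k := half h.
  have Nk : rnorm k = rnorm h / 2 by exact: Nhalf.
  have -> : rem h = (rem k + rem k) + ((f (x + k + k) - f (x + k)) - (f (x + k) - f x)).
    rewrite /rem {1 2}(halfE h) -/k raddfD /= addrA; ring.
  apply: le_trans (ncD _ _) _; apply: lerD; first by rewrite mulr_natl mulr2n ncD.
  have := @holo_second_difference f a r M r0 fh fM x (x + k) k.
  have -> : x + k - x = k by rewrite addrAC subrr add0r.
  have -> : K * rnorm h ^+ 2 = 256 * M / r ^+ 2 * rnorm k * rnorm k.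
    by rewrite Nk /K; field; rewrite gt_eqF.
  have e8 : r / 8 = r / 16 + r / 16 by field.
  have e4 : r / 4 = r / 16 + r / 16 + r / 16 + r / 16 by field.
  have r16 : 0 < r / 16 by rewrite divr_gt0.
  have kr : rnorm k < r / 16.
    by rewrite Nk; apply: le_lt_trans hr; rewrite ler_pdivrMr// ler_peMr ?ler1n// rnorm_ge0.
  apply; first by rewrite e8 (lt_trans xa)// ltrDl.
    by rewrite addrAC e8; apply: le_lt_trans (rnormD _ _) _; rewrite ltrD.
  by rewrite e4 (lt_trans kr)// -!addrA ltrDl !addr_gt0.
have iter k h : rnorm h < r / 16 -> nc (rem h) <=
    2 ^+ k * nc (rem ((2^-1 ^+ k)%:C%C *: h)) + 2 * K * (1 - 2^-1 ^+ k) * rnorm h ^+ 2.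
  elim: k h => [|k IH] h hr.
    by rewrite !expr0 scale1r mul1r subrr mulr0 mul0r addr0.
  have hhr : rnorm (half h) < r / 16.
    by rewrite Nhalf; apply: le_lt_trans hr; rewrite ler_pdivrMr// ler_peMr ?ler1n// rnorm_ge0.
  apply: le_trans (step _ hr) _.
  have := IH _ hhr; rewrite Nhalf /half scalerA -rmorphM /= -exprSr !(exprS _ k).
  move=> /(ler_wpM2l (ler0n R 2)) H; apply: le_trans (lerD H (lexx _)) _.
  rewrite le_eqVlt; apply/orP; left; apply/eqP.
  have E (A B D N : R) : 2 * (D * A + 2 * K * (1 - B) * (N / 2) ^+ 2) + K * N ^+ 2 =
    2 * D * A + 2 * K * (1 - 2^-1 * B) * N ^+ 2 by clear; field.
  exact: E.
have M0 : 0 <= M by apply: le_trans (nc_ge0 _) (fM a _); rewrite subrr rnorm0.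
have K0 : 0 <= K by rewrite mulr_ge0 ?invr_ge0 ?exprn_ge0 ?(ltW r0)// mulr_ge0.
have r16r : r / 16 <= r by rewrite ler_pdivrMr// ler_peMr ?ler1n// ltW.
have dfx : differentiable (f : V -> C^o) x by apply: fh; exact: lt_le_trans r16r.
have -> : 128 * M / r ^+ 2 = 2 * K by rewrite /K; ring.
apply/ler_addgt0Pr => e e0.
have N0 : 0 < rnorm h0 + 1 by rewrite ltr_wpDl// rnorm_ge0.
have [|d d0 Hd] := differentiable_expansion dfx (e := e / (rnorm h0 + 1)).
  by rewrite divr_gt0.
have [k kd] : exists k, 2^-1 ^+ k * rnorm h0 < d.
  have : (fun k => 2^-1 ^+ k * rnorm h0) @ \oo --> (0 : R) * rnorm h0.
    by apply: cvgMl; apply: cvg_expr; rewrite ger0_norm ?invr_ge0// invf_lt1// ltr1n.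
  rewrite mul0r => /cvgrPdist_lt /(_ _ d0) [k _ /(_ k (leqnn _))].
  rewrite sub0r normrN => /(le_lt_trans (ler_norm _)) Hk.
  by exists k.
have p0 : 0 < 2^-1 ^+ k :> R by rewrite exprn_gt0.
have Nk : rnorm ((2^-1 ^+ k)%:C%C *: h0) = 2^-1 ^+ k * rnorm h0.
  by rewrite rnormZ nc_real gtr0_norm.
apply: le_trans (iter k _ ha) _.
have {Hd} := Hd ((2^-1 ^+ k)%:C%C *: h0); rewrite Nk => /(_ kd) Hd.
rewrite addrC; apply: lerD.
  have p1 : 1 - 2^-1 ^+ k <= 1 :> R by rewrite gerBl ltW.
  have K20 : 0 <= 2 * K by rewrite mulr_ge0.
  by apply: ler_wpM2r; [rewrite exprn_ge0 ?rnorm_ge0|rewrite ler_piMr].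
apply: (@le_trans _ _ (2 ^+ k * (e / (rnorm h0 + 1) * (2^-1 ^+ k * rnorm h0)))).
  by rewrite ler_wpM2l ?exprn_ge0.
have -> : 2 ^+ k * (e / (rnorm h0 + 1) * (2^-1 ^+ k * rnorm h0)) =
   e * (rnorm h0 / (rnorm h0 + 1)).
  rewrite exprVn; have : 2 ^+ k != 0 :> R by rewrite expf_neq0// pnatr_eq0.
  move: (2 ^+ k) => u u0; field; rewrite u0 gt_eqF//.
by rewrite ler_piMr ?(ltW e0)// ler_pdivrMr// mul1r lerDl.
Qed.

(* Borel-Caratheodory: with [u = q - q a], the Moebius map [u / (u - 4iA)] sends the half-plane
   [Im u < 2A] into the unit disc. *)
Lemma holo_im_lipschitz q a (r A : R) : 0 < r -> 0 < A -> holo_ball q a r ->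
  (forall w, rnorm (w - a) < r -> `|complex.Im (q w)| <= A) ->
  forall x y, rnorm (x - a) < r / 32 -> rnorm (y - a) < r / 32 ->
  nc (q y - q x) <= 512 * A / r * rnorm (y - x).
Proof.
move=> r0 A0 qh qA x y xa ya.
pose u w := q w - q a.
pose B : C := Complex 0 (4 * A).
have uA w : rnorm (w - a) < r -> complex.Im (u w) <= 2 * A.
  move=> wa; rewrite /u ImB.
  have := qA _ wa; have := qA a; rewrite subrr rnorm0 => /(_ r0).
  rewrite !ler_norml => /andP[h1 h2] /andP[h3 h4]; clear -h1 h4; lra.
have uB w : rnorm (w - a) < r -> u w - B != 0.
  move=> /uA uw; apply/negP => /eqP; case: (u w) uw => p t /= uw [_] H.
  clear -H uw A0; lra.
have uh : holo_ball u a r.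
  move=> w wa; apply: (@differentiableB _ _ _ (q : V -> C^o) (cst (q a) : V -> C^o)).
    exact: qh.
  exact: differentiable_cst.
pose T w := u w / (u w - B).
have Th : holo_ball T a r.
  move=> w wa; apply: (@differentiableM _ _ (u : V -> C^o) (fun w => (u w - B)^-1 : C^o)).
    exact: uh.
  apply: (@differentiableV _ _ (fun w => u w - B : C^o)); last exact: uB.
  apply: (@differentiableB _ _ _ (u : V -> C^o) (cst B : V -> C^o)).
    exact: uh.
  exact: differentiable_cst.
have T1 w : rnorm (w - a) < r -> nc (T w) <= 1.
  move=> wa; rewrite ncM ncV ler_pdivrMr ?mul1r ?nc_gt0; last exact: uB.
  rewrite -(@ler_pXn2r _ 2) ?nnegrE ?nc_ge0// !nc_sqr ReB ImB.
  have := uA _ wa; rewrite /B /= subr0 => h.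
  rewrite lerD2l -subr_ge0.
  have -> : (complex.Im (u w) - 4 * A) ^+ 2 - complex.Im (u w) ^+ 2 =
     8 * A * (2 * A - complex.Im (u w)) by ring.
  by rewrite mulr_ge0 ?subr_ge0// mulr_ge0// ltW.
have le2 w : rnorm (w - a) < r / 16 -> rnorm (w - a) < r / 2.
  by move=> /lt_le_trans; apply; rewrite ler_pM2l// lef_pV2 ?posrE// ler_nat.
have le1 w : rnorm (w - a) < r / 16 -> rnorm (w - a) < r.
  by move=> /lt_le_trans; apply; rewrite ler_pdivrMr// ler_peMr ?ler1n// ltW.
(* [T] vanishes at [a], so its Lipschitz bound gives [|T| <= 1/2] on this ball; solving
   [u = T * (u - B)] then bounds [u]. *)
have u4 w : rnorm (w - a) < r / 16 -> nc (u w) <= 4 * A.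
  move=> wa; have := @holo_lipschitz R n T a r 1 r0 Th T1 a w.
  rewrite subrr rnorm0 => /(_ (divr_gt0 r0 _) (le2 _ wa)); rewrite ltr0n => /(_ isT).
  have Ta : T a = 0 by rewrite /T /u subrr mul0r.
  rewrite Ta subr0 mulr1 => TN.
  have T2 : nc (T w) <= 1 / 2.
    apply: le_trans TN _; apply: (@le_trans _ _ (8 / r * (r / 16))).
      by rewrite ler_wpM2l ?divr_ge0// ltW.
    have -> : 8 / r * (r / 16) = 1 / 2; last by [].
    by field; rewrite gt_eqF.
  have E : u w = T w * (u w - B) by rewrite divfK// uB// le1.
  have nB : nc B = 4 * A by rewrite nc_imag gtr0_norm// mulr_gt0.
  have H1 : nc (u w) <= 1 / 2 * (nc (u w) + 4 * A).
    rewrite {1}E ncM ler_pM ?nc_ge0// -nB; exact: ncB.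
  clear -H1; lra.
have r16 : r / 16 / 2 = r / 32 by field.
have := @holo_lipschitz R n u a (r / 16) (4 * A); rewrite r16.
have -> : 8 * (4 * A) / (r / 16) = 512 * A / r by field; rewrite gt_eqF.
have -> : q y - q x = u y - u x by rewrite /u opprB addrA subrK.
move=> H; apply: H; first by rewrite divr_gt0.
- by move=> w /le1; exact: uh.
- exact: u4.
- exact: xa.
- exact: ya.
Qed.

End HolomorphicEstimates.

(** * Concentration of slowly varying functions *)

Section Concentration.
Variables (R : realType) (n : nat).
Notation C := (CC R).
Notation nc := (@Normc.normc R).
Notation V := 'rV[C]_n.
Implicit Types (a x y : V) (v : V -> R) (s r M : R).

(** The property shared by [|f|] and [|Im q|]: an upper bound on a ball controls the variation near
    its centre. The constants are those of [holo_im_lipschitz], the weaker of the two estimates. *)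
Definition slowly_varying v a s := forall x r M, 0 < r -> 0 < M ->
  (forall y, rnorm (y - x) < r -> rnorm (y - a) < s) ->
  (forall y, rnorm (y - x) < r -> v y <= M) ->
  forall y, rnorm (y - x) < r / 32 -> `|v y - v x| <= 2 ^+ 9 * M / r * rnorm (y - x).

(** The first factor comes from the near-maximum, which costs [2], and from the weight
    [(2 * rho) ^ m]; the second from shrinking the radius [rho] by [2 ^ (m + 11)]. *)
Definition kappa m : R := 2 ^+ m.+1 * (2 ^+ (m + 11)) ^+ m.

(* The point [x] almost maximizes the weight [(s - |x - a|) ^ m * v x]; the
   weight forces [v <= 2 ^ m.+1 * v x] on a ball of radius [(s - |x - a|) / 2]. *)
Lemma concentration v a s m B : 0 < s ->
  (forall y, rnorm (y - a) < s -> 0 <= v y <= B) ->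
  slowly_varying v a s -> 0 < v a ->
  exists x r, [/\ 0 < r <= s,
    forall y, rnorm (y - x) < r -> rnorm (y - a) < s /\ v x / 2 <= v y &
    v a * s ^+ m <= kappa m * v x * r ^+ m].
Proof.
move=> s0 vB sv va0.
pose W y := (s - rnorm (y - a)) ^+ m * v y.
pose E := [set W y | y in [set y | rnorm (y - a) < s]].
have Ea : E (s ^+ m * v a).
  by exists a; rewrite /= ?/W subrr rnorm0 ?subr0.
have sup_E : has_sup E.
  split; first by exists (s ^+ m * v a).
  exists (s ^+ m * B) => _ [y ys <-]; have /andP[v0 vb] := vB _ ys.
  rewrite ler_pM// ?exprn_ge0 ?subr_ge0 ?(ltW ys)//.
  by rewrite lerXn2r ?nnegrE ?subr_ge0 ?(ltW ys) ?(ltW s0)// gerBl rnorm_ge0.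
have Sa : s ^+ m * v a <= sup E by apply: ub_le_sup => //; case: sup_E.
have S0 : 0 < sup E by apply: lt_le_trans Sa; rewrite mulr_gt0// exprn_gt0.
have [_ [x /= xs <-] Wx] := sup_adherent (divr_gt0 S0 (ltr0n R 2)) sup_E.
have {}Wx : sup E < 2 * W x by move: Wx; clear; lra.
pose rho := (s - rnorm (x - a)) / 2.
have rho0 : 0 < rho by rewrite divr_gt0// subr_gt0.
have rho2 : s - rnorm (x - a) = 2 * rho by rewrite /rho mulrC divfK.
have vx0 : 0 < v x.
  have : 0 < W x by move: (lt_trans S0 Wx); clear; lra.
  by rewrite /W rho2 pmulr_rgt0// exprn_gt0// mulr_gt0.
have in_s y : rnorm (y - x) < rho -> rnorm (y - a) < s - rho.
  move=> yx; have := rnormD (y - x) (x - a); rewrite addrA subrK.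
  by move: yx rho2; clear; lra.
have in_s' y : rnorm (y - x) < rho -> rnorm (y - a) < s.
  by move=> /in_s; move: rho0; clear; lra.
pose M := 2 ^+ m.+1 * v x.
have M0 : 0 < M by rewrite mulr_gt0// exprn_gt0.
have vM y : rnorm (y - x) < rho -> v y <= M.
  move=> yx; have /andP[vy0 _] := vB _ (in_s' _ yx).
  have Wy : W y <= sup E.
    by apply: ub_le_sup; [case: sup_E|exists y => //; exact: in_s'].
  have H : rho ^+ m * v y <= W y.
    rewrite /W ler_wpM2r// lerXn2r ?nnegrE ?(ltW rho0)//; have := in_s _ yx; move: rho0; clear; lra.
  rewrite -(ler_pM2l (exprn_gt0 m rho0)).
  apply: le_trans H _; apply: le_trans Wy _; apply: le_trans (ltW Wx) _.
  by rewrite /W rho2 /M exprMn exprS le_eqVlt; apply/orP; left; apply/eqP; ring.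
(* With this ratio of radii the variation [2 ^+ 9 * M / rho * (e * rho)] equals [v x / 2], since
   [M = 2 ^+ m.+1 * v x]. *)
pose e : R := (2 ^+ (m + 11))^-1.
have e0 : 0 < e by rewrite invr_gt0 exprn_gt0.
have e32 : e <= 1 / 32.
  rewrite /e div1r lef_pV2 ?posrE ?exprn_gt0//.
  have -> : 32 = 2 ^+ 5 :> R by rewrite -natrX.
  by rewrite ler_eXn2l ?ltr1n// (leq_trans _ (leq_addl _ _)).
exists x, (e * rho); split.
- rewrite mulr_gt0//=; apply: (@le_trans _ _ rho).
    rewrite ler_piMl ?(ltW rho0)//; move: e32; clear; lra.
  by have := rnorm_ge0 (x - a); move: rho2 rho0; clear; lra.
- move=> y yx.
  have y32 : rnorm (y - x) < rho / 32.
    apply: lt_le_trans yx _; rewrite mulrC ler_wpM2l ?(ltW rho0)//.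
    by move: e32; clear; lra.
  have yrho : rnorm (y - x) < rho by move: y32 rho0; clear; lra.
  split; first exact: in_s'.
  have := sv x rho M rho0 M0 in_s' vM y y32.
  have B1 : 2 ^+ 9 * M / rho * rnorm (y - x) <= v x / 2.
    apply: (@le_trans _ _ (2 ^+ 9 * M / rho * (e * rho))).
      apply: ler_wpM2l; last exact: (ltW yx).
      by apply: divr_ge0; [apply: mulr_ge0; [exact: exprn_ge0|exact: (ltW M0)]|exact: (ltW rho0)].
    have -> : 2 ^+ 9 * M / rho * (e * rho) = (2 ^+ (m + 10)) * v x * e.
      by rewrite /M (exprD _ m 10) (exprS _ m) (exprS _ 9); move: (2 ^+ 9) (2 ^+ m) => c u; field; rewrite gt_eqF.
    have -> : e = (2 ^+ (m + 10))^-1 / 2 by rewrite /e (addnS m 10) (exprSr _ (m + 10)) invfM mulrC.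
    have : 2 ^+ (m + 10) != 0 :> R by rewrite expf_neq0// pnatr_eq0.
    by move: (2 ^+ _) => u u0; rewrite le_eqVlt; apply/orP; left; apply/eqP; field.
  move=> H; have {H} := le_trans H B1.
  by rewrite ler_norml => /andP[+ _]; clear; lra.
- rewrite mulrC; apply: le_trans Sa _; apply: le_trans (ltW Wx) _.
  rewrite /W rho2 /kappa [(2 * rho) ^+ m]exprMn [(e * rho) ^+ m]exprMn /e (exprS _ m) exprVn.
  have : (2 ^+ (m + 11)) ^+ m != 0 :> R by rewrite !expf_neq0// pnatr_eq0.
  move: ((2 ^+ (m + 11)) ^+ m) (2 ^+ m) (rho ^+ m) (v x) => p q t w p0.
  by rewrite le_eqVlt; apply/orP; left; apply/eqP; field.
Qed.

Lemma slowly_varying_normc (f : V -> C) a s :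
  holo_ball f a s -> slowly_varying (fun y => nc (f y)) a s.
Proof.
move=> fh x r M r0 M0 xs fM y yr.
have -> : 2 ^+ 9 = 512 :> R by rewrite -natrX.
have r2 : r / 32 <= r / 2 by rewrite ler_pM2l// lef_pV2 ?posrE// ler_nat.
have hx : holo_ball f x r by move=> w /xs; exact: fh.
have := @holo_lipschitz R n f x r M r0 hx fM x y.
rewrite subrr rnorm0 divr_gt0// => /(_ isT (lt_le_trans yr r2)) H.
apply: (@le_trans _ _ (nc (f y - f x))).
  rewrite ler_norml; apply/andP; split.
    by rewrite lerNl opprB lerBlDr; have := ncD (f x - f y) (f y); rewrite subrK nc_distrC.
  by rewrite lerBlDr; have := ncD (f y - f x) (f x); rewrite subrK.
apply: le_trans H _; rewrite ler_wpM2r ?rnorm_ge0// ler_wpM2r ?invr_ge0 ?(ltW r0)//.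
by rewrite ler_wpM2r ?(ltW M0)// ler_nat.
Qed.

Lemma slowly_varying_Im (q : V -> C) a s :
  holo_ball q a s -> slowly_varying (fun y => `|complex.Im (q y)|) a s.
Proof.
move=> qh x r M r0 M0 xs qM y yr.
have -> : 2 ^+ 9 = 512 :> R by rewrite -natrX.
have hx : holo_ball q x r by move=> w /xs; exact: qh.
have := @holo_im_lipschitz R n q x r M r0 M0 hx qM x y.
rewrite subrr rnorm0 divr_gt0// => /(_ isT yr); apply: le_trans.
apply: le_trans (ler_dist_dist _ _) _; rewrite -ImB; exact: nc_Im.
Qed.

End Concentration.

(** * Integration over an open set *)

Section Measurability.
Variables (R : realType) (n : nat).
Notation C := (CC R).
Notation nc := (@Normc.normc R).
Notation V := 'rV[C]_n.
Notation RT := (measurableTypeR R).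
Notation T := ((n + n).-tuple RT).
Notation tc := (@tuple_to_complex R n).
Notation mu := (lebesgueT R (n + n)).
Implicit Types (t : T) (x y z : V).

Lemma rat_approx m (a : 'I_m -> R) (e : R) : 0 < e ->
  exists q : 'rV[rat]_m, forall i, `|a i - ratr (q 0 i)| < e.
Proof.
move=> e0.
have /choice[q Hq] : forall i, exists q : rat, `|a i - ratr q| < e.
  move=> i; have [|q] := @rat_in_itvoo R (a i - e) (a i + e).
    by rewrite ltrBlDr -addrA ltrDl addr_gt0.
  rewrite in_itv /= => /andP[h1 h2]; exists q.
  by rewrite ltr_norml; apply/andP; split; move: h1 h2; clear; lra.
by exists (\row_i q i) => i; rewrite mxE.
Qed.

Lemma rnorm_tuple t t' (e : R) : 0 < e ->
  (forall i, `|tnth t i - tnth t' i| < e) -> rnorm (tc t - tc t') < e *+ 2.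
Proof.
move=> e0 H; apply/rnorm_ltP; split=> [|k]; first by rewrite pmulrn_lgt0.
rewrite !mxE; apply: le_lt_trans (nc_le_ReIm _) _.
by rewrite ReB ImB /= ?mxE mulr2n ltrD// H.
Qed.

Lemma measurable_box m (B : 'I_m -> set RT) : (forall i, measurable (B i)) ->
  measurable [set t : m.-tuple RT | forall i, B i (tnth t i)].
Proof.
move=> mB; rewrite (_ : mkset _ =
    \bigcap_(i in [set: 'I_m]) ((@tnth m RT)^~ i @^-1` B i)); last first.
  by apply/seteqP; split=> [t tB i _|t tB i]; exact: tB.
apply: fin_bigcap_measurable => // i _.
by rewrite -[X in measurable X]setTI; exact: measurable_tnth.
Qed.

(** Measurability on tuples is measurability in the coordinates, so the preimage of an open set is
    exhibited as the countable union of the rational boxes it contains. *)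
Lemma measurable_preimage_open (U : set V) : open U -> measurable (tc @^-1` U).
Proof.
move=> oU.
pose box (qk : 'rV[rat]_(n + n) * nat) : set T :=
  [set t | forall i, `](ratr (qk.1 0 i) - qk.2.+1%:R^-1), (ratr (qk.1 0 i) + qk.2.+1%:R^-1)[%classic (tnth t i)].
have boxE qk t : box qk t <-> forall i, `|tnth t i - ratr (qk.1 0 i)| < qk.2.+1%:R^-1.
  by split=> H i; have := H i; rewrite /= in_itv /= ltr_distl.
have mbox qk : measurable (box qk).
  apply: (@measurable_box _ (fun i => `](ratr (qk.1 0 i) - qk.2.+1%:R^-1), (ratr (qk.1 0 i) + qk.2.+1%:R^-1)[%classic)) => i.
  exact: measurable_itv.
rewrite (_ : tc @^-1` U = \bigcup_qk (if `[< box qk `<=` tc @^-1` U >] then box qk else set0)).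
  apply: countable_bigcupT_measurable; first exact: countableP.
  by move=> qk; case: ifP.
apply/seteqP; split=> [t Ut|t [qk _]]; last by case: asboolP => // H /H.
have /nbhs_rnorm[r r0 rU] := open_nbhs_nbhs (conj oU Ut).
have [k kr] : exists k : nat, k.+1%:R^-1 < r / 4.
  have r4 : 0 < r / 4 by rewrite divr_gt0.
  have [k _ /(_ k (leqnn _))] := near_infty_natSinv_lt (PosNum r4).
  by exists k.
have e0 : 0 < k.+1%:R^-1 :> R by rewrite invr_gt0.
have [q Hq] := @rat_approx _ (fun i => tnth t i) _ e0.
exists (q, k) => //; case: asboolP => [_|[]]; first by apply/boxE.
move=> t' /boxE /= Ht'; apply: rU.
have H i : `|tnth t' i - tnth t i| < k.+1%:R^-1 *+ 2.
  rewrite mulr2n -(subrK (ratr (q 0 i)) (tnth t' i)) -addrA.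
  by apply: le_lt_trans (ler_normD _ _) _; rewrite ltrD// distrC.
apply: lt_le_trans (rnorm_tuple _ H) _; first by rewrite pmulrn_lgt0.
move: kr; move: (k.+1%:R^-1) => u ur.
by rewrite !mulr2n; move: ur; clear; lra.
Qed.

Variable Omega : set V.
Hypothesis oO : open Omega.
Notation D := (tc @^-1` Omega).

Let mD : measurable D. Proof. exact: measurable_preimage_open. Qed.

Lemma measurable_fun_continuous (g : V -> R) :
  (forall z, Omega z -> {for z, continuous g}) -> measurable_fun D (g \o tc).
Proof.
move=> cg; apply: (measurability _ (RGenOInfty.measurableE R)).
move=> _ [_ [a ->] <-].
rewrite (_ : _ `&` _ = tc @^-1` (Omega `&` [set z | a < g z])).
  apply: measurable_preimage_open; rewrite openE => z [/= Oz az].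
  rewrite /interior; apply: filterI; first exact: open_nbhs_nbhs.
  by have := cg z Oz; move=> /cvgrPdist_lt /(_ (g z - a)); rewrite subr_gt0 => /(_ az); apply: filterS => w /=; rewrite ltr_distlC => /andP[+ _]; rewrite opprB subrKC.
by apply/seteqP; split=> t /=; rewrite in_itv /= andbT.
Qed.

Definition intO (g : V -> R) : \bar R := (\int[mu]_(t in D) (g (tc t))%:E)%E.

Lemma intO_le (g h : V -> R) : measurable_fun D (g \o tc) -> measurable_fun D (h \o tc) ->
  (forall z, Omega z -> 0 <= g z <= h z) -> (intO g <= intO h)%E.
Proof.
move=> mg mh gh; apply: ge0_le_integral => //.
- by move=> t /gh /andP[]; rewrite lee_fin.
- exact/measurable_EFinP.
- exact/measurable_EFinP.
- by move=> t /gh /andP[]; rewrite lee_fin.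
Qed.

Lemma intOD (g h : V -> R) : measurable_fun D (g \o tc) -> measurable_fun D (h \o tc) ->
  (forall z, Omega z -> 0 <= g z) -> (forall z, Omega z -> 0 <= h z) ->
  (intO (fun z => (g z + h z)%R) = intO g + intO h)%E.
Proof.
move=> mg mh g0 h0; rewrite /intO -ge0_integralD//.
- by move=> t /g0; rewrite lee_fin.
- exact/measurable_EFinP.
- by move=> t /h0; rewrite lee_fin.
- exact/measurable_EFinP.
Qed.

Lemma intOZ (k : R) (g : V -> R) : measurable_fun D (g \o tc) ->
  (forall z, Omega z -> 0 <= g z) -> 0 <= k ->
  (intO (fun z => (k * g z)%R) = k%:E * intO g)%E.
Proof.
move=> mg g0 k0; rewrite /intO -ge0_integralZl_EFin//.
- by move=> t /g0; rewrite lee_fin.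
- exact/measurable_EFinP.
Qed.

Lemma cube_measure (x : V) (r : R) : 0 < r ->
  mu [set t : T | forall i, `[(of_complex x 0 i - r), (of_complex x 0 i + r)]%classic (tnth t i)]
    = ((r *+ 2) ^+ (n + n))%:E.
Proof.
move=> r0; rewrite (@lebesgueT_box _ _ (fun i => `[(of_complex x 0 i - r), (of_complex x 0 i + r)]%classic)); last by move=> i; exact: measurable_itv.
rewrite (eq_bigr (fun=> (r *+ 2)%:E)) => [|i _].
  by rewrite prodEFin prodr_const card_ord.
rewrite lebesgue_measure_itv /= lte_fin ltrBlDr -addrA ltrDl addr_gt0// -EFinB.
by congr (_%:E); rewrite opprD opprK addrACA subrr add0r mulr2n.
Qed.

(** The ball contains the cube of half-side [r / 4] centred at [x], whose measure is
    [(r / 2) ^+ (n + n)]; the gain [c] is integrated over that cube only. *)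
Lemma intO_gain (g h : V -> R) (c r : R) x :
  measurable_fun D (g \o tc) -> measurable_fun D (h \o tc) ->
  (forall z, Omega z -> 0 <= g z <= h z) -> 0 <= c -> 0 < r ->
  (forall z, rnorm (z - x) < r -> Omega z /\ g z + c <= h z) ->
  (intO g + (c * (r / 2) ^+ (n + n))%:E <= intO h)%E.
Proof.
move=> mg mh gh c0 r0 H.
pose Q := [set t : T | forall i, `[(of_complex x 0 i - r / 4), (of_complex x 0 i + r / 4)]%classic (tnth t i)].
have mQ : measurable Q.
  apply: (@measurable_box _ (fun i => `[(of_complex x 0 i - r / 4), (of_complex x 0 i + r / 4)]%classic)) => i.
  exact: measurable_itv.
have r4 : 0 < r / 4 by rewrite divr_gt0.
have Qball t : Q t -> rnorm (tc t - x) < r.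
  move=> Qt; have -> : x = tc [tuple of_complex x 0 i | i < n + n].
    rewrite /tuple_to_complex -[LHS]of_complexK; congr to_complex.
    by apply/rowP => i; rewrite [RHS]mxE tnth_mktuple.
  (* [rnorm_tuple] wants a strict bound on the coordinates: [3r / 8] lies strictly between [r / 4]
     and [r / 2]. *)
  apply: (@lt_trans _ _ ((3 * r / 8) *+ 2)); last first.
    by rewrite -mulr_natr; move: r0; lra.
  apply: rnorm_tuple => [|i]; first by move: r0; lra.
  rewrite tnth_mktuple; have := Qt i; rewrite /= in_itv /= => /andP[h1 h2].
  by rewrite ltr_norml; apply/andP; split; move: h1 h2 r0; lra.
have QD : Q `<=` D by move=> t /Qball /H[].
have E : (c * (r / 2) ^+ (n + n))%:E = (\int[mu]_(t in D) (c%:E * (\1_Q t)%:E))%E.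
  rewrite ge0_integralZl_EFin//; last first.
    by apply/measurable_EFinP; exact: measurable_indic.
  transitivity (c%:E * mu Q)%E; last by rewrite integral_indic// setIidl.
  rewrite (cube_measure x r4).
  by rewrite -EFinM; congr (_%:E); congr (_ * _ ^+ _); rewrite -mulr_natr; field.
rewrite E /intO -ge0_integralD//; last 4 first.
- by move=> t /gh /andP[]; rewrite lee_fin.
- exact/measurable_EFinP.
- by move=> t _; rewrite -EFinM lee_fin mulr_ge0.
- by apply/measurable_EFinP; apply: measurable_funM => //; exact: measurable_indic.
apply: ge0_le_integral => //.
- move=> t /gh /andP[g0 _]; rewrite -EFinM -EFinD lee_fin addr_ge0// mulr_ge0//.
- apply: emeasurable_funD; first exact/measurable_EFinP.
  by apply/measurable_EFinP; apply: measurable_funM => //; exact: measurable_indic.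
- exact/measurable_EFinP.
- move=> t Dt; rewrite -EFinM -EFinD lee_fin indicE.
  have [/set_mem Qt|_] := boolP (t \in Q).
    by rewrite mulr1; have [] := H _ (Qball _ Qt).
  by rewrite mulr0 addr0; have /andP[] := gh _ Dt.
Qed.

End Measurability.

(** * Convexity inequalities for powers *)

Section PowerInequalities.
Variable R : realType.
Implicit Types (x y p : R).

(** Young's inequality for [x * 1], with the conjugate exponent [(1 - p^-1)^-1]; for [p = 1] that
    exponent degenerates and the claim is an equality. *)
Lemma powR_bernoulli p x : 1 <= p -> 0 <= x -> 1 + p * (x - 1) <= x `^ p.
Proof.
rewrite le_eqVlt => /predU1P[<-|p1] x0; first by rewrite powRr1// mul1r subrKC.
have p0 : 0 < p by apply: lt_trans p1.
have q0 : 0 < (1 - p^-1)^-1 by rewrite invr_gt0 subr_gt0 invf_lt1.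
have := @conjugate_powR R x 1 p (1 - p^-1)^-1 x0 ler01 p0 q0.
rewrite invrK subrKC => /(_ erefl).
rewrite mulr1 powR1 mul1r => H.
have := ler_wpM2l (ltW p0) H.
have -> : p * (x `^ p / p + (1 - p^-1)) = x `^ p + p - 1 by field; rewrite gt_eqF.
clear; lra.
Qed.

(** Convexity from the tangent at the midpoint [m]: Bernoulli at [x / m] and at [y / m], whose
    linear terms cancel. *)
Lemma powR_midpoint p x y : 1 <= p -> 0 <= x -> 0 <= y ->
  ((x + y) / 2) `^ p <= (x `^ p + y `^ p) / 2.
Proof.
move=> p1 x0 y0; set m := (x + y) / 2.
have m0 : 0 <= m by rewrite divr_ge0// addr_ge0.
have [mE|m_neq0] := eqVneq m 0.
  by rewrite mE powR0 ?divr_ge0 ?addr_ge0 ?powR_ge0// gt_eqF// (lt_le_trans ltr01).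
have mgt : 0 < m by rewrite lt_def m_neq0.
have H z : 0 <= z -> m `^ p * (1 + p * (z / m - 1)) <= z `^ p.
  move=> z0; have zm : 0 <= z / m by rewrite divr_ge0.
  have -> : z `^ p = m `^ p * (z / m) `^ p by rewrite -powRM// mulrC divfK.
  by rewrite ler_wpM2l ?powR_ge0// powR_bernoulli.
have := lerD (H _ x0) (H _ y0).
have -> : m `^ p * (1 + p * (x / m - 1)) + m `^ p * (1 + p * (y / m - 1)) = m `^ p * 2.
  have xy0 : x + y != 0 by apply: contra m_neq0 => /eqP h; rewrite /m h mul0r.
  by rewrite /m; field.
by rewrite ler_pdivlMr.
Qed.

(** [t]^ p <= t[for]t = x / y[in][0, 1][, so the difference of powers is at least]y
    [^ p * (1 - x / y)]. This needs no strict convexity and covers [p = 1]. *)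
Lemma powR_gap p x y : 1 <= p -> 0 <= x <= y -> 1 / 2 <= y <= 2 ->
  (1 / 2) `^ p / 2 * (y - x) <= y `^ p - x `^ p.
Proof.
move=> p1 /andP[x0 xy] /andP[y1 y2].
have y0 : 0 < y by apply: lt_le_trans y1; rewrite divr_gt0.
have xyE : x `^ p = y `^ p * (x / y) `^ p.
  by rewrite -powRM ?divr_ge0 ?(ltW y0)// mulrC divfK// gt_eqF.
have H : (x / y) `^ p <= x / y.
  have xy1 : x / y <= 1 by rewrite ler_pdivrMr// mul1r.
  have xy0 : 0 <= x / y by rewrite divr_ge0// ltW.
  have [->|n0] := eqVneq (x / y) 0; first by rewrite powR0// gt_eqF// (lt_le_trans ltr01).
  rewrite -[X in _ <= X](powRr1 xy0) ger_powR// lt_def n0 xy0 //.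
rewrite xyE; have -> : y `^ p - y `^ p * (x / y) `^ p = y `^ p * (1 - (x / y) `^ p) by ring.
have P : (1 / 2) `^ p <= y `^ p.
  by rewrite ge0_ler_powR// ?nnegrE ?(ltW y0)// ?divr_ge0// (le_trans ler01).
have E : 1 - x / y = (y - x) / y by field; rewrite gt_eqF.
apply: (@le_trans _ _ (y `^ p * (1 - x / y))); last first.
  by rewrite ler_wpM2l ?powR_ge0// lerD2l lerN2.
rewrite E -mulrA ler_pM ?powR_ge0// ?mulr_ge0 ?invr_ge0 ?subr_ge0//.
by rewrite mulrC ler_wpM2l ?subr_ge0// lef_pV2 ?posrE.
Qed.

Notation nc := (@Normc.normc R).

Lemma nc_half (a : CC R) : nc (a / 2) = nc a / 2.
Proof.
rewrite ncM ncV; congr (_ / _).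
by rewrite -(rmorph_nat (real_complex R)) nc_real ger0_norm.
Qed.

Lemma nc_midpoint p (a b : CC R) : 1 <= p ->
  nc ((a + b) / 2) `^ p <= (nc a `^ p + nc b `^ p) / 2.
Proof.
move=> p1; apply: le_trans (powR_midpoint p1 (nc_ge0 a) (nc_ge0 b)).
rewrite ge0_ler_powR ?nnegrE ?nc_ge0 ?divr_ge0 ?addr_ge0 ?nc_ge0// ?(le_trans ler01)//.
by rewrite nc_half ler_wpM2r ?invr_ge0// ncD.
Qed.

(* The loss in the triangle inequality when [a / b] is not real replaces the uniform convexity
   of the norm, which fails for [p = 1]. *)
Lemma nc_midpoint_gap p (a b : CC R) : 1 <= p ->
  1 / 2 <= nc a <= 2 -> 1 / 2 <= nc b <= 2 ->
  nc ((a + b) / 2) `^ p + (1 / 2) `^ p / 2048 * complex.Im (a / b) ^+ 2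
    <= (nc a `^ p + nc b `^ p) / 2.
Proof.
move=> p1 /andP[a1 a2] /andP[b1 b2].
set y := (nc a + nc b) / 2; set x := nc ((a + b) / 2).
have a0 := nc_ge0 a; have b0 := nc_ge0 b.
have x0 : 0 <= x by exact: nc_ge0.
have xy : x <= y by rewrite /x /y nc_half ler_wpM2r ?invr_ge0// ncD.
have y12 : 1 / 2 <= y <= 2 by apply/andP; split; rewrite /y; clear -a1 a2 b1 b2; lra.
have bpos : 0 < nc b by clear -b1; lra.
have apos : 0 < nc a by clear -a1; lra.
set q := a / b.
have aE : a = q * b by rewrite divfK// -nc_gt0.
have nA : nc a = nc q * nc b by rewrite -ncM -aE.
have key : complex.Im q ^+ 2 / 1024 <= y - x.
  (* [S] is the real part of [a] times the conjugate of [b]. Both [y ^+ 2 - x ^+ 2] and the squared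
     imaginary part are governed by [P - S], through [P ^+ 2 - S ^+ 2]. *)
  pose P := nc a * nc b; pose S := nc b ^+ 2 * complex.Re q.
  have sq : y ^+ 2 - x ^+ 2 = (P - S) / 2.
    have E1 : nc (a + b) ^+ 2 = nc a ^+ 2 + nc b ^+ 2 + 2 * S.
      have Eab : a + b = (q + 1) * b by rewrite mulrDl mul1r -aE.
      rewrite /S Eab nA ncM !exprMn (nc_sqr (q + 1)) (nc_sqr q) ReD ImD.
      have -> : complex.Re (1 : CC R) = 1 by [].
      have -> : complex.Im (1 : CC R) = 0 by [].
      by ring.
    by rewrite /y /x nc_half !expr_div_n E1 /P; field.
  have PS : P ^+ 2 - S ^+ 2 = nc b ^+ 4 * complex.Im q ^+ 2.
    by rewrite /P /S nA !exprMn (nc_sqr q); ring.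
  have P4 : P <= 4.
    have -> : 4 = 2 * 2 :> R by rewrite -natrM.
    by rewrite /P ler_pM.
  have Ppos : 0 < P by rewrite mulr_gt0.
  have b4 : 1 / 16 <= nc b ^+ 4.
    have -> : 1 / 16 = (1 / 2) ^+ 4 :> R by field.
    by rewrite lerXn2r// ?nnegrE ?divr_ge0.
  have SP : `|S| <= P.
    rewrite /S /P normrM (ger0_norm (sqr_ge0 _)) nA.
    have -> : nc q * nc b * nc b = nc b ^+ 2 * nc q by ring.
    by rewrite ler_wpM2l ?sqr_ge0// nc_Re.
  have H1 : complex.Im q ^+ 2 / 16 <= (P - S) * (P + S).
    have -> : (P - S) * (P + S) = P ^+ 2 - S ^+ 2 by ring.
    by rewrite PS mulrC ler_wpM2r ?sqr_ge0//; clear -b4; lra.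
  have [S1 S2] : S <= P /\ - P <= S by move: SP; rewrite ler_norml => /andP[].
  have H2 : (P - S) * (P + S) <= (P - S) * 8.
    by rewrite ler_wpM2l ?subr_ge0//; clear -S1 P4; lra.
  have H3 : (y - x) * (y + x) <= (y - x) * 4.
    by rewrite ler_wpM2l ?subr_ge0//; move/andP: y12 => [_ y2]; clear -y2 xy; lra.
  have H4 : (y - x) * (y + x) = (P - S) / 2 by rewrite -sq; ring.
  clear -H1 H2 H3 H4; lra.
apply: le_trans (powR_midpoint p1 a0 b0); rewrite -/y -lerBrDl.
apply: le_trans (powR_gap p1 _ y12); last by rewrite x0.
have -> : (1 / 2) `^ p / 2048 * complex.Im q ^+ 2 =
    (1 / 2) `^ p / 2 * (complex.Im q ^+ 2 / 1024) by field.
by rewrite ler_wpM2l ?divr_ge0 ?powR_ge0.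
Qed.

End PowerInequalities.

(** * Local boundedness and concentration of powers *)

Section LocalBound.
Variables (R : realType) (n : nat).
Notation C := (CC R).
Notation nc := (@Normc.normc R).
Notation V := 'rV[C]_n.
Implicit Types (f : V -> C) (x y z a : V) (v : V -> R).

Lemma continuous_normc f z : differentiable (f : V -> C^o) z ->
  {for z, continuous (fun w => nc (f w))}.
Proof.
move=> /differentiable_continuous fz.
move=> U /nbhs_ballP[e /= e0 eU].
have /fz : nbhs (f z) [set w | nc (w - f z) < e] by apply/nbhs_nc; exists e.
move=> /nbhs_rnorm[r r0 H]; apply/nbhs_rnorm; exists r => // w /H /=.
rewrite nc_distrC => fwz; apply: eU; rewrite /ball /=; apply: le_lt_trans fwz.
have h1 := ncD (f z - f w) (f w); rewrite subrK in h1.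
have h2 := ncD (f w - f z) (f z); rewrite subrK nc_distrC in h2.
by rewrite ler_norml; apply/andP; split; lra.
Qed.

Lemma rnorm_to_complex (x y : 'rV[R]_(n + n)) (e : R) : 0 < e ->
  (forall i, `|x 0 i - y 0 i| < e) -> rnorm (to_complex x - to_complex y) < e *+ 2.
Proof.
move=> e0 H; apply/rnorm_ltP; split=> [|k]; first by rewrite pmulrn_lgt0.
rewrite !mxE; apply: le_lt_trans (nc_le_ReIm _) _.
by rewrite ReB ImB /= ?mxE mulr2n ltrD// H.
Qed.

Lemma continuous_to_complex : continuous (@to_complex R n).
Proof.
move=> x U /nbhs_rnorm[r r0 rU].
have r2 : 0 < r / 2 by rewrite divr_gt0.
apply/nbhs_ballP; exists (r / 2) => // y [_ xy].
apply: rU; apply: lt_le_trans (rnorm_to_complex r2 _) _.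
  by move=> i; have := xy 0 i; rewrite /ball /= distrC.
by rewrite mulr2n -splitr.
Qed.

(** Only the finiteness of [B] matters: it makes the supremum taken in [concentration] exist.
    Compactness is obtained in real coordinates, inside a product of segments. *)
Lemma holo_bounded f a (r s : R) : 0 < s < r -> holo_ball f a r ->
  exists B, forall w, rnorm (w - a) < s -> nc (f w) <= B.
Proof.
move=> /andP[s0 sr] fh; pose x0 := of_complex a.
pose K := [set x : 'rV[R]_(n + n) | forall i, `[x0 0 i - s, x0 0 i + s]%classic (x ord0 i)].
pose K' := K `&` (@to_complex R n) @^-1` [set w | rnorm (w - a) <= s].
have cK : compact K.
  apply: (@rV_compact _ _ (fun i => `[x0 0 i - s, x0 0 i + s]%classic)) => i.
  exact: segment_compact.
have N1 (w w' : V) : rnorm w' - rnorm (w' - w) <= rnorm w.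
  by rewrite lerBlDr; have := rnormD w (w' - w); rewrite subrKC.
have clK' : closed [set x : 'rV[R]_(n + n) | rnorm (to_complex x - a) <= s].
  move=> x clx; rewrite /= leNgt; apply/negP => sx.
  pose e := rnorm (to_complex x - a) - s.
  have e0 : 0 < e by rewrite subr_gt0.
  have /clx[y [/= ys]] : nbhs x ((@to_complex R n) @^-1` [set w | rnorm (w - to_complex x) < e]).
    by apply: continuous_to_complex; apply/nbhs_rnorm; exists e.
  rewrite rnorm_distrC => xy.
  have := N1 (to_complex y - a) (to_complex x - a).
  rewrite opprB addrA subrK => H; move: H ys xy; rewrite /e; lra.
have cK' : compact K' by apply: compact_closedI.
have cg : {within K', continuous (fun x : 'rV[R]_(n + n) => nc (f (to_complex x)) : R^o)}.
  apply: continuous_in_subspaceT => x; rewrite inE => -[_ /= xs].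
  apply: (@continuous_comp _ _ _ (@to_complex R n) (fun w => nc (f w))).
    exact: continuous_to_complex.
  by apply: continuous_normc; apply: fh; exact: le_lt_trans sr.
have := compact_bounded (continuous_compact cg cK').
rewrite /bounded_set /bounded_near => /pinfty_ex_gt0[B B0 HB].
exists B => w wa; apply: le_trans (ler_norm _) _; apply: HB.
exists (of_complex w); last by rewrite of_complexK.
split; last by rewrite /= of_complexK ltW.
have /rnorm_ltP[_ H] := wa.
move=> i /=; rewrite in_itv /=.
suff : `|of_complex w 0 i - x0 0 i| <= s by rewrite ler_distl.
rewrite /x0 /of_complex !mxE; case: splitP => j _; rewrite !mxE.
  by rewrite -ReB; apply: le_trans (nc_Re _) _; have := H j; rewrite !mxE => /ltW.
by rewrite -ImB; apply: le_trans (nc_Im _) _; have := H j; rewrite !mxE => /ltW.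
Qed.

Lemma concentration_power (s q : R) : 0 < s <= 1 -> 1 <= q ->
  exists2 k : R, 0 < k & forall v a B,
    (forall y, rnorm (y - a) < s -> 0 <= v y <= B) -> slowly_varying v a s ->
    exists x r, [/\ 0 < r, 0 <= v x,
      forall y, rnorm (y - x) < r -> rnorm (y - a) < s /\ v x / 2 <= v y &
      k * v a `^ q <= (v x / 2) `^ q * (r / 2) ^+ (n + n)].
Proof.
move=> /andP[s0 s1] q1; pose m := (n + n)%N.
have k0 : 0 < kappa R m by rewrite /kappa mulr_gt0 ?exprn_gt0.
pose c := s ^+ m / (2 * kappa R m).
have c0 : 0 < c by rewrite divr_gt0 ?exprn_gt0// mulr_gt0.
exists (2^-1 ^+ m * c `^ q); first by rewrite mulr_gt0 ?exprn_gt0 ?powR_gt0.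
move=> v a B vB sv.
have q0 : q != 0 by rewrite gt_eqF// (lt_le_trans ltr01).
have va0 : 0 <= v a by have := vB a; rewrite subrr rnorm0 => /(_ s0) /andP[].
have [vaE|va] := eqVneq (v a) 0.
  exists a, s; split=> //.
    by move=> y ys; split=> //; rewrite vaE mul0r; have /andP[] := vB _ ys.
  by rewrite vaE powR0// mulr0 mulr_ge0 ?powR_ge0 ?exprn_ge0// divr_ge0// ltW.
have {}va : 0 < v a by rewrite lt_def va.
have [x [r [/andP[r0 rs] xr H]]] := concentration m s0 vB sv va.
have r1 : r <= 1 by apply: le_trans s1.
have vx0 : 0 <= v x.
  by have := xr x; rewrite subrr rnorm0 => /(_ r0)[/vB /andP[]].
exists x, r; split=> //.
rewrite -mulrA -powRM ?(ltW c0)// mulrC expr_div_n mulrA -exprVn ler_wpM2r ?exprn_ge0//.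
have H1 : c * v a <= v x / 2 * r ^+ m.
  rewrite /c mulrAC ler_pdivrMr ?mulr_gt0// mulrC.
  apply: le_trans H _; rewrite le_eqVlt; apply/orP; left; apply/eqP; by field.
have rm : 0 < r ^+ m <= 1 by rewrite exprn_gt0//= exprn_ile1// ltW.
apply: (@le_trans _ _ ((v x / 2 * r ^+ m) `^ q)).
  rewrite ge0_ler_powR ?nnegrE//; first by rewrite (le_trans ler01).
    by rewrite mulr_ge0 ?(ltW c0).
  by rewrite mulr_ge0 ?divr_ge0// exprn_ge0// ltW.
rewrite powRM ?divr_ge0 ?exprn_ge0 ?(ltW r0)// ler_wpM2l ?powR_ge0//.
by rewrite -[X in _ <= X]powRr1 ?exprn_ge0 ?(ltW r0)// ger_powR.
Qed.

End LocalBound.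

(** * The Bergman space and its minimizers *)

Section BergmanSpace.
Variables (R : realType) (n : nat) (Omega : set 'rV[CC R]_n) (p : R).
Hypotheses (oO : open Omega) (p1 : 1 <= p).
Notation C := (CC R).
Notation nc := (@Normc.normc R).
Notation V := 'rV[C]_n.
Notation tc := (@tuple_to_complex R n).
Notation D := (tc @^-1` Omega).
Notation energy f := (fine (int_powp Omega p f)).
Implicit Types (f g : V -> C) (x y z w a : V).

Let p_gt0 : 0 < p. Proof. exact: lt_le_trans p1. Qed.

Lemma open_rnorm z : Omega z -> exists2 r : R, 0 < r <= 1 &
  forall w, rnorm (w - z) < r -> Omega w.
Proof.
move=> Oz; have /nbhs_rnorm[r r0 H] := open_nbhs_nbhs (conj oO Oz).
exists (Num.min r 1) => [|w]; first by rewrite lt_min r0 ltr01 ge_min lexx orbT.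
by rewrite lt_min => /andP[/H].
Qed.

Lemma measurable_powp f : holomorphic Omega f ->
  measurable_fun D ((fun z => nc (f z) `^ p) \o tc).
Proof.
move=> hf; apply: (measurableT_comp (measurable_powR p)).
apply: (measurable_fun_continuous oO (g := fun z => nc (f z))) => z Oz.
by apply: continuous_normc; exact: hf.
Qed.

Lemma int_powp_ge0 f : (0 <= int_powp Omega p f)%E.
Proof. by apply: integral_ge0 => t _; rewrite lee_fin powR_ge0. Qed.

Lemma energy_ge0 f : 0 <= energy f.
Proof. exact/fine_ge0/int_powp_ge0. Qed.

Lemma energyE f : Ap Omega p f -> int_powp Omega p f = (energy f)%:E.
Proof. by move=> [_ fI]; rewrite fineK// ge0_fin_numE// int_powp_ge0. Qed.

Lemma energyP f e : holomorphic Omega f -> int_powp Omega p f = e%:E ->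
  Ap Omega p f /\ energy f = e.
Proof. by move=> hf fe; split; [split=> //; rewrite fe ltry|rewrite fe]. Qed.

Lemma int_powp_intO f : int_powp Omega p f = intO Omega (fun z => nc (f z) `^ p).
Proof. by []. Qed.

Lemma holomorphicZ c f : holomorphic Omega f -> holomorphic Omega (fun z => c * f z).
Proof.
move=> hf z Oz; apply: (@differentiableM _ _ (cst c : V -> C^o) (f : V -> C^o)).
  exact: differentiable_cst.
exact: hf.
Qed.

Lemma holomorphic_half f g : holomorphic Omega f -> holomorphic Omega g ->
  holomorphic Omega (fun z => (f z + g z) / 2).
Proof.
move=> hf hg z Oz.
apply: (@differentiableM _ _ ((fun z => f z + g z) : V -> C^o) (cst (2^-1) : V -> C^o)).
  by apply: (@differentiableD _ _ _ (f : V -> C^o) (g : V -> C^o)); [exact: hf|exact: hg].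
exact: differentiable_cst.
Qed.

Lemma Ap_scale c f : Ap Omega p f ->
  Ap Omega p (fun z => c * f z) /\ energy (fun z => c * f z) = nc c `^ p * energy f.
Proof.
move=> Af; have [hf _] := Af; apply: energyP; first exact: holomorphicZ.
rewrite EFinM -energyE// !int_powp_intO -intOZ//.
- congr (intO Omega); apply/funext => z.
  by rewrite ncM powRM ?nc_ge0.
- exact: measurable_powp.
- by move=> z _; exact: powR_ge0.
- exact: powR_ge0.
Qed.

Lemma intO_half f g : Ap Omega p f -> Ap Omega p g ->
  intO Omega (fun z => (nc (f z) `^ p + nc (g z) `^ p) / 2) =
  ((energy f + energy g) / 2)%:E.
Proof.
move=> Af Ag; have [hf _] := Af; have [hg _] := Ag.
rewrite mulrC EFinM EFinD -!energyE// !int_powp_intO -intOD//; last 4 first.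
- exact: measurable_powp.
- exact: measurable_powp.
- by move=> z _; exact: powR_ge0.
- by move=> z _; exact: powR_ge0.
rewrite -intOZ//.
- by congr (intO Omega); apply/funext => z; rewrite mulrC.
- by apply: measurable_funD; exact: measurable_powp.
- by move=> z _; rewrite addr_ge0// powR_ge0.
Qed.

Lemma measurable_half f g : holomorphic Omega f -> holomorphic Omega g ->
  measurable_fun D ((fun z => (nc (f z) `^ p + nc (g z) `^ p) / 2) \o tc).
Proof.
move=> hf hg; apply: measurable_funM; last exact: measurable_cst.
by apply: measurable_funD; exact: measurable_powp.
Qed.

Lemma Ap_half f g : Ap Omega p f -> Ap Omega p g -> Ap Omega p (fun z => (f z + g z) / 2).
Proof.
move=> Af Ag; have [hf _] := Af; have [hg _] := Ag.
split; first exact: holomorphic_half.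
apply: (@le_lt_trans _ _ ((energy f + energy g) / 2)%:E); last by rewrite ltry.
rewrite -intO_half// int_powp_intO; apply: intO_le => //.
- by apply: measurable_powp; exact: holomorphic_half.
- exact: measurable_half.
- by move=> z _; rewrite powR_ge0 nc_midpoint.
Qed.

Lemma energy_half_gain f g x (c r : R) : Ap Omega p f -> Ap Omega p g ->
  0 <= c -> 0 < r ->
  (forall z, rnorm (z - x) < r -> Omega z /\
     nc ((f z + g z) / 2) `^ p + c <= (nc (f z) `^ p + nc (g z) `^ p) / 2) ->
  energy (fun z => (f z + g z) / 2) + c * (r / 2) ^+ (n + n) <= (energy f + energy g) / 2.
Proof.
move=> Af Ag c0 r0 H; have [hf _] := Af; have [hg _] := Ag.
rewrite -lee_fin -intO_half// EFinD -energyE; last exact: Ap_half.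
rewrite int_powp_intO; apply: (intO_gain oO _ _ _ c0 r0 H).
- by apply: measurable_powp; exact: holomorphic_half.
- exact: measurable_half.
- by move=> z _; rewrite powR_ge0 nc_midpoint.
Qed.

(** In the role of the sub-mean value property: [|f|] is at least half of [|f x|] on some ball
    around [x], and the mass of that ball dominates [|f a|^p]. The doubled radius ensures that [f]
    is bounded on the ball of radius [s]. *)
Lemma Ap_bound (s : R) : 0 < s <= 1 -> exists2 k : R, 0 < k & forall f a,
  (forall w, rnorm (w - a) < s *+ 2 -> Omega w) -> Ap Omega p f ->
  k * nc (f a) `^ p <= energy f.
Proof.
move=> s01; have /andP[s0 _] := s01.
have [k k0 H] := concentration_power n s01 p1.
exists k => // f a aO Af; have [hf _] := Af.
have ss : s < s *+ 2 by rewrite mulr2n ltrDl.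
have hb : holo_ball f a (s *+ 2) by move=> w /aO; exact: hf.
have hb' : holo_ball f a s by move=> w ws; apply: hb; exact: lt_trans ss.
have [|B HB] := @holo_bounded R n f a (s *+ 2) s _ hb; first by rewrite s0.
have [|x [r [r0 vx0 xr Hk]]] := H (fun z => nc (f z)) a B _ (slowly_varying_normc hb').
  by move=> y ys; rewrite nc_ge0 HB.
apply: le_trans Hk _; rewrite -lee_fin -energyE// int_powp_intO.
rewrite -[leLHS]add0e.
have -> : 0%E = intO Omega (fun=> 0 : R) by rewrite /intO integral0.
apply: (intO_gain oO (x := x)) => //.
- exact: measurable_cst.
- exact: measurable_powp.
- by move=> z _; rewrite lexx powR_ge0.
- exact: powR_ge0.
- move=> z /xr[zs vz]; split; first by apply: aO; exact: lt_trans ss.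
  rewrite add0r ge0_ler_powR// ?nnegrE ?nc_ge0 ?divr_ge0//; exact: ltW.
Qed.

Lemma normp_powR f : normp Omega p f `^ p = energy f.
Proof. by rewrite /normp -powRrM mulVf ?gt_eqF// powRr1// energy_ge0. Qed.

Lemma normp_ge0 f : 0 <= normp Omega p f.
Proof. exact: powR_ge0. Qed.

Lemma mp_le f z : Ap Omega p f -> f z = 1 -> mp Omega p z <= normp Omega p f.
Proof.
move=> Af fz; apply: ge_inf; last by exists f.
by exists 0 => _ [g _ <-]; exact: normp_ge0.
Qed.

Hypothesis Ap_one : Ap Omega p (cst 1).

Lemma mp_ge0 z : 0 <= mp Omega p z.
Proof.
apply: lb_le_inf; first by exists (normp Omega p (cst 1)), (cst 1).
by move=> _ [g _ <-]; exact: normp_ge0.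
Qed.

Lemma powR_mono (x y : R) : 0 <= x -> 0 <= y -> x <= y -> x `^ p <= y `^ p.
Proof. by move=> x0 y0; apply: ge0_ler_powR; rewrite ?nnegrE// ltW. Qed.

Definition min_energy z : R := mp Omega p z `^ p.

Lemma min_energy_ge0 z : 0 <= min_energy z. Proof. exact: powR_ge0. Qed.

(** [f / f z] competes for the infimum at [z] unless [f z = 0]. *)
Lemma min_energy_le f z : Ap Omega p f -> nc (f z) `^ p * min_energy z <= energy f.
Proof.
move=> Af; have [fz0|fz] := eqVneq (f z) 0.
  by rewrite fz0 nc0 powR0 ?gt_eqF// mul0r energy_ge0.
have [Ag Eg] := Ap_scale (f z)^-1 Af.
have H := mp_le Ag (mulVf fz).
have := powR_mono (mp_ge0 z) (normp_ge0 _) H.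
rewrite normp_powR Eg -/(min_energy z) => H2.
have P : 0 < nc (f z) `^ p by rewrite powR_gt0 ?nc_gt0.
rewrite -(ler_pM2l P) in H2; apply: le_trans H2 _.
by rewrite mulrA -powRM ?nc_ge0// -ncM divff// nc1 powR1 mul1r.
Qed.

Lemma min_energy_gt0 z : Omega z -> 0 < min_energy z.
Proof.
move=> Oz; have [r /andP[r0 r1] rO] := open_rnorm Oz.
have s01 : 0 < r / 2 <= 1.
  by rewrite divr_gt0//= ler_pdivrMr// (le_trans r1)// mul1r ler1n.
have [k k0 H] := Ap_bound s01.
have kp : 0 < k `^ p^-1 by rewrite powR_gt0.
apply/powR_gt0/(lt_le_trans kp); apply: lb_le_inf.
  by exists (normp Omega p (cst 1)), (cst 1).
move=> _ [g [Ag gz] <-]; rewrite /normp ge0_ler_powR ?nnegrE ?invr_ge0 ?(ltW p_gt0) ?(ltW k0) ?energy_ge0//.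
have := H g z; rewrite gz nc1 powR1 mulr1; apply => //.
by rewrite mulr2n -splitr.
Qed.

Definition is_minimizer z f := [/\ Ap Omega p f, f z = 1 & normp Omega p f = mp Omega p z].

Lemma is_minimizer_energy z f : is_minimizer z f -> energy f = min_energy z.
Proof. by move=> [_ _ E]; rewrite -normp_powR E. Qed.

(** The supremum is attained by the minimizer divided by its norm; [min_energy_le] gives the upper
    bound. *)
Lemma Kp_min_energy z : Omega z -> (exists f, is_minimizer z f) ->
  Kp Omega p z = (min_energy z)^-1.
Proof.
move=> Oz [f mf]; have [Af fz fE] := mf; have J0 := min_energy_gt0 Oz.
have m0 : mp Omega p z != 0 by apply: contraTneq J0 => m0; rewrite /min_energy m0 powR0 ?ltxx// gt_eqF.
have mgt : 0 < mp Omega p z by rewrite lt_def m0 mp_ge0.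
have ub : ubound [set nc (g z) `^ p | g in [set g | Ap Omega p g /\ normp Omega p g = 1]] (min_energy z)^-1.
  move=> _ [g [Ag g1] <-]; rewrite -(ler_pM2r J0) mulVf ?gt_eqF//.
  by have := min_energy_le z Ag; rewrite -normp_powR g1 powR1.
have mem : [set nc (g z) `^ p | g in [set g | Ap Omega p g /\ normp Omega p g = 1]] (min_energy z)^-1.
  pose c : C := ((mp Omega p z)^-1)%:C%C.
  have [Acf Ecf] := Ap_scale c Af.
  have ncc : nc c = (mp Omega p z)^-1 by rewrite nc_real gtr0_norm// invr_gt0.
  have cJ : nc c `^ p = (min_energy z)^-1.
    have Jn : min_energy z != 0 by rewrite gt_eqF.
    rewrite ncc; apply: (mulIf Jn); rewrite mulVf// /min_energy.
    by rewrite -powRM ?invr_ge0 ?(ltW mgt)// mulVf// powR1.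
  exists (fun w => c * f w).
    split=> //; rewrite /normp Ecf (is_minimizer_energy mf) cJ mulVf ?gt_eqF//.
    by rewrite powR1.
  by rewrite fz mulr1 cJ.
apply/eqP; rewrite eq_le; apply/andP; split.
  by apply: ge_sup => //; exists (min_energy z)^-1.
by apply: ub_le_sup => //; exists (min_energy z)^-1.
Qed.

End BergmanSpace.

Section PowerLipschitz.
Variable R : realType.
Implicit Types (x y p A : R).

(** Bernoulli at [y / x] for [y <= x], then [x]^ p <= A [^ p * (x / A)]. *)
Lemma powR_lipschitz p x y A : 1 <= p -> 1 <= A -> 0 <= x <= A -> 0 <= y <= A ->
  `|x `^ p - y `^ p| <= p * A `^ p * `|x - y|.
Proof.
move=> p1 A1; wlog yx : x y / y <= x.
  move=> H xA yA; have [yx|/ltW xy] := leP y x; first exact: H.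
  by rewrite distrC [X in _ <= _ * X]distrC; exact: H.
move=> /andP[x0 xA] /andP[y0 yA].
have p0 : 0 < p by apply: lt_le_trans p1.
have A0 : 0 < A by apply: lt_le_trans A1.
have yxp : y `^ p <= x `^ p by apply: ge0_ler_powR; rewrite ?nnegrE// ltW.
rewrite !ger0_norm ?subr_ge0//.
have [x00|xn0] := eqVneq x 0.
  have y00 : y = 0 by apply/eqP; rewrite eq_le y0 -{1}x00 yx.
  by rewrite x00 y00 !subrr mulr0.
have xgt : 0 < x by rewrite lt_def xn0.
have yx0 : 0 <= y / x by rewrite divr_ge0.
have xA0 : 0 < x / A by rewrite divr_gt0.
have H1 : x `^ p - y `^ p <= p * (x `^ p * (1 - y / x)).
  have yE : y `^ p = x `^ p * (y / x) `^ p by rewrite -powRM// mulrC divfK.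
  have := powR_bernoulli p1 yx0; rewrite -(ler_pM2l (powR_gt0 p xgt)) -yE.
  by move: (x `^ p) (y `^ p) (y / x) => a b c; clear; nra.
have H2 : x `^ p <= A `^ p * (x / A).
  have -> : x `^ p = A `^ p * (x / A) `^ p.
    by rewrite -powRM ?(ltW A0) ?(ltW xA0)// mulrC divfK// gt_eqF.
  rewrite ler_wpM2l ?powR_ge0// -[X in _ <= X](powRr1 (ltW xA0)) ger_powR//.
  by rewrite xA0 ler_pdivrMr// mul1r.
apply: le_trans H1 _; rewrite -mulrA ler_wpM2l ?(ltW p0)//.
have yx1 : 0 <= 1 - y / x by rewrite subr_ge0 ler_pdivrMr// mul1r.
apply: le_trans (ler_wpM2r yx1 H2) _; rewrite -mulrA ler_wpM2l ?powR_ge0//.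
have -> : x / A * (1 - y / x) = (x - y) / A by field; rewrite xn0 gt_eqF.
by rewrite ler_pdivrMr// ler_peMr// subr_ge0.
Qed.

End PowerLipschitz.

(** * Limits along an ultrafilter *)

Section UltraLimit.
Variables (R : realType) (U : set_system nat).
Notation C := (CC R).
Notation nc := (@Normc.normc R).
Implicit Types (u v : nat -> C) (l : C).

Definition flim u l := forall e : R, 0 < e -> U [set k | nc (u k - l) < e].

(** Compactness of a segment in its ultrafilter form. One fixed [U] then serves for all points and
    all coefficients at once. *)
Lemma flim_bounded_exists (UU : UltraFilter U) u (A : R) : (forall k, nc (u k) <= A) -> exists l, flim u l.
Proof.
move=> uA.
have real_lim (v : nat -> R) : (forall k, `|v k| <= A) ->
    exists l : R, forall e, 0 < e -> U [set k | `|v k - l| < e].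
  move=> vA; have := @segment_compact R (- A) A; rewrite compact_ultra => /(_ (v @ U)).
  (* The image of an ultrafilter is maximal: if [B] belongs to a finer filter but its preimage is
     not in [U], the preimage of the complement is. *)
  have vU : UltraFilter (v @ U).
    split=> [|G GF vG]; first exact: fmap_proper_filter.
    apply/seteqP; split=> [B GB|]; last exact: vG.
    have [//|UnB] := in_ultra_setVsetC (v @^-1` B) UU.
    have {UnB} /vG UnB : (v @ U) (~` B) by exact: UnB.
    by have /filter_ex[? []] : G (B `&` ~` B) by exact: filterI.
  case/(_ vU) => [|l [_ vl]].
    by apply: (@filterS _ U _ setT) => [k _|]; [rewrite /= in_itv /= -ler_norml|exact: filterT].
  exists l => e e0; have H : U (v @^-1` ball l e) by apply: vl; exact: nbhsx_ballx.
  by apply: filterS H => k; rewrite /= /ball /= distrC.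
have [a Ha] := real_lim (fun k => complex.Re (u k)) (fun k => le_trans (nc_Re _) (uA k)).
have [b Hb] := real_lim (fun k => complex.Im (u k)) (fun k => le_trans (nc_Im _) (uA k)).
exists (Complex a b) => e e0.
have e2 : 0 < e / 2 by rewrite divr_gt0.
apply: filterS (filterI (Ha _ e2) (Hb _ e2)) => k [/= h1 h2].
apply: le_lt_trans (nc_le_ReIm _) _; rewrite ReB ImB /= [e]splitr; exact: ltrD.
Qed.

Context {UF : ProperFilter U}.

Lemma flimD u v l m : flim u l -> flim v m -> flim (fun k => u k + v k) (l + m).
Proof.
move=> ul vm e e0; have e2 : 0 < e / 2 by rewrite divr_gt0.
apply: filterS (filterI (ul _ e2) (vm _ e2)) => k [/= h1 h2].
have -> : u k + v k - (l + m) = (u k - l) + (v k - m) by ring.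
by apply: le_lt_trans (ncD _ _) _; rewrite [e]splitr ltrD.
Qed.

Lemma flimMl c u l : flim u l -> flim (fun k => c * u k) (c * l).
Proof.
move=> ul e e0; have c0 : 0 < nc c + 1 by rewrite ltr_wpDl// nc_ge0.
have e2 : 0 < e / (nc c + 1) by rewrite divr_gt0.
apply: filterS (ul _ e2) => k /= h; rewrite -mulrBr ncM.
rewrite ltr_pdivlMr// in h; apply: le_lt_trans h; rewrite mulrC.
by rewrite ler_wpM2l ?nc_ge0// lerDl.
Qed.

Lemma flim_cst c : flim (fun=> c) c.
Proof. by move=> e e0; apply: (@filterS _ U _ setT) => [k _|]; [rewrite /= subrr nc0|exact: filterT]. Qed.

Lemma flimB u v l m : flim u l -> flim v m -> flim (fun k => u k - v k) (l - m).
Proof.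
move=> ul vm; have := flimD ul (flimMl (- 1) vm); rewrite mulN1r => H e e0.
by apply: filterS (H e e0) => k /=; rewrite mulN1r.
Qed.

Lemma flim_le u l (B : R) : flim u l -> (forall k, nc (u k) <= B) -> nc l <= B.
Proof.
move=> ul uB; apply/ler_addgt0Pr => e e0.
have [k /= h] := filter_ex (ul e e0).
have := ncD (l - u k) (u k); rewrite subrK nc_distrC => /le_trans; apply.
by rewrite addrC lerD// ltW.
Qed.

Lemma flim_sum (I : Type) (s : seq I) (u : I -> nat -> C) (l : I -> C) :
  (forall i, flim (u i) (l i)) -> flim (fun k => \sum_(i <- s) u i k) (\sum_(i <- s) l i).
Proof.
move=> H; elim: s => [|i s IH].
  rewrite big_nil => e e0; apply: filterS (flim_cst 0 e0) => k.
  by rewrite /= big_nil.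
rewrite big_cons => e e0; apply: filterS (flimD (H i) IH e0) => k.
by rewrite /= big_cons.
Qed.

End UltraLimit.

Section BoundedDomain.
Variables (R : realType) (n : nat).
Notation C := (CC R).
Notation nc := (@Normc.normc R).
Notation V := 'rV[C]_n.

Lemma norm_of_complex (w : V) i : `|of_complex w 0 i| <= rnorm w.
Proof.
rewrite /of_complex !mxE; case: splitP => j _; rewrite !mxE.
  by apply: le_trans (nc_Re _) (rnorm_coord _ _).
by apply: le_trans (nc_Im _) (rnorm_coord _ _).
Qed.

(** A bounded set lies in a cube of finite measure. The constant [1] thus competes in every infimum
    [mp], and its energy bounds all the minimal energies. *)
Lemma Ap_one_bounded (Omega : set V) (p : R) : open Omega -> bounded_set Omega ->
  Ap Omega p (cst 1).
Proof.
move=> oO bO; split; first by move=> z _; exact: differentiable_cst.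
have [M M0 HM] : exists2 M : R, 0 < M & forall z, Omega z -> rnorm z <= M.
  move: bO => /pinfty_ex_gt0[B /CC_gt0E[M M0 ->] H].
  by exists M => // z /H /=; rewrite rnormE lecR.
have E : int_powp Omega p (cst 1) = lebesgueT R (n + n) ((@tuple_to_complex R n) @^-1` Omega).
  rewrite /int_powp (eq_integral (cst 1%E)) => [|t _].
    by rewrite integral_cst ?mul1e//; exact: measurable_preimage_open.
  by rewrite /= nc1 powR1.
rewrite E; apply: (@le_lt_trans _ _ ((M *+ 2) ^+ (n + n))%:E); last by rewrite ltry.
rewrite -(cube_measure 0 M0); apply: le_measure; rewrite ?inE.
- exact: measurable_preimage_open.
- apply: (@measurable_box _ _ (fun i => `[of_complex 0 0 i - M, of_complex 0 0 i + M]%classic)) => i.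
  exact: measurable_itv.
- move=> t /= /HM tM i; have := norm_of_complex (tuple_to_complex t) i.
  rewrite to_complexK !mxE => /le_trans/(_ tM).
  case: splitP => j _; rewrite !mxE /= in_itv /= sub0r add0r -ler_norml //.
Qed.

End BoundedDomain.

(** * Minimizing sequences and their limits *)

Section Existence.
Variables (R : realType) (n : nat) (Omega : set 'rV[CC R]_n) (p : R).
Hypotheses (oO : open Omega) (p1 : 1 <= p) (Ap_one : Ap Omega p (cst 1)).
Notation C := (CC R).
Notation nc := (@Normc.normc R).
Notation V := 'rV[C]_n.
Notation tc := (@tuple_to_complex R n).
Notation D := (tc @^-1` Omega).
Notation energy f := (fine (int_powp Omega p f)).
Implicit Types (f g : V -> C) (x y z w a : V).

Let p_gt0 : 0 < p. Proof. exact: lt_le_trans p1. Qed.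

Lemma minimizing_sequence z : exists f : nat -> V -> C,
  forall k, [/\ Ap Omega p (f k), f k z = 1 & energy (f k) <= min_energy Omega p z + k.+1%:R^-1].
Proof.
suff /choice[f Hf] : forall k : nat, exists f : V -> C,
    [/\ Ap Omega p f, f z = 1 & energy f <= min_energy Omega p z + k.+1%:R^-1].
  by exists f.
move=> k; set J := min_energy _ _ _; pose e : R := k.+1%:R^-1.
have e0 : 0 < e by rewrite invr_gt0.
have J0 : 0 <= J by exact: min_energy_ge0.
have Je : 0 <= J + e by rewrite addr_ge0// ltW.
pose t := (J + e) `^ p^-1.
have tp : t `^ p = J + e by rewrite /t -powRrM mulVf ?gt_eqF// powRr1.
have mt : mp Omega p z < t.
  rewrite ltNge; apply/negP => /(powR_mono p1 (powR_ge0 _ _) (mp_ge0 Ap_one z)).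
  by rewrite tp -/(min_energy Omega p z) -/J gerDl leNgt e0.
have hi : has_inf [set normp Omega p f | f in [set f | Ap Omega p f /\ f z = 1]].
  split; first by exists (normp Omega p (cst 1)), (cst 1).
  by exists 0 => _ [g _ <-]; exact: powR_ge0.
have tm : 0 < t - mp Omega p z by rewrite subr_gt0.
have [_ [f [Af fz] <-]] := inf_adherent tm hi.
rewrite -/(mp Omega p z) subrKC => ft.
exists f; split=> //; rewrite -(normp_powR _ p1) -tp.
by apply: (powR_mono p1); [exact: powR_ge0|exact: powR_ge0|exact: ltW].
Qed.

(** [Ap_bound] at all centres near [a]. The bound depends on [f] only through its energy, so it
    serves minimizing sequences and, later, all minimizers simultaneously. *)
Lemma locally_uniformly_bounded (E : R) a : Omega a -> exists r A : R,
  [/\ 0 < r, forall w, rnorm (w - a) < r -> Omega w &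
   forall f, Ap Omega p f -> energy f <= E -> forall w, rnorm (w - a) < r -> nc (f w) <= A].
Proof.
move=> Oa; have [r /andP[r0 r1] rO] := open_rnorm oO Oa.
have s01 : 0 < r / 4 <= 1.
  by rewrite divr_gt0//= ler_pdivrMr// (le_trans r1)// mul1r ler1n.
have [k k0 H] := Ap_bound oO p1 s01.
exists (r / 2), ((E / k) `^ p^-1); split.
- by rewrite divr_gt0.
- by move=> w wr; apply: rO; apply: lt_le_trans wr _; rewrite ler_pdivrMr// ler_peMr ?ler1n// ltW.
move=> f Af fE w wr.
have B : k * nc (f w) `^ p <= E.
  apply: le_trans fE; apply: H => // y yw; apply: rO.
  have -> : y - a = (y - w) + (w - a) by rewrite addrA subrK.
  apply: le_lt_trans (rnormD _ _) _; rewrite [r]splitr ltrD//.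
  by apply: lt_le_trans yw _; rewrite -mulr_natr; lra.
rewrite -[leLHS](powRr1 (nc_ge0 _)) -(mulfV (lt0r_neq0 p_gt0)) powRrM.
apply: ge0_ler_powR; rewrite ?nnegrE ?invr_ge0 ?(ltW p_gt0) ?powR_ge0//.
  rewrite divr_ge0 ?(ltW k0)//; apply: le_trans B.
  by rewrite mulr_ge0 ?powR_ge0// ltW.
by rewrite ler_pdivlMr// mulrC.
Qed.

Section Limit.
Variables (U : set_system nat) (UU : UltraFilter U).
Variables (F : nat -> V -> C) (E : R).
Hypothesis AF : forall k, Ap Omega p (F k).
Hypothesis FE : forall k, energy (F k) <= E.

Lemma pointwise_limit : exists f : V -> C, forall w, Omega w -> flim U (F ^~ w) (f w).
Proof.
suff /choice[f Hf] : forall w, exists l : C, Omega w -> flim U (F ^~ w) l by exists f.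
move=> w; have [Ow|nOw] := pselect (Omega w); last by exists 0.
have [r [A [r0 _ H]]] := locally_uniformly_bounded E Ow.
have [|l Hl] := @flim_bounded_exists R U UU (F ^~ w) A; last by exists l.
by move=> k; apply: (H (F k) (AF k) (FE k) w); rewrite subrr rnorm0.
Qed.

(** The Taylor bound [K |h|^2] is uniform in [k] and passes to the limit. The limit differential is
    assembled from the limits of the differentials on the basis vectors. *)
Lemma limit_holomorphic f : (forall w, Omega w -> flim U (F ^~ w) (f w)) ->
  holomorphic Omega f.
Proof.
move=> fF a Oa; have [r [A [r0 rO H]]] := locally_uniformly_bounded E Oa.
have FA k w : rnorm (w - a) < r -> nc (F k w) <= A.
  exact: (H (F k) (AF k) (FE k) w).
have Fh k : holo_ball (F k) a r.
  by move=> w /rO Ow; have [hf _] := AF k; exact: hf.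
have A0 : 0 <= A by apply: le_trans (nc_ge0 _) (FA 0%N a _); rewrite subrr rnorm0.
pose K := 128 * A / r ^+ 2.
have K0 : 0 <= K.
  by apply: divr_ge0; [apply: mulr_ge0 => //; exact: ler0n|exact/exprn_ge0/ltW].
have r16 : 0 < r / 16 by rewrite divr_gt0.
have r16r : r / 16 <= r by rewrite ler_pdivrMr// ler_peMr ?ler1n// ltW.
pose L k := 'd (F k : V -> C^o) a.
have T k h : rnorm h < r / 16 -> nc (F k (a + h) - F k a - L k h) <= K * rnorm h ^+ 2.
  by move=> hr; apply: (holo_taylor r0 (Fh k) (FA k)) => //; rewrite subrr rnorm0.
pose e_ j : V := delta_mx 0 j.
have LE k h : L k h = \sum_j h 0 j * L k (e_ j).
  rewrite {1}(row_sum_delta h) linear_sum; apply: eq_bigr => j _.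
  by rewrite linearZ.
(* At a short step along [e_ j] the Taylor bound compares the differential with a difference of
   values of [F k], hence bounds it uniformly in [k]. *)
have /choice[l Hl] : forall j, exists l, flim U (fun k => L k (e_ j)) l.
  move=> j; pose t := r / 16 / 2 / (rnorm (e_ j) + 1).
  have N0 : 0 < rnorm (e_ j) + 1 by rewrite ltr_wpDl// rnorm_ge0.
  have t0 : 0 < t by rewrite !divr_gt0.
  have Nt : rnorm (t%:C%C *: e_ j) < r / 16.
    rewrite rnormZ nc_real gtr0_norm//.
    apply: (@le_lt_trans _ _ (t * (rnorm (e_ j) + 1))).
      by rewrite ler_wpM2l ?(ltW t0)// lerDl.
    by rewrite /t divfK ?gt_eqF// ltr_pdivrMr// ltr_pMr// ltr1n.
  apply: (@flim_bounded_exists R U UU _ ((A + A + K * rnorm (t%:C%C *: e_ j) ^+ 2) / t)) => k.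
  rewrite ler_pdivlMr// mulrC.
  have -> : t * nc (L k (e_ j)) = nc (L k (t%:C%C *: e_ j)).
    by rewrite linearZ ncM nc_real gtr0_norm.
  have -> : L k (t%:C%C *: e_ j) = (F k (a + t%:C%C *: e_ j) - F k a)
     - (F k (a + t%:C%C *: e_ j) - F k a - L k (t%:C%C *: e_ j)) by ring.
  apply: le_trans (ncB _ _) _; apply: lerD; last exact: T.
  apply: le_trans (ncB _ _) _; apply: lerD; apply: FA.
    by rewrite addrAC subrr add0r; exact: lt_le_trans r16r.
  by rewrite subrr rnorm0.
pose g w := \sum_j w 0 j * l j.
have dg : differentiable (g : V -> C^o) a.
  have -> : (g : V -> C^o) = \sum_j (fun w : V => w 0 j * l j : C^o).
    by apply/funext => w; rewrite /g fct_sumE.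
  apply: differentiable_sum => j.
  apply: (@differentiableM _ _ ((fun w : V => w 0 j) : V -> C^o) (cst (l j) : V -> C^o)).
    exact: differentiable_coord.
  exact: differentiable_cst.
apply: (expansion_differentiable dg) => e e0.
have K1 : 0 < K + 1 by rewrite ltr_wpDl.
exists (Num.min (r / 16) (e / (K + 1))) => [|h]; first by rewrite lt_min r16 divr_gt0.
rewrite lt_min => /andP[hr he].
apply: (@le_trans _ _ (K * rnorm h ^+ 2)); last first.
  rewrite expr2 mulrA ler_wpM2r ?rnorm_ge0//.
  rewrite ltr_pdivlMr// in he; apply: le_trans (ltW he).
  by rewrite mulrC ler_wpM2l ?rnorm_ge0// lerDl.
have Oah : Omega (a + h).
  by apply: rO; rewrite addrAC subrr add0r; exact: lt_le_trans r16r.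
have -> : g (a + h) - g a = \sum_j h 0 j * l j.
  rewrite /g -sumrB; apply: eq_bigr => j _; rewrite mxE; ring.
apply: (@flim_le _ U _ (fun k => F k (a + h) - F k a - \sum_j h 0 j * L k (e_ j))).
  apply: flimB; first by apply: flimB; exact: fF.
  by apply: flim_sum => j; exact: flimMl.
by move=> k; rewrite -LE; exact: T.
Qed.

End Limit.
End Existence.

Section Minimizer.
Variables (R : realType) (n : nat) (Omega : set 'rV[CC R]_n) (p : R).
Hypotheses (oO : open Omega) (p1 : 1 <= p) (Ap_one : Ap Omega p (cst 1)).
Notation C := (CC R).
Notation nc := (@Normc.normc R).
Notation V := 'rV[C]_n.
Notation tc := (@tuple_to_complex R n).
Notation D := (tc @^-1` Omega).
Notation energy f := (fine (int_powp Omega p f)).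
Implicit Types (f g : V -> C) (x y z w a : V).

Let p_gt0 : 0 < p. Proof. exact: lt_le_trans p1. Qed.

Definition rational_point (i : nat) : V :=
  if unpickle i is Some q then to_complex (map_mx (@ratr R) (q : 'rV[rat]_(n + n))) else 0.

Lemma rational_point_dense w (e : R) : 0 < e ->
  exists i, rnorm (rational_point i - w) < e.
Proof.
move=> e0; have e2 : 0 < e / 2 by rewrite divr_gt0.
have [q Hq] := @rat_approx R _ (fun i => of_complex w 0 i) _ e2.
exists (pickle q); rewrite /rational_point pickleK -{1}[w]of_complexK.
rewrite [e]splitr -mulr2n; apply: rnorm_to_complex => // i.
by rewrite mxE distrC.
Qed.

(* The limit is taken along an ultrafilter; a genuine subsequence, needed for Fatou's lemma,
   is recovered from convergence at the rational points and local equicontinuity. *)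
Lemma limit_subsequence (F : nat -> V -> C) (E : R) :
  (forall k, Ap Omega p (F k)) -> (forall k, energy (F k) <= E) ->
  exists (f : V -> C) (s : nat -> nat), [/\ holomorphic Omega f, forall m, (m <= s m)%N &
    forall w, Omega w -> (nc (F (s m) w - f w) @[m --> \oo] --> 0)%R].
Proof.
move=> AF FE.
have [U [UU sU]] := ultraFilterLemma (@eventually_filter).
have [f fF] := pointwise_limit oO p1 UU AF FE.
have hf := limit_holomorphic oO p1 UU AF FE fF.
(* [U] contains all tails and is closed under finite intersections, so an index beyond [m] can meet
   the conditions at the first [m + 1] rational points. *)
have /choice[s Hs] : forall m, exists k, (m <= k)%N /\
    forall i, (i <= m)%N -> Omega (rational_point i) ->
      nc (F k (rational_point i) - f (rational_point i)) < m.+1%:R^-1.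
  move=> m; have e0 : 0 < m.+1%:R^-1 :> R by rewrite invr_gt0.
  have Uj : forall j, U [set k | forall i, (i < j)%N -> Omega (rational_point i) ->
      nc (F k (rational_point i) - f (rational_point i)) < m.+1%:R^-1].
    elim=> [|j IH]; first by apply: (@filterS _ U _ setT) => //; exact: filterT.
    have Ui : U [set k | Omega (rational_point j) ->
      nc (F k (rational_point j) - f (rational_point j)) < m.+1%:R^-1].
      have [Oj|nOj] := pselect (Omega (rational_point j)).
        by apply: filterS (fF _ Oj _ e0) => k /= h _.
      have UT : U setT by exact: filterT.
      by apply: filterS UT => k _ /nOj.
    apply: filterS (filterI IH Ui) => k [/= h1 h2] i.
    by rewrite ltnS leq_eqVlt => /predU1P[->|ij]; [exact: h2|exact: h1].
  have Um : U [set k | (m <= k)%N] by apply: sU; exists m.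
  have [k [/= mk h]] := filter_ex (filterI Um (Uj m.+1)).
  by exists k; split=> // i im; apply: h; rewrite ltnS.
exists f, s; split=> // [m|w Ow]; first by have [] := Hs m.
have [r [A [r0 rO H]]] := locally_uniformly_bounded oO p1 E Ow.
have FA k y : rnorm (y - w) < r -> nc (F k y) <= A by exact: (H (F k) (AF k) (FE k) y).
have fA y : rnorm (y - w) < r -> nc (f y) <= A.
  by move=> yr; apply: (flim_le (fF _ (rO _ yr))) => k; exact: FA.
have Fh k : holo_ball (F k) w r by move=> y /rO Oy; have [hF _] := AF k; exact: hF.
have fh : holo_ball f w r by move=> y /rO Oy; exact: hf.
have A0 : 0 <= A by apply: le_trans (nc_ge0 _) (FA 0%N w _); rewrite subrr rnorm0.
pose L := 8 * A / r.
have L0 : 0 <= L by rewrite divr_ge0 ?mulr_ge0// ltW.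
have L1 : 0 < L + 1 by rewrite ltr_wpDl.
have r2 : 0 < r / 2 by rewrite divr_gt0.
apply/cvgrPdist_lt => e e0.
have d0 : 0 < Num.min (r / 2) (e / 4 / (L + 1)) by rewrite lt_min r2 !divr_gt0.
(* A rational point so close to [w] that [f] and every [F k] vary by at most [e / 4] between the
   two. *)
have [i +] := rational_point_dense w d0; set d := rational_point i.
rewrite lt_min => /andP[dr de].
have Lde : L * rnorm (d - w) <= e / 4.
  rewrite ltr_pdivlMr// in de; apply: le_trans (ltW de).
  by rewrite mulrC ler_wpM2l ?rnorm_ge0// lerDl.
have Od : Omega d by apply: rO; apply: lt_le_trans dr _; rewrite ler_pdivrMr// ler_peMr ?ler1n// ltW.
have e4 : 0 < e / 4 by rewrite divr_gt0.
have w0 : rnorm (w - w) < r / 2 by rewrite subrr rnorm0.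
near=> m.
have mi : (i <= m)%N by near: m; exact: nbhs_infty_ge.
have me : m.+1%:R^-1 < e / 4 by near: m; exact: (near_infty_natSinv_lt (PosNum e4)).
have [_ h1] := Hs m; have {}h1 := h1 i mi Od.
rewrite sub0r normrN ger0_norm ?nc_ge0//.
have h2 := holo_lipschitz r0 (Fh (s m)) (FA (s m)) w0 dr.
have h3 := holo_lipschitz r0 fh fA w0 dr.
have -> : F (s m) w - f w = (f d - f w) - (F (s m) d - F (s m) w) + (F (s m) d - f d) by ring.
apply: le_lt_trans (ncD _ _) _.
have := ncB (f d - f w) (F (s m) d - F (s m) w).
have := le_trans h2 Lde; have := le_trans h3 Lde; move: (lt_trans h1 me) e0; lra.
Unshelve. all: by end_near. Qed.

(** Along the extracted subsequence the limit keeps the value [1] at [z], and Fatou's lemma bounds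
    its energy by [J]. *)
Lemma minimizer_exists z : Omega z -> exists f, is_minimizer Omega p z f.
Proof.
move=> Oz; have [F HF] := minimizing_sequence p1 Ap_one z.
set J := min_energy Omega p z in HF.
have AF k : Ap Omega p (F k) by have [] := HF k.
have FJ k : energy (F k) <= J + k.+1%:R^-1 by have [] := HF k.
have FE k : energy (F k) <= J + 1.
  by apply: le_trans (FJ k) _; rewrite lerD2l invf_le1 ?ler1n.
have [f [s [hf ms fs]]] := limit_subsequence AF FE.
have fz : f z = 1.
  have F1 m : F (s m) z = 1 by have [] := HF (s m).
  have := fs z Oz; have -> : (fun m => nc (F (s m) z - f z)) = cst (nc (1 - f z)).
    by apply/funext => m; rewrite F1.
  move=> /(cvg_unique _ (cvg_cst _)) => /(_ (@norm_hausdorff _ _)) /eqP.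
  by rewrite nc_eq0 subr_eq0 => /eqP.
have JF k : J <= energy (F k).
  have := min_energy_le oO p1 Ap_one z (AF k); have [_ -> _] := HF k.
  by rewrite nc1 powR1 mul1r.
(* The energies lie between [J] and [J + (s m).+1%:R^-1], and [m <= s m]. *)
have EJ : (energy (F (s m)))%:E @[m --> \oo] --> J%:E.
  apply: cvg_EFin; first by near=> m.
  apply/cvgrPdist_le => e e0; near=> m => /=.
  rewrite distrC ger0_norm ?subr_ge0// lerBlDl; apply: le_trans (FJ _) _.
  rewrite lerD2l; apply: (@le_trans _ _ m.+1%:R^-1).
    by rewrite lef_pV2 ?posrE// ler_nat ltnS.
  by apply: ltW; near: m; exact: (near_infty_natSinv_lt (PosNum e0)).
have pw w : Omega w -> (nc (F (s m) w) `^ p)%:E @[m --> \oo] --> (nc (f w) `^ p)%:E.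
  move=> Ow; apply: cvg_EFin; first by near=> m.
  have [r [A [r0 rO H]]] := locally_uniformly_bounded oO p1 (J + 1) Ow.
  have w0 : rnorm (w - w) < r by rewrite subrr rnorm0.
  pose B := Num.max 1 (Num.max A (nc (f w))).
  have FB k : 0 <= nc (F k w) <= B.
    by rewrite nc_ge0/= !le_max (H (F k) (AF k) (FE k) w w0) orbT.
  have fB : 0 <= nc (f w) <= B by rewrite nc_ge0/= !le_max lexx !orbT.
  have B1 : 1 <= B by rewrite le_max lexx.
  have K0 : 0 < p * B `^ p + 1 by rewrite ltr_wpDl// mulr_ge0 ?powR_ge0// ltW.
  apply/cvgrPdist_lt => e e0.
  have /cvgrPdist_lt /(_ _ (divr_gt0 e0 K0)) := fs w Ow.
  apply: filterS => m /=; rewrite sub0r normrN ger0_norm ?nc_ge0// ltr_pdivlMr// => h.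
  apply: le_lt_trans (powR_lipschitz p1 B1 fB (FB (s m))) _.
  apply: le_lt_trans h; rewrite mulrC; apply: ler_pM => //.
  - by rewrite mulr_ge0 ?powR_ge0// ltW.
  - have h1 := ncD (F (s m) w - f w) (f w); rewrite subrK in h1.
    have h2 := ncD (f w - F (s m) w) (F (s m) w); rewrite subrK nc_distrC in h2.
    by rewrite ler_norml; apply/andP; split; lra.
  - by rewrite lerDl.
have IJ : (int_powp Omega p f <= J%:E)%E.
  have mD : measurable D by exact: measurable_preimage_open.
  have := @fatou _ _ R (lebesgueT R (n + n)) D mD
    (fun m t => (nc (F (s m) (tc t)) `^ p)%:E).
  rewrite (_ : (fun m => _) = (fun m => (energy (F (s m)))%:E)); last first.
    by apply/funext => m; rewrite -(energyE (AF (s m))).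
  rewrite (cvg_limn_einf_sup EJ).1 => fat.
  apply: le_trans (fat _ _).
  - rewrite le_eqVlt; apply/orP; left; apply/eqP; apply: eq_integral => t /set_mem Dt.
    by rewrite (cvg_limn_einf_sup (pw _ Dt)).1.
  - move=> m; have [hF _] := AF (s m).
    by apply/measurable_EFinP; apply: (measurable_powp p oO hF).
  - by move=> m t _; rewrite lee_fin powR_ge0.
have Af : Ap Omega p f by split=> //; apply: le_lt_trans IJ _; rewrite ltry.
exists f; split=> //; apply/eqP; rewrite eq_le (mp_le Af fz) andbT.
rewrite leNgt; apply/negP => mf.
have : J < energy f.
  rewrite -(normp_powR _ p1); apply: gt0_ltr_powR => //; rewrite nnegrE; [exact: mp_ge0|exact: normp_ge0].
by rewrite ltNge -lee_fin -energyE// IJ.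
Unshelve. all: by end_near. Qed.

End Minimizer.

(** * Elementary inequalities behind the expansions *)

Section RealInequalities.
Variable R : realType.
Implicit Types (a b g : R).

(** [(1 - a + 2a^2)(1 + a) = 1 + a^2 (1 + 2a)], which is at least [1] for [a >= - 1/2]. *)
Lemma le_inv_taylor (u v a : R) : 0 <= v -> - (1 / 2) <= a -> u * (1 + a) <= v ->
  u <= v * (1 - a + 2 * a ^+ 2).
Proof.
move=> v0 a12 uv; have a1 : 0 < 1 + a by move: a12; lra.
rewrite -(ler_pM2r a1); apply: le_trans uv _.
have -> : v * (1 - a + 2 * a ^+ 2) * (1 + a) = v + v * (a ^+ 2 * (1 + 2 * a)) by ring.
by rewrite lerDl mulr_ge0// mulr_ge0 ?sqr_ge0//; move: a12; lra.
Qed.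

(** [Jm] is the minimal energy at the midpoint and [H] the energy of the half sum. Inverting the
    first two bounds estimates the mean of [Jz] and [Jw] by [Jm * (1 - (a + b) / 2)] up to squares,
    so only [a + b] and [g] count to first order. *)
Lemma midpoint_gap_le (Jz Jw Jm H a b g S T G : R) : 0 <= Jm ->
  `|a| <= 1 / 4 -> `|b| <= 1 / 4 -> `|a| <= T -> `|b| <= T ->
  Jz * (1 + a) <= Jm -> Jw * (1 + b) <= Jm -> Jm * (1 + g) <= H ->
  - S <= a + b -> - G <= g ->
  (Jz + Jw) / 2 - H <= Jm * (S / 2 + 2 * T ^+ 2 + G).
Proof.
move=> J0 a4 b4 aT bT za wb mg Sab Gg.
have half (c : R) : `|c| <= 1 / 4 -> - (1 / 2) <= c by rewrite ler_norml => /andP[+ _]; lra.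
have Hz := le_inv_taylor J0 (half _ a4) za.
have Hw := le_inv_taylor J0 (half _ b4) wb.
have sqT (c : R) : `|c| <= T -> c ^+ 2 <= T ^+ 2.
  by move=> cT; rewrite -[X in X <= _]real_normK ?num_real// lerXn2r ?nnegrE// (le_trans _ cT).
have T1 := sqT _ aT; have T2 := sqT _ bT.
have K1 : 0 <= Jm * (S + (a + b)) by rewrite mulr_ge0//; lra.
have K2 : 0 <= Jm * (g + G) by rewrite mulr_ge0//; lra.
have K3 : 0 <= Jm * (T ^+ 2 - a ^+ 2) by rewrite mulr_ge0// subr_ge0.
have K4 : 0 <= Jm * (T ^+ 2 - b ^+ 2) by rewrite mulr_ge0// subr_ge0.
move: Hz Hw mg K1 K2 K3 K4.
move: (a ^+ 2) (b ^+ 2) (T ^+ 2) => a2 b2 t2; clear; lra.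
Qed.

(** One bound is the hypothesis itself. The other is the hypothesis with the points exchanged,
    inverted to second order: there [- b] stands in for [a], at the price [S]. *)
Lemma inverse_expansion_le (kz kw a b S T : R) : 0 <= kz ->
  `|b| <= 1 / 4 -> `|b| <= T -> kz * (1 + a) <= kw -> kw * (1 + b) <= kz ->
  `|a + b| <= S -> `|kw - kz - kz * a| <= kz * (S + 2 * T ^+ 2).
Proof.
move=> k0 b4 bT za wb; rewrite ler_norml => /andP[S1 S2].
have b2 : - (1 / 2) <= b by move: b4; rewrite ler_norml => /andP[+ _]; lra.
have H := le_inv_taylor k0 b2 wb.
have T2 : b ^+ 2 <= T ^+ 2.
  by rewrite -[X in X <= _]real_normK ?num_real// lerXn2r ?nnegrE// (le_trans _ bT).
rewrite ger0_norm; last by move: za; lra.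
have K1 : 0 <= kz * (S + (a + b)) by rewrite mulr_ge0//; lra.
have K3 : 0 <= kz * (T ^+ 2 - b ^+ 2) by rewrite mulr_ge0// subr_ge0.
by move: H K1 K3; move: (b ^+ 2) (T ^+ 2) => c t; clear; lra.
Qed.

(** If [t >= d], taking [e = t] gives [c t^2 <= C (65 + L) d t], and one factor [t] divides out. The
    expression [64 * e + L * d] is the bound of [minimizer_difference]; requiring [d <= e] keeps [e]
    positive when [t] vanishes. *)
Lemma quadratic_absorption (c C L d t G : R) : 0 < c -> 0 <= C -> 0 <= L -> 0 <= d ->
  0 <= t -> c * t ^+ 2 = G ->
  (forall e, d <= e -> t <= e -> G <= C * (d ^+ 2 + d * (64 * e + L * d))) ->
  t <= (C * (65 + L) / c + 1) * d.
Proof.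
move=> c0 C0 L0 d0 t0 tG H.
have q0 : 0 <= C * (65 + L) / c by rewrite divr_ge0 ?(ltW c0)// mulr_ge0// addr_ge0.
have [td|/ltW dt] := leP t d.
  by apply: le_trans td _; rewrite ler_peMl// lerDr.
have [t00|tn0] := eqVneq t 0; first by rewrite t00 mulr_ge0// addr_ge0.
have tgt : 0 < t by rewrite lt_def tn0.
apply: (@le_trans _ _ (C * (65 + L) / c * d)); last by rewrite ler_wpM2r// lerDl.
rewrite mulrAC ler_pdivlMr// -(ler_pM2r tgt).
have -> : t * c * t = G by rewrite -tG; ring.
apply: le_trans (H t dt (lexx t)) _.
have -> : C * (65 + L) * d * t = C * (d * t + d * (64 * t + L * t)) by ring.
rewrite ler_wpM2l// expr2 lerD// ?ler_wpM2l// lerD2l ler_wpM2l//.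
Qed.

End RealInequalities.

(** * Dependence of the minimizers on the base point *)

Section LocalLipschitz.
Variables (R : realType) (n : nat) (Omega : set 'rV[CC R]_n) (p : R).
Hypotheses (oO : open Omega) (p1 : 1 <= p) (Ap_one : Ap Omega p (cst 1)).
Notation C := (CC R).
Notation nc := (@Normc.normc R).
Notation V := 'rV[C]_n.
Notation energy f := (fine (int_powp Omega p f)).
Notation J := (min_energy Omega p).
Variable m : V -> V -> C.
Hypothesis m_min : forall z, Omega z -> is_minimizer Omega p z (m z).
Variables (z0 : V) (rho A E : R).
Hypotheses (rho0 : 0 < rho) (rho1 : rho <= 1) (A1 : 1 <= A).
Hypothesis rhoO : forall w, rnorm (w - z0) < rho -> Omega w.
Hypothesis mA : forall z w, Omega z -> rnorm (w - z0) < rho -> nc (m z w) <= A.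
Hypothesis JE : forall z, Omega z -> J z <= E.
Implicit Types (x y z w a : V).

(** [L] is the common Lipschitz constant of the minimizers near [z0], and [s] is fixed by
    [p * L * s = 1 / 8]: for two points within [s] of [z0] this makes [p |m z w - 1|] at most
    [1 / 4]. Later, base points stay within [s / 512], inside half the ball of radius [s / 64] where
    differences of minimizers are estimated. *)
Let L := 8 * A / rho.
Let s := rho / (64 * p * A).
Let p0 : 0 < p. Proof. exact: lt_le_trans p1. Qed.
Let A0 : 0 < A. Proof. exact: lt_le_trans A1. Qed.
Let s0 : 0 < s. Proof. by rewrite divr_gt0// !mulr_gt0. Qed.
Let L0 : 0 < L. Proof. by rewrite divr_gt0// mulr_gt0. Qed.
Let sE : 64 * p * A * s = rho.
Proof. by rewrite /s mulrC divfK// gt_eqF// !mulr_gt0. Qed.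
Let s_rho : 64 * s <= rho.
Proof.
have pA : 1 <= p * A by rewrite -[1]mulr1 ler_pM.
have E1 : rho = (p * A) * (64 * s) by rewrite -{1}sE; ring.
by rewrite E1 ler_peMl// mulr_ge0// ltW.
Qed.
Let s_lt_rho : s < rho. Proof. by move: s0 s_rho; lra. Qed.
Let s64r : s / 64 < rho. Proof. by move: s0 s_rho; lra. Qed.
Let s128 : s / 512 < s / 64 / 2. Proof. by move: s0; lra. Qed.
Let s_16 : s < rho / 16. Proof. by move: s0 s_rho; lra. Qed.
Let s_512_16 : (s / 512) *+ 2 <= rho / 16.
Proof. by rewrite mulr2n; move: s0 s_rho; lra. Qed.
Let le_s : s / 512 <= s. Proof. by move: s0; lra. Qed.
Let Re_pos (u : R) : `|p * (u - 1)| <= 1 / 4 -> 0 <= u.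
Proof.
rewrite normrM (gtr0_norm p0) => hu.
have : `|u - 1| <= 1 / 4 by apply: le_trans hu; rewrite ler_peMl.
by rewrite ler_norml => /andP[+ _]; lra.
Qed.
Let pLs : p * (L * s) = 1 / 8.
Proof. by rewrite /L /s; field; rewrite !gt_eqF. Qed.

Let m_holo z : Omega z -> holo_ball (m z) z0 rho.
Proof. by move=> /m_min[[hz _] _ _] w /rhoO; exact: hz. Qed.

Let m_lip z x y : Omega z -> rnorm (x - z0) < rho / 2 -> rnorm (y - z0) < rho / 2 ->
  nc (m z y - m z x) <= L * rnorm (y - x).
Proof. by move=> Oz; apply: (holo_lipschitz rho0 (m_holo Oz)) => w; exact: mA. Qed.

Let dist_lt r x y : rnorm (x - z0) < r -> rnorm (y - z0) < r -> rnorm (x - y) < r *+ 2.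
Proof.
move=> xr yr; have -> : x - y = (x - z0) - (y - z0) by rewrite opprB addrA subrK.
by apply: le_lt_trans (rnormD _ _) _; rewrite rnormN mulr2n ltrD.
Qed.

Lemma minimizer_near_one z w : rnorm (z - z0) < s -> rnorm (w - z0) < s ->
  nc (m z w - 1) <= L * rnorm (w - z) /\ p * nc (m z w - 1) <= 1 / 4.
Proof.
move=> zs ws.
have sr : s < rho / 2 by move: s0 s_rho; lra.
have Oz : Omega z by apply: rhoO; move: zs sr rho0; lra.
have [_ mz _] := m_min Oz.
have H : nc (m z w - 1) <= L * rnorm (w - z).
  by rewrite -mz; apply: m_lip => //; [exact: lt_trans sr|exact: lt_trans sr].
split=> //; apply: le_trans (ler_wpM2l (ltW p0) H) _.
apply: (@le_trans _ _ (p * (L * (s *+ 2)))).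
  by rewrite ler_wpM2l ?(ltW p0)// ler_wpM2l ?(ltW L0)// ltW// dist_lt.
have -> : p * (L * (s *+ 2)) = (p * (L * s)) * 2 by ring.
by rewrite pLs; lra.
Qed.

Lemma minimizer_bounds z w : rnorm (z - z0) < s -> rnorm (w - z0) < s ->
  1 / 2 <= nc (m z w) <= 2.
Proof.
move=> zs ws; have [_ H] := minimizer_near_one zs ws.
have H4 : nc (m z w - 1) <= 1 / 4.
  by apply: le_trans H; rewrite ler_peMl ?nc_ge0.
have h1 := ncD (m z w - 1) 1; have h2 := ncD (1 - m z w) (m z w).
rewrite subrK nc1 in h1; rewrite subrK nc1 nc_distrC in h2.
by apply/andP; split; move: h1 h2 H4; lra.
Qed.

Definition energy_gap z w : R :=
  (J z + J w) / 2 - energy (fun x => (m z x + m w x) / 2).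

Let s_le1 : s / 2 <= 1. Proof. by move: s_rho rho1 s0; lra. Qed.

Lemma quotient_holo z w : rnorm (z - z0) < s -> rnorm (w - z0) < s ->
  holo_ball (fun x => m z x / m w x) z0 s.
Proof.
move=> zs ws x xs.
have sr := s_lt_rho.
have Oz : Omega z by apply: rhoO; exact: lt_trans sr.
have Ow : Omega w by apply: rhoO; exact: lt_trans sr.
apply: (@differentiableM _ _ (m z : V -> C^o) (fun x => (m w x)^-1 : C^o)).
  by apply: m_holo => //; exact: lt_trans sr.
apply: (@differentiableV _ _ (m w : V -> C^o)).
  by apply: m_holo => //; exact: lt_trans sr.
have /andP[h _] := minimizer_bounds ws xs.
by rewrite -nc_gt0 (lt_le_trans _ h)// divr_gt0.
Qed.

Lemma Im_quotient_gap : exists2 c : R, 0 < c & forall z w a,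
  rnorm (z - z0) < s -> rnorm (w - z0) < s -> rnorm (a - z0) < s / 2 ->
  c * complex.Im (m z a / m w a) ^+ 2 <= energy_gap z w.
Proof.
have s20 : 0 < s / 2 by rewrite divr_gt0.
have s01 : 0 < s / 2 <= 1 by rewrite s20 s_le1.
have two1 : 1 <= 2%:R :> R by rewrite ler1n.
(* Exponent [2], because the pointwise gain is quadratic in the imaginary part. *)
have [k k0 Hk] := concentration_power n s01 two1.
pose c0 : R := (1 / 2) `^ p / 2048.
have c00 : 0 < c0 by apply: divr_gt0; [apply: powR_gt0; exact: divr_gt0|rewrite ltr0n].
exists (c0 * k); first by rewrite mulr_gt0.
move=> z w a zs ws as2; pose q x := m z x / m w x.
have qh := quotient_holo zs ws.
have inB y : rnorm (y - a) < s / 2 -> rnorm (y - z0) < s.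
  move=> ya; have -> : y - z0 = (y - a) + (a - z0) by rewrite addrA subrK.
  by apply: le_lt_trans (rnormD _ _) _; rewrite [s]splitr ltrD.
have qha : holo_ball q a (s / 2) by move=> y /inB; exact: qh.
have qB y : rnorm (y - a) < s / 2 -> 0 <= `|complex.Im (q y)| <= 4.
  move=> /inB ys; rewrite normr_ge0 /=; apply: le_trans (nc_Im _) _.
  have /andP[_ h1] := minimizer_bounds zs ys; have /andP[h2 _] := minimizer_bounds ws ys.
  have h3 : 0 < nc (m w y) by rewrite (lt_le_trans _ h2)// divr_gt0.
  by rewrite ncM ncV ler_pdivrMr//; move: h1 h2; lra.
have [x [r [r0 vx0 xr H]]] := Hk _ _ _ qB (slowly_varying_Im qha).
have sr := s_lt_rho.
have Oz : Omega z by apply: rhoO; exact: lt_trans sr.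
have Ow : Omega w by apply: rhoO; exact: lt_trans sr.
have [Az _ _] := m_min Oz; have [Aw _ _] := m_min Ow.
pose c := c0 * (`|complex.Im (q x)| / 2) ^+ 2.
have c_ge0 : 0 <= c by rewrite mulr_ge0 ?(ltW c00)// sqr_ge0.
have G : energy (fun y => (m z y + m w y) / 2) + c * (r / 2) ^+ (n + n) <=
    (J z + J w) / 2.
  rewrite -(is_minimizer_energy p1 (m_min Oz)) -(is_minimizer_energy p1 (m_min Ow)).
  apply: (energy_half_gain oO p1 (x := x)) => // y /xr[/inB ys vy].
  split; first by apply: rhoO; exact: lt_trans sr.
  apply: le_trans (nc_midpoint_gap p1 (minimizer_bounds zs ys) (minimizer_bounds ws ys)).
  rewrite lerD2l -/c0 ler_wpM2l ?(ltW c00)// -[X in _ <= X]real_normK ?num_real//.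
  by rewrite lerXn2r ?nnegrE ?divr_ge0.
apply: (@le_trans _ _ (c * (r / 2) ^+ (n + n))); last by rewrite /energy_gap; move: G; lra.
rewrite /c -(mulrA c0) -(mulrA c0) ler_wpM2l ?(ltW c00)//.
have := H; rewrite !powR_mulrn ?normr_ge0 ?divr_ge0//.
by rewrite real_normK ?num_real.
Qed.

(* A quotient whose imaginary part is small is nearly constant, and at [z] it is near [1]. *)
Lemma minimizer_difference z w (eta : R) : 0 < eta ->
  rnorm (z - z0) < s / 64 -> rnorm (w - z0) < s / 64 ->
  (forall a, rnorm (a - z0) < s / 2 -> `|complex.Im (m z a / m w a)| <= eta) ->
  forall x, rnorm (x - z0) < s / 64 ->
  nc (m z x - m w x) <= 64 * eta + 4 * L * rnorm (z - w).
Proof.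
move=> e0 zs ws Im_le x xs.
have lt_s y : rnorm (y - z0) < s / 64 -> rnorm (y - z0) < s by move: s0; lra.
have sr := s_lt_rho.
have Oz : Omega z by apply: rhoO; exact: lt_trans (lt_s _ zs) sr.
have [_ mz _] := m_min Oz.
have qh := quotient_holo (lt_s _ zs) (lt_s _ ws).
have qh2 : holo_ball (fun x => m z x / m w x) z0 (s / 2).
  by move=> y ys; apply: qh; move: ys s0; lra.
have s20 : 0 < s / 2 by rewrite divr_gt0.
have s64 : s / 2 / 32 = s / 64 by field.
have := holo_im_lipschitz s20 e0 qh2 Im_le (x := z) (y := x); rewrite s64 => /(_ zs xs).
set q := m z x / m w x; set qz := m z z / m w z => H1.
have /andP[b1 b2] := minimizer_bounds (lt_s _ ws) (lt_s _ xs).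
have /andP[b3 b4] := minimizer_bounds (lt_s _ ws) (lt_s _ zs).
have wx0 : m w x != 0 by rewrite -nc_gt0 (lt_le_trans _ b1)// divr_gt0.
have wz0 : m w z != 0 by rewrite -nc_gt0 (lt_le_trans _ b3)// divr_gt0.
have H2 : nc (q - qz) <= 32 * eta.
  apply: le_trans H1 _; apply: (@le_trans _ _ (512 * eta / (s / 2) * (s / 64 *+ 2))).
    apply: ler_wpM2l; last by rewrite ltW// dist_lt.
    by apply: divr_ge0; [apply: mulr_ge0; [exact: ler0n|exact: ltW]|exact: ltW].
  by rewrite le_eqVlt; apply/orP; left; apply/eqP; field; rewrite gt_eqF.
have H3 : nc (qz - 1) <= 2 * (L * rnorm (z - w)).
  have [H _] := minimizer_near_one (lt_s _ ws) (lt_s _ zs).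
  have -> : qz - 1 = (1 - m w z) / m w z by rewrite /qz mz mulrBl divff.
  rewrite ncM ncV nc_distrC ler_pdivrMr ?nc_gt0//; apply: le_trans H _.
  have : 0 <= L * rnorm (z - w) by rewrite mulr_ge0 ?rnorm_ge0// ltW.
  by move: (L * _) b3 => t; move: (nc (m w z)) => u; nra.
have -> : m z x - m w x = m w x * ((q - qz) + (qz - 1)).
  by rewrite addrA subrK mulrBr mulr1 /q mulrC divfK.
rewrite ncM; apply: (@le_trans _ _ (2 * (32 * eta + 2 * (L * rnorm (z - w))))).
  by apply: ler_pM; rewrite ?nc_ge0//; apply: le_trans (ncD _ _) _; exact: lerD.
by rewrite le_eqVlt; apply/orP; left; apply/eqP; ring.
Qed.

(** [m y] competes at [x] after scaling, and [|m y x|^p] is at least the p-th power of its real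
    part, which Bernoulli linearizes. The factor [p] and the real part in the final formulas
    originate here. *)
Lemma min_energy_bernoulli y x : rnorm (y - z0) < s -> rnorm (x - z0) < s ->
  J x * (1 + p * (complex.Re (m y x) - 1)) <= J y.
Proof.
move=> ys xs; have sr := s_lt_rho.
have Oy : Omega y by apply: rhoO; exact: lt_trans sr.
have [Ay _ _] := m_min Oy.
rewrite -[J y](is_minimizer_energy p1 (m_min Oy)).
apply: le_trans (min_energy_le oO p1 Ap_one x Ay); rewrite mulrC.
rewrite ler_wpM2r ?min_energy_ge0//.
have [_ H] := minimizer_near_one ys xs.
have H4 : nc (m y x - 1) <= 1 / 4 by apply: le_trans H; rewrite ler_peMl ?nc_ge0.
have Re0 : 0 <= complex.Re (m y x).
  have Re1 : complex.Re (1 : C) = 1 by [].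
  have := nc_Re (m y x - 1); rewrite ReB Re1 => /le_trans/(_ H4).
  by rewrite ler_norml => /andP[+ _]; lra.
apply: le_trans (powR_bernoulli p1 Re0) _; apply: powR_mono => //; first exact: nc_ge0.
exact: le_trans (ler_norm _) (nc_Re _).
Qed.

Lemma Re_minimizer_le y x : rnorm (y - z0) < s -> rnorm (x - z0) < s ->
  `|p * (complex.Re (m y x) - 1)| <= 1 / 4 /\
  `|p * (complex.Re (m y x) - 1)| <= p * L * rnorm (x - y).
Proof.
move=> ys xs; have [H1 H2] := minimizer_near_one ys xs.
have Re_le : `|complex.Re (m y x) - 1| <= nc (m y x - 1).
  by have := nc_Re (m y x - 1); rewrite ReB.
rewrite normrM (gtr0_norm p0); split.
  by apply: le_trans H2; rewrite ler_wpM2l// ltW.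
by rewrite -mulrA ler_wpM2l ?(ltW p0)//; exact: le_trans H1.
Qed.

Lemma minimizer_second_difference y x u : rnorm (y - z0) < s ->
  rnorm (x - z0) < s -> rnorm (x + u - z0) < s -> rnorm u < s ->
  nc ((m y (x + u + u) - m y (x + u)) - (m y (x + u) - m y x))
    <= 256 * A / rho ^+ 2 * rnorm u ^+ 2.
Proof.
move=> ys xs xus us.
have s8 : s < rho / 8 by move: s0 s_rho; lra.
have s4 : s < rho / 4 by move: s0 s_rho; lra.
have sr := s_lt_rho.
have Oy : Omega y by apply: rhoO; exact: lt_trans sr.
have := holo_second_difference rho0 (m_holo Oy) (fun w => @mA y w Oy)
  (lt_trans xs s8) (lt_trans xus s8) (lt_trans us s4).
have -> : x + u - x = u by rewrite addrAC subrr add0r.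
by rewrite -mulrA -expr2.
Qed.

(* With [y] the midpoint of [z] and [w], the half sum competes with the minimizer at [y]; the
   first order terms of [J z], [J w] and of its value at [y] cancel up to [d ^ 2 + d * X]. *)
Lemma energy_gap_le : exists2 K : R, 0 <= K & forall z w (X : R),
  rnorm (z - z0) < s / 512 -> rnorm (w - z0) < s / 512 -> 0 <= X ->
  (forall x, rnorm (x - z0) < s / 64 -> nc (m z x - m w x) <= X) ->
  energy_gap z w <= K * (rnorm (z - w) ^+ 2 + rnorm (z - w) * X).
Proof.
pose C2 := 64 * A / rho ^+ 2.
have C20 : 0 <= C2 by apply: divr_ge0; [apply: mulr_ge0; [exact: ler0n|exact: ltW]|exact/exprn_ge0/ltW].
have Oz0 : Omega z0 by apply: rhoO; rewrite subrr rnorm0.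
have E0 : 0 <= E by apply: le_trans (JE Oz0); exact: min_energy_ge0.
exists (E * (p * C2 + p ^+ 2 * L ^+ 2 + 128 * p / s)).
  apply: mulr_ge0 => //; apply: addr_ge0; first apply: addr_ge0.
  - by apply: mulr_ge0 => //; exact: ltW.
  - by apply: mulr_ge0; exact: sqr_ge0.
  - by apply: divr_ge0; [apply: mulr_ge0; [exact: ler0n|exact: ltW]|exact: ltW].
move=> z w X zs ws X0 zwX; set d := rnorm (z - w).
have d0 : 0 <= d by exact: rnorm_ge0.
have s512 : 0 < s / 512 by apply: divr_gt0; [exact: s0|rewrite ltr0n].
have sr := s_lt_rho.
(* Half the difference, so that [w], [y = w + h] and [z = y + h] are equally spaced. *)
pose h : V := (2^-1)%:C%C *: (z - w).
have Nh : rnorm h = d / 2 by rewrite rnormZ nc_real gtr0_norm ?invr_gt0// mulrC.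
pose y := w + h.
have half2 : (2^-1)%:C%C + (2^-1)%:C%C = 1 :> C.
  by rewrite -rmorphD /= -[X in X + X]div1r -splitr.
have hh : h + h = z - w by rewrite /h -scalerDl half2 scale1r.
have zy : z = y + h by rewrite /y -addrA hh subrKC.
have hs : rnorm h < s / 512.
  rewrite Nh ltr_pdivrMr// mulr_natr; exact: dist_lt.
have ys : rnorm (y - z0) < s / 512.
  have -> : y - z0 = (2^-1)%:C%C *: (z - z0) + (2^-1)%:C%C *: (w - z0).
    rewrite -scalerDr addrACA -opprD scalerBr scalerDr /y /h scalerBr.
    have -> : (2^-1)%:C%C *: (z0 + z0) = z0 by rewrite scalerDr -scalerDl half2 scale1r.
    congr (_ - _); rewrite -{1}[w]scale1r -half2 scalerDl.
    by rewrite addrACA subrr addr0 addrC.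
  apply: le_lt_trans (rnormD _ _) _; rewrite !rnormZ nc_real gtr0_norm ?invr_gt0//.
  by move: zs ws; lra.
have lt_s x : rnorm (x - z0) < s / 512 -> rnorm (x - z0) < s.
  by move=> xs; exact: lt_le_trans xs le_s.
have zs' := lt_s _ zs; have ws' := lt_s _ ws; have ys' := lt_s _ ys.
have hs' : rnorm h < s by exact: lt_le_trans hs le_s.
have Oy : Omega y by apply: rhoO; exact: lt_trans sr.
have Oz : Omega z by apply: rhoO; exact: lt_trans sr.
have Ow : Omega w by apply: rhoO; exact: lt_trans sr.
have SD x : rnorm (x - z0) < s ->
    nc ((m x z - m x y) - (m x y - m x w)) <= C2 * d ^+ 2.
  move=> xs; have := @minimizer_second_difference x w h xs ws' ys' hs'.
  rewrite -/y -zy Nh => /le_trans; apply.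
  by rewrite /C2 le_eqVlt; apply/orP; left; apply/eqP; field; rewrite gt_eqF.
have [_ mz _] := m_min Oz; have [_ mw _] := m_min Ow; have [_ my _] := m_min Oy.
pose a := p * (complex.Re (m y z) - 1); pose b := p * (complex.Re (m y w) - 1).
have [a4 aT] := Re_minimizer_le ys' zs'; have [b4 bT] := Re_minimizer_le ys' ws'.
rewrite -/a in a4 aT; rewrite -/b in b4 bT.
have Nzy : rnorm (z - y) = d / 2 by rewrite zy addrAC subrr add0r.
have Nwy : rnorm (w - y) = d / 2 by rewrite rnorm_distrC /y addrAC subrr add0r.
rewrite Nzy in aT; rewrite Nwy in bT.
pose half x := (m z x + m w x) / 2.
pose g := p * (complex.Re (half y) - 1).
pose G := p * (1 / 2) * (8 * X / (s / 64) * (d / 2) + C2 * d ^+ 2).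
have Re1 : complex.Re (1 : C) = 1 by [].
(* As [m y y = 1], the sum is [p] times the real part of a second difference of [m y], hence
   quadratic in [d]. *)
have ab : - (p * (C2 * d ^+ 2)) <= a + b.
  have H := le_trans (nc_Re _) (SD y ys'); rewrite my !ReB Re1 in H.
  have -> : a + b = p * (complex.Re (m y z) - 1 - (1 - complex.Re (m y w))).
    by rewrite /a /b; ring.
  rewrite -mulrN ler_wpM2l ?(ltW p0)//; move: H; rewrite ler_norml => /andP[]//.
have [Az _ _] := m_min Oz; have [Aw _ _] := m_min Ow.
have Ahalf : Ap Omega p half by exact: Ap_half.
have s640 : 0 < s / 64 by rewrite divr_gt0.
have half1 : `|complex.Re (half y) - 1| <= (1 / 2) * (8 * X / (s / 64) * (d / 2) + C2 * d ^+ 2).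
  have dh : holo_ball (fun x => m z x - m w x) z0 (s / 64).
    move=> x xs; apply: (@differentiableB _ _ _ (m z : V -> C^o) (m w : V -> C^o)).
      by apply: m_holo => //; exact: lt_trans s64r.
    by apply: m_holo => //; exact: lt_trans s64r.
  have H1 := holo_lipschitz s640 dh zwX (lt_trans zs s128) (lt_trans ys s128).
  rewrite rnorm_distrC Nzy in H1.
  have H2 := SD w ws'.
  (* Using [m z z = m w w = 1], the numerator splits into an increment of [m z - m w], of size
     [d * X], and a second difference of [m w], of size [d ^+ 2]. *)
  have E1 : half y - 1 = ((m z y - m w y - (m z z - m w z)) -
      (m w z - m w y - (m w y - m w w))) / 2.
    by rewrite /half mz mw; field.
  rewrite -[1]Re1 -ReB E1; apply: le_trans (nc_Re _) _.
  rewrite nc_half mulrC -[1 / 2]/(1 * 2^-1) mul1r ler_wpM2l ?invr_ge0//.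
  by apply: le_trans (ncB _ _) _; exact: lerD.
have gG : - G <= g.
  rewrite /G /g -mulrA -mulrN ler_wpM2l ?(ltW p0)//.
  by move: half1; rewrite ler_norml => /andP[].
have mg : J y * (1 + g) <= energy half.
  apply: le_trans (min_energy_le oO p1 Ap_one y Ahalf); rewrite mulrC.
  rewrite ler_wpM2r ?min_energy_ge0//.
  have /andP[bz _] := minimizer_bounds zs' ys'.
  have Re0 : 0 <= complex.Re (half y).
    have [z4 _] := Re_minimizer_le zs' ys'; have [w4 _] := Re_minimizer_le ws' ys'.
    have -> : complex.Re (half y) = (complex.Re (m z y) + complex.Re (m w y)) / 2.
      rewrite /half -ReD; move: (_ + _) => c.
      have -> : c / 2 = c * (2^-1)%:C%C by rewrite fmorphV rmorph_nat.
      by case: c => u v /=; rewrite mulr0 subr0.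
    by rewrite divr_ge0// addr_ge0// Re_pos.
  apply: le_trans (powR_bernoulli p1 Re0) _; apply: powR_mono => //; first exact: nc_ge0.
  exact: le_trans (ler_norm _) (nc_Re _).
have := midpoint_gap_le (min_energy_ge0 Omega p y) a4 b4 aT bT
  (min_energy_bernoulli ys' zs') (min_energy_bernoulli ys' ws') mg ab gG.
rewrite -/(energy_gap z w) => /le_trans; apply.
set Q := _ + G.
have QE : Q = (p * C2 + p ^+ 2 * L ^+ 2 / 2) * d ^+ 2 + 128 * p / s * (d * X).
  by rewrite /Q /G; field; rewrite gt_eqF.
have W0 : 0 <= d ^+ 2 + d * X by rewrite addr_ge0 ?sqr_ge0// mulr_ge0.
have P1 : 0 <= p * C2 by apply: mulr_ge0 => //; exact: ltW.
have P2 : 0 <= p ^+ 2 * L ^+ 2 by apply: mulr_ge0; exact: sqr_ge0.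
have P3 : 0 <= 128 * p / s.
  by apply: divr_ge0; [apply: mulr_ge0; [exact: ler0n|exact: ltW]|exact: ltW].
have D2 := sqr_ge0 d; have D3 : 0 <= d * X by exact: mulr_ge0.
have P12 : 0 <= p * C2 + p ^+ 2 * L ^+ 2 / 2 by apply: addr_ge0 => //; exact: divr_ge0.
have Q0 : 0 <= Q by rewrite QE; apply: addr_ge0; exact: mulr_ge0.
apply: (@le_trans _ _ (E * Q)); first by rewrite ler_wpM2r// JE.
rewrite -mulrA ler_wpM2l// QE.
rewrite [X in _ <= X]mulrDr; apply: lerD; rewrite ler_wpM2r//.
  rewrite -addrA lerD2l; apply: (@le_trans _ _ (p ^+ 2 * L ^+ 2)); last by rewrite lerDl.
  by rewrite ler_pdivrMr// ler_peMr// ler1n.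
by rewrite lerDr addr_ge0.
Qed.

(* With [X] the sup of [m z - m w] and [t ^ 2] the energy gap up to a constant, the previous
   lemmas give [X <= C (t + d)] and [t ^ 2 <= C (d ^ 2 + d * X)], hence [X <= C d]. *)
Lemma minimizer_lipschitz : exists2 K : R, 0 <= K & forall z w x,
  rnorm (z - z0) < s / 512 -> rnorm (w - z0) < s / 512 -> rnorm (x - z0) < s / 64 ->
  nc (m z x - m w x) <= K * rnorm (z - w).
Proof.
have [c c0 Hc] := Im_quotient_gap; have [K K0 HK] := energy_gap_le.
have L40 : 0 <= 4 * L by rewrite mulr_ge0// ltW.
(* The constant of [quadratic_absorption], with [4 * L] for its [L]. *)
pose M := K * (65 + 4 * L) / c + 1.
have M1 : 1 <= M by rewrite lerDr divr_ge0 ?(ltW c0)// mulr_ge0// addr_ge0.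
have M0 : 0 < M by exact: lt_le_trans M1.
exists (64 * M + 4 * L); first by rewrite addr_ge0// mulr_ge0// ltW.
move=> z w x zs ws xs; set d := rnorm (z - w).
have d0 : 0 <= d by exact: rnorm_ge0.
have [dE|dn0] := eqVneq d 0.
  by have /subr0_eq -> := rnorm_eq0 dE; rewrite subrr nc0 dE mulr0.
have dgt : 0 < d by rewrite lt_def dn0.
have lt_s y : rnorm (y - z0) < s / 512 -> rnorm (y - z0) < s by move=> h; exact: lt_le_trans le_s.
have lt_64 y : rnorm (y - z0) < s / 512 -> rnorm (y - z0) < s / 64.
  by move=> h; apply: lt_trans h (lt_le_trans s128 _); rewrite ler_pdivrMr// ler_peMr ?ler1n// divr_ge0// ltW.
set G := energy_gap z w.
have gap a : rnorm (a - z0) < s / 2 -> c * complex.Im (m z a / m w a) ^+ 2 <= G.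
  by apply: Hc; exact: lt_s.
have G0 : 0 <= G.
  have := gap z0; rewrite subrr rnorm0 divr_gt0// => /(_ isT); apply: le_trans.
  by rewrite mulr_ge0 ?sqr_ge0// ltW.
pose t := Num.sqrt (G / c).
have tE : c * t ^+ 2 = G by rewrite sqr_sqrtr ?divr_ge0 ?(ltW c0)// mulrC divfK// gt_eqF.
have Im_le e : 0 <= e -> t <= e -> forall a, rnorm (a - z0) < s / 2 ->
    `|complex.Im (m z a / m w a)| <= e.
  move=> e0 te a /gap; rewrite -tE ler_pM2l// => h; apply: le_trans te.
  rewrite -(@ler_pXn2r _ 2) ?nnegrE ?sqrtr_ge0//.
  by rewrite real_normK ?num_real.
have tM : t <= M * d.
  apply: (quadratic_absorption c0 K0 L40 d0 (sqrtr_ge0 _) tE) => e de te.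
  have e0 : 0 < e by exact: lt_le_trans de.
  apply: (HK z w _ zs ws).
    apply: addr_ge0; last exact: mulr_ge0.
    by apply: mulr_ge0; [exact: ler0n|exact: ltW].
  move=> x' x's.
  exact: (minimizer_difference e0 (lt_64 _ zs) (lt_64 _ ws) (Im_le e (ltW e0) te) x's).
have Md0 : 0 < M * d by exact: mulr_gt0.
have := minimizer_difference Md0 (lt_64 _ zs) (lt_64 _ ws) (Im_le _ (ltW Md0) tM) xs.
move=> /le_trans; apply; rewrite -/d.
by rewrite le_eqVlt; apply/orP; left; apply/eqP; clearbody M; ring.
Qed.

Let quarter (u : R) : - (1 / 4) <= u -> 3 / 4 <= 1 + u.
Proof. by lra. Qed.

Lemma inv_min_energy_expansion : exists2 K : R, 0 <= K & forall z w,
  rnorm (z - z0) < s / 512 -> rnorm (w - z0) < s / 512 ->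
  `|(J w)^-1 - (J z)^-1 - p * (J z)^-1 * complex.Re ('d (m z : V -> C^o) z (w - z))|
    <= K * rnorm (w - z) ^+ 2.
Proof.
have [K1 K10 H1] := minimizer_lipschitz.
have Oz0 : Omega z0 by apply: rhoO; rewrite subrr rnorm0.
have J0 : 0 < J z0 by exact: min_energy_gt0.
(* A common bound for [(J z)^-1] near [z0]: comparing with the value at [z0] gives
   [J z >= 3/4 * J z0]. *)
pose k1 := (J z0 * (3 / 4))^-1.
have k10 : 0 < k1 by rewrite invr_gt0; apply: mulr_gt0 => //; apply: divr_gt0; rewrite ltr0n.
pose C3 := 128 * A / rho ^+ 2.
have C30 : 0 <= C3 by apply: divr_ge0; [apply: mulr_ge0; [exact: ler0n|exact: ltW]|exact/exprn_ge0/ltW].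
(* The three terms come from the symmetric error [a + b], from the inversion to second order, and
   from the Taylor remainder of [m z]. *)
pose C4 := p * (512 * K1 / s) + 2 * (p * L) ^+ 2 + p * C3.
have C40 : 0 <= C4.
  apply: addr_ge0; first apply: addr_ge0; apply: mulr_ge0.
  - exact: (ltW p0).
  - by apply: divr_ge0; [apply: mulr_ge0; [exact: ler0n|exact: K10]|exact: (ltW s0)].
  - exact: ler0n.
  - exact: sqr_ge0.
  - exact: (ltW p0).
  - exact: C30.
exists (k1 * C4); first by rewrite mulr_ge0// ltW.
move=> z w zs ws; set d := rnorm (w - z).
have d0 : 0 <= d by exact: rnorm_ge0.
have lt_s y : rnorm (y - z0) < s / 512 -> rnorm (y - z0) < s by move=> h; exact: lt_le_trans le_s.
have zs' := lt_s _ zs; have ws' := lt_s _ ws.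
have Oz : Omega z by apply: rhoO; exact: lt_trans s_lt_rho.
have Ow : Omega w by apply: rhoO; exact: lt_trans s_lt_rho.
have Jz : 0 < J z by exact: min_energy_gt0.
have Jw : 0 < J w by exact: min_energy_gt0.
have z0s : rnorm (z0 - z0) < s by rewrite subrr rnorm0.
have kz1 : (J z)^-1 <= k1.
  have j34 : 0 < J z0 * (3 / 4) by apply: mulr_gt0 => //; apply: divr_gt0; rewrite ltr0n.
  rewrite /k1 lef_pV2 ?posrE; [|exact: Jz|exact: j34].
  apply: le_trans (min_energy_bernoulli zs' z0s).
  have [] := Re_minimizer_le zs' z0s; rewrite ler_norml => /andP[h _] _.
  by apply: (ler_wpM2l (ltW J0)); exact: quarter h.
pose a := p * (complex.Re (m z w) - 1); pose b := p * (complex.Re (m w z) - 1).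
have [b4 bT] := Re_minimizer_le ws' zs'; rewrite rnorm_distrC -/d -/b in b4 bT.
have inv_step (u v c : R) : 0 < u -> 0 < v -> u * (1 + c) <= v -> v^-1 * (1 + c) <= u^-1.
  move=> u0 v0 h; rewrite mulrC ler_pdivrMr//.
  by rewrite mulrC ler_pdivlMr// mulrC.
have za := inv_step _ _ _ Jw Jz (min_energy_bernoulli zs' ws').
have wb := inv_step _ _ _ Jz Jw (min_energy_bernoulli ws' zs').
have s128' := s128.
have s640 : 0 < s / 64 by rewrite divr_gt0.
have ab : `|a + b| <= p * (512 * K1 / s) * d ^+ 2.
  have dh : holo_ball (fun x => m z x - m w x) z0 (s / 64).
    move=> x xs; apply: (@differentiableB _ _ _ (m z : V -> C^o) (m w : V -> C^o)).
      by apply: m_holo => //; exact: lt_trans s64r.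
    by apply: m_holo => //; exact: lt_trans s64r.
  have H2 := holo_lipschitz s640 dh (fun x => H1 z w x zs ws) (lt_trans zs s128) (lt_trans ws s128).
  have [_ mz _] := m_min Oz; have [_ mw _] := m_min Ow.
  have Re1 : complex.Re (1 : C) = 1 by [].
  have -> : a + b = p * complex.Re (m z w - m w w - (m z z - m w z)).
    by rewrite mz mw !ReB Re1 /a /b; ring.
  rewrite normrM (gtr0_norm p0) -mulrA ler_wpM2l ?(ltW p0)//.
  apply: le_trans (nc_Re _) _; apply: le_trans H2 _; rewrite [rnorm (z - w)]rnorm_distrC -/d.
  by rewrite le_eqVlt; apply/orP; left; apply/eqP; field; rewrite gt_eqF.
have kz0 : 0 <= (J z)^-1 by rewrite invr_ge0 ltW.
have EXP := inverse_expansion_le kz0 b4 bT za wb ab.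
set lz := complex.Re _.
have TAY : `|complex.Re (m z w) - 1 - lz| <= C3 * d ^+ 2.
  have zr : rnorm (z - z0) < rho / 16 by apply: lt_trans zs' s_16.
  have wr : rnorm (w - z) < rho / 16 by apply: lt_le_trans (dist_lt ws zs) s_512_16.
  have := holo_taylor rho0 (m_holo Oz) (fun x => @mA z x Oz) zr wr.
  rewrite subrKC; have [_ -> _] := m_min Oz => /(le_trans (nc_Re _)).
  by rewrite !ReB.
have -> : (J w)^-1 - (J z)^-1 - p * (J z)^-1 * lz =
   ((J w)^-1 - (J z)^-1 - (J z)^-1 * a) + (J z)^-1 * (p * (complex.Re (m z w) - 1 - lz)).
  by rewrite /a; ring.
apply: le_trans (ler_normD _ _) _.
have T2 : `|(J z)^-1 * (p * (complex.Re (m z w) - 1 - lz))| <= (J z)^-1 * (p * (C3 * d ^+ 2)).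
  by rewrite normrM (ger0_norm kz0) ler_wpM2l// normrM (gtr0_norm p0) ler_wpM2l// ltW.
apply: le_trans (lerD EXP T2) _.
have -> : (J z)^-1 * (p * (512 * K1 / s) * d ^+ 2 + 2 * (p * L * d) ^+ 2) +
  (J z)^-1 * (p * (C3 * d ^+ 2)) = (J z)^-1 * (C4 * d ^+ 2) by rewrite /C4; ring.
by rewrite -mulrA ler_wpM2r// mulr_ge0// sqr_ge0.
Qed.

End LocalLipschitz.

(** * Derivatives of the kernel *)

Section QuadraticExpansion.
Variables (R : realType) (n : nat).
Notation C := (CC R).
Notation nc := (@Normc.normc R).
Notation V := 'rV[C]_n.
Implicit Types (z w v : V) (j : 'I_(n + n)).

Definition real_direction j : V := to_complex (delta_mx 0 j).

Lemma rnorm_real_direction j : rnorm (real_direction j) < 4.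
Proof.
have e2 : 0 < (2 : R) by rewrite ltr0n.
have to_complex0 : to_complex (0 : 'rV[R]_(n + n)) = 0 by apply/rowP => k; rewrite !mxE.
rewrite -[real_direction j]subr0 -to_complex0.
apply: lt_le_trans (rnorm_to_complex e2 _) _; last by rewrite mulr2n -natrD.
by move=> i; rewrite !mxE subr0 eqxx /=; case: eqP => _; rewrite ?normr1 ?normr0// ltr1n.
Qed.

Lemma to_complex_line (x : 'rV[R]_(n + n)) (h : R) j :
  to_complex (x + h *: delta_mx 0 j) = to_complex x + h%:C%C *: real_direction j.
Proof.
apply/rowP => k; rewrite !mxE; apply/eqP; rewrite eq_complex /=.
by rewrite !mul0r subr0 addr0 !eqxx.
Qed.

Lemma real_direction_rshift k :
  real_direction (rshift n k) = 'i%C *: real_direction (lshift n k).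
Proof.
apply/rowP => l; rewrite !mxE !eqxx /= !(inj_eq (@lshift_inj _ _)) !(inj_eq (@rshift_inj _ _)).
rewrite eq_lrshift eq_rlshift; apply/eqP; rewrite eq_complex /=.
by rewrite !mul0r !mul1r ?sub0r ?subr0 ?add0r ?addr0 ?oppr0 !eqxx.
Qed.

Lemma rnorm_to_complex_le (x y : 'rV[R]_(n + n)) :
  rnorm (to_complex x - to_complex y) <= 2 * `|x - y|.
Proof.
apply/ler_addgt0Pr => e e0.
have r0 : 0 < `|x - y| + e / 2 by rewrite ltr_wpDl// divr_gt0.
have [_ xy] : ball x (`|x - y| + e / 2) y by rewrite mx_norm_ball /ball_ /= ltrDl divr_gt0.
apply: le_trans (ltW (rnorm_to_complex r0 _)) _.
  by move=> i; have := xy 0 i; rewrite /ball /=.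
by move: (`|_|) => t; rewrite mulr2n; lra.
Qed.

Variables (Omega : set V) (u : V -> R) (P : V -> V -> R).
Hypothesis PD : forall z, {morph P z : v w / v + w}.
Hypothesis PZ : forall z (a : R) v, P z (a%:C%C *: v) = a * P z v.
Hypothesis P_expansion : forall z0, Omega z0 -> exists2 r : R, 0 < r & exists2 K : R, 0 <= K &
  forall z w, rnorm (z - z0) < r -> rnorm (w - z0) < r ->
  `|u w - u z - P z (w - z)| <= K * rnorm (w - z) ^+ 2.
Notation g := (u \o @to_complex R n).

Lemma quadratic_is_derive x j : Omega (to_complex x) ->
  is_derive x (delta_mx 0 j) g (P (to_complex x) (real_direction j)).
Proof.
move=> /P_expansion[r r0 [K K0 H]]; apply: expansion_is_derive => e e0.
(* A step [h] moves by at most [4 |h|], so the quadratic error is at most [16 * K * |h| ^+ 2]. *)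
pose d := Num.min (r / 4) (e / (16 * K + 1)).
have K1 : 0 < 16 * K + 1 by rewrite ltr_wpDl// mulr_ge0.
exists d => [|h]; first by rewrite lt_min !divr_gt0.
rewrite lt_min => /andP[hr he].
set z := to_complex x; set v := real_direction j.
have v4 : rnorm v < 4 by exact: rnorm_real_direction.
have hv : rnorm (h%:C%C *: v) <= 4 * `|h|.
  by rewrite rnormZ nc_real mulrC; apply: ler_wpM2r => //; exact: ltW.
rewrite /= to_complex_line -/z -/v.
have zz : rnorm (z - z) < r by rewrite subrr rnorm0.
have hz : z + h%:C%C *: v - z = h%:C%C *: v by rewrite addrAC subrr add0r.
have zh : rnorm (z + h%:C%C *: v - z) < r.
  by rewrite hz; apply: le_lt_trans hv _; rewrite mulrC -ltr_pdivlMr.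
have := H z _ zz zh; rewrite hz PZ [h * _]mulrC => /le_trans; apply.
apply: (@le_trans _ _ ((16 * K + 1) * `|h| * `|h|)); last first.
  by rewrite ler_wpM2r// mulrC -ler_pdivlMr// ltW.
rewrite -mulrA -expr2 mulrDl mul1r -[X in X <= _]addr0 lerD ?sqr_ge0//.
have -> : 16 * K * `|h| ^+ 2 = K * (4 * `|h|) ^+ 2 by ring.
by rewrite ler_wpM2l// lerXn2r ?nnegrE ?rnorm_ge0// mulr_ge0.
Qed.

Lemma partial_quadratic x j : Omega (to_complex x) ->
  partial g j x = P (to_complex x) (real_direction j).
Proof. by move=> /(quadratic_is_derive j) dg; rewrite /partial derive_val. Qed.

(* Comparing the three expansions between [z], [w] and [z + |z - w| e_j] leaves only
   [P z - P w] evaluated at a vector of length comparable to [|z - w|]. *)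
Lemma quadratic_lipschitz z0 j : Omega z0 -> exists2 r : R, 0 < r & exists2 K : R, 0 <= K &
  forall z w, rnorm (z - z0) < r -> rnorm (w - z0) < r ->
  `|P z (real_direction j) - P w (real_direction j)| <= K * rnorm (z - w).
Proof.
move=> /P_expansion[r r0 [K K0 H]]; exists (r / 16); first by rewrite divr_gt0.
(* [42 = 25 + 16 + 1]: the squared distances between [y] and [w], [y] and [z], [z] and [w] are at
   most [25], [16] and [1] times [d ^+ 2]. *)
exists (42 * K); first by rewrite mulr_ge0.
move=> z w zr wr; set d := rnorm (z - w); set v := real_direction j.
have d0 : 0 <= d by exact: rnorm_ge0.
have [dE|dn0] := eqVneq d 0.
  by have /subr0_eq -> := rnorm_eq0 dE; rewrite subrr normr0 dE mulr0.
have dgt : 0 < d by rewrite lt_def dn0.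
have v4 : rnorm v <= 4 by apply/ltW; exact: rnorm_real_direction.
have hv : rnorm (d%:C%C *: v) <= 4 * d.
  by rewrite rnormZ nc_real (gtr0_norm dgt) mulrC ler_wpM2r.
have d8 : d < r / 8.
  have -> : r / 8 = r / 16 + r / 16 by field.
  rewrite /d; have -> : z - w = (z - z0) - (w - z0) by rewrite opprB addrA subrK.
  by apply: le_lt_trans (rnormD _ _) _; rewrite rnormN ltrD.
set y := z + d%:C%C *: v.
have lt_r x : rnorm (x - z0) < r / 16 -> rnorm (x - z0) < r.
  by move=> h; apply: lt_trans h _; rewrite ltr_pdivrMr// ltr_pMr// ltr1n.
have yz : y - z = d%:C%C *: v by rewrite /y addrAC subrr add0r.
have yr : rnorm (y - z0) < r.
  have -> : y - z0 = (y - z) + (z - z0) by rewrite addrA subrK.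
  apply: le_lt_trans (rnormD _ _) _; rewrite yz; apply: le_lt_trans (lerD hv (ltW zr)) _.
  by move: d8 r0; lra.
have yw : rnorm (y - w) <= 5 * d.
  have -> : y - w = (y - z) + (z - w) by rewrite addrA subrK.
  apply: le_trans (rnormD _ _) _; rewrite yz -/d.
  have -> : 5 * d = 4 * d + d by ring.
  exact: lerD.
have H1 := H _ _ (lt_r _ zr) yr; have H2 := H _ _ (lt_r _ wr) yr.
have H3 := H _ _ (lt_r _ wr) (lt_r _ zr).
have sq (a b : R) : 0 <= a -> a <= b -> K * a ^+ 2 <= K * b ^+ 2.
  by move=> a0 ab; rewrite ler_wpM2l// lerXn2r ?nnegrE// (le_trans a0).
have {}H1 := le_trans H1 (sq _ _ (rnorm_ge0 _) _).
rewrite yz in H1; have {}H1 := H1 _ hv.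
have {}H2 := le_trans H2 (sq _ _ (rnorm_ge0 _) yw).
have Pyw : P w (y - w) = d * P w v + P w (z - w).
  by rewrite -PZ -PD -yz addrA subrK.
rewrite PZ in H1; rewrite Pyw in H2; rewrite -/d in H3.
rewrite -(ler_pM2r dgt) -{1}(gtr0_norm dgt) -normrM.
have -> : (P z v - P w v) * d = (u y - u w - (d * P w v + P w (z - w))) -
  (u y - u z - d * P z v) - (u z - u w - P w (z - w)) by ring.
apply: le_trans (ler_normB _ _) _; apply: le_trans (lerD (ler_normB _ _) H3) _.
apply: le_trans (lerD (lerD H2 H1) (lexx _)) _.
by rewrite le_eqVlt; apply/orP; left; apply/eqP; ring.
Qed.

Lemma quadratic_C11 : open Omega -> C11_loc Omega u.
Proof.
move=> oO E g' j; rewrite {}/E {}/g'.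
have LIP x : Omega (to_complex x) -> exists U : set 'rV[R]_(n + n), exists2 K : R, 0 <= K &
    [/\ nbhs x U, U `<=` @to_complex R n @^-1` Omega & forall y z : 'rV[R]_(n + n), U y -> U z ->
     `|partial g j y - partial g j z| <= K * `|y - z|].
  move=> Ox; have [r r0 [K K0 H]] := quadratic_lipschitz j Ox.
  (* Intersecting with [Omega] allows the partial derivatives to be read off from [P] on the whole
     neighbourhood. *)
  exists (@to_complex R n @^-1` ([set w | rnorm (w - to_complex x) < r] `&` Omega)).
  exists (K * 2); first by rewrite mulr_ge0.
  split.
  - apply: continuous_to_complex; apply: filterI; last exact: open_nbhs_nbhs.
    by apply/nbhs_rnorm; exists r.
  - by move=> y [].
  - move=> y z [yr Oy] [zr Oz]; rewrite !partial_quadratic//.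
    apply: le_trans (H _ _ yr zr) _; rewrite -mulrA ler_wpM2l//.
    exact: rnorm_to_complex_le.
split=> x Ox.
- exact: (@ex_derive _ _ _ _ _ _ _ (quadratic_is_derive j Ox)).
- have [U [K K0 [xU _ H]]] := LIP x Ox.
  move=> W /nbhs_ballP[e /= e0 eW].
  have K1 : 0 < K + 1 by rewrite ltr_wpDl.
  have xe : nbhs x [set y | `|x - y| < e / (K + 1)].
    by apply/nbhs_ballP; exists (e / (K + 1)); [exact: divr_gt0|move=> y; rewrite mx_norm_ball].
  apply: filterS (filterI xU xe) => y [Uy xy]; apply: eW; rewrite /ball /=.
  apply: le_lt_trans (H _ _ (nbhs_singleton xU) Uy) _.
  apply: (@le_lt_trans _ _ ((K + 1) * `|x - y|)).
    by rewrite ler_wpM2r// lerDl.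
  by rewrite mulrC -ltr_pdivlMr.
- have [U [K K0 [xU _ H]]] := LIP x Ox.
  exists U => //; exists K; split=> [|M KM]; first exact: num_real.
  move=> [y z] [[Uy _] [Uz _]]; apply: le_trans (H _ _ Uy Uz) _.
  by rewrite ler_wpM2r// ltW.
Qed.

End QuadraticExpansion.

(** * Coordinate derivatives of holomorphic functions *)

Section Wirtinger.
Variables (R : realType) (n : nat).
Notation C := (CC R).
Notation nc := (@Normc.normc R).
Notation V := 'rV[C]_n.

Lemma differentiable_expansionM (f : V -> C) z : differentiable (f : V -> C^o) z ->
  forall (c : C) (e : R), 0 < e -> exists2 d : R, 0 < d & forall v, rnorm v < d ->
    nc (c * f (z + v) - c * f z - c * 'd (f : V -> C^o) z v) <= e * rnorm v.
Proof.
move=> df c e e0.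
have c1 : 0 < nc c + 1 by rewrite ltr_wpDl ?nc_ge0.
have [|d d0 H] := differentiable_expansion df (e := e / (nc c + 1)); first exact: divr_gt0.
exists d => // v vd; rewrite -!mulrBr ncM.
apply: le_trans (ler_wpM2l (nc_ge0 c) (H _ vd)) _.
rewrite mulrA ler_wpM2r ?rnorm_ge0// mulrA ler_pdivrMr// mulrC.
by rewrite ler_wpM2l ?(ltW e0)// lerDl.
Qed.

Lemma dxC_holomorphic (f : V -> C) z (c : C) j : differentiable (f : V -> C^o) z ->
  dxC (fun w => c * f w) j z = c * 'd (f : V -> C^o) z (real_direction R j).
Proof.
move=> df; set l := c * _.
(* [F] stands for the real or the imaginary part: a real-linear map dominated by the modulus. *)
have line (F : C -> R) : {morph F : x y / x - y} -> (forall x, `|F x| <= nc x) ->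
    (forall (a : R) x, F (a%:C%C * x) = a * F x) ->
    dx (fun w => F (c * f w)) j z = F l.
  move=> FB F_le FZ; rewrite /dx /partial.
  suff dF : is_derive (of_complex z) (delta_mx 0 j)
      ((fun w => F (c * f w)) \o @to_complex R n) (F l) by rewrite derive_val.
  apply: expansion_is_derive => e e0.
  have e4 : 0 < e / 4 by rewrite divr_gt0.
  have [d d0 H] := differentiable_expansionM df c e4.
  exists (d / 4) => [|h hd]; first by rewrite divr_gt0.
  rewrite /= to_complex_line of_complexK.
  have hv : rnorm (h%:C%C *: real_direction R j : V) <= 4 * `|h|.
    rewrite rnormZ nc_real mulrC ler_wpM2r//.
    by apply/ltW; exact: rnorm_real_direction.
  have vd : rnorm (h%:C%C *: real_direction R j : V) < d.
    by apply: le_lt_trans hv _; rewrite mulrC -ltr_pdivlMr.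
  rewrite [F l * h]mulrC -FZ -!FB; apply: le_trans (F_le _) _.
  have lZ : c * 'd (f : V -> C^o) z (h%:C%C *: real_direction R j) = h%:C%C * l.
    by rewrite linearZ /l [RHS]mulrCA.
  rewrite -lZ; apply: le_trans (H _ vd) _.
  apply: le_trans (ler_wpM2l (ltW e4) hv) _.
  by rewrite mulrA divfK.
rewrite /dxC (line (@complex.Re R)) ?(line (@complex.Im R)).
- by case: (l).
- exact: ImB.
- exact: nc_Im.
- by move=> a [x y] /=; rewrite mul0r addr0.
- exact: ReB.
- exact: nc_Re.
- by move=> a [x y] /=; rewrite mul0r subr0.
Qed.

End Wirtinger.

(** * Expansion of the kernel *)

Section BergmanExpansion.
Variables (R : realType) (n : nat) (Omega : set 'rV[CC R]_n) (p : R).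
Hypotheses (oO : open Omega) (p1 : 1 <= p) (Ap_one : Ap Omega p (cst 1)).
Notation C := (CC R).
Notation nc := (@Normc.normc R).
Notation V := 'rV[C]_n.

Lemma minimizerP z : Omega z -> is_minimizer Omega p z (minimizer Omega p z).
Proof. by move=> /(minimizer_exists oO p1 Ap_one); exact: xgetPex. Qed.

Lemma Kp_inv_min_energy z : Omega z -> Kp Omega p z = (min_energy Omega p z)^-1.
Proof.
move=> Oz; apply: (Kp_min_energy oO p1 Ap_one Oz).
by exists (minimizer Omega p z); exact: minimizerP.
Qed.

(** Provides the data of the local analysis: [E], the energy of the constant [1], dominates every
    minimal energy, so near [z0] all minimizers share one bound [B]. *)
Lemma Kp_expansion z0 : Omega z0 -> exists2 r : R, 0 < r & exists2 K : R, 0 <= K &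
  forall z w, rnorm (z - z0) < r -> rnorm (w - z0) < r ->
  `|Kp Omega p w - Kp Omega p z - p * Kp Omega p z *
    complex.Re ('d (minimizer Omega p z : V -> C^o) z (w - z))| <= K * rnorm (w - z) ^+ 2.
Proof.
move=> Oz0.
pose E := fine (int_powp Omega p (cst 1 : V -> C)).
have JE z : Omega z -> min_energy Omega p z <= E.
  by move=> _; have := min_energy_le oO p1 Ap_one z Ap_one; rewrite nc1 powR1 mul1r.
have [r [A [r0 rO rA]]] := locally_uniformly_bounded oO p1 E Oz0.
pose rho := Num.min r 1; pose B := Num.max A 1.
have rho0 : 0 < rho by rewrite lt_min r0 ltr01.
have rho1 : rho <= 1 by rewrite ge_min lexx orbT.
have B1 : 1 <= B by rewrite le_max lexx orbT.
have rho_r w : rnorm (w - z0) < rho -> rnorm (w - z0) < r.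
  by rewrite lt_min => /andP[].
have rhoO w : rnorm (w - z0) < rho -> Omega w by move=> /rho_r; exact: rO.
have mB z w : Omega z -> rnorm (w - z0) < rho -> nc (minimizer Omega p z w) <= B.
  move=> Oz /rho_r wr; have mz := minimizerP Oz; have [Az _ _] := mz.
  rewrite le_max; apply/orP; left; apply: rA => //.
  by rewrite (is_minimizer_energy p1 mz) JE.
have [K K0 H] := inv_min_energy_expansion oO p1 Ap_one minimizerP rho0 rho1 B1 rhoO mB JE.
have pB : 1 <= 64 * p * B.
  by apply: mulr_ege1 => //; apply: mulr_ege1 => //; rewrite ler1n.
have pB0 : 0 < 64 * p * B by exact: lt_le_trans pB.
have s_rho : rho / (64 * p * B) / 512 <= rho.
  rewrite ler_pdivrMr ?ltr0n// ler_pdivrMr// -mulrA; apply: ler_peMr; first exact: ltW.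
  by apply: mulr_ege1 => //; rewrite ler1n.
exists (rho / (64 * p * B) / 512); first by apply: divr_gt0; [exact: divr_gt0|rewrite ltr0n].
exists K => // z w zs ws.
rewrite !Kp_inv_min_energy; [exact: H|apply: rhoO|apply: rhoO].
  exact: lt_le_trans s_rho.
exact: lt_le_trans s_rho.
Qed.

End BergmanExpansion.

Theorem theorem1p1 (R : realType) (n : nat) (Omega : set 'rV[CC R]_n) (p : R)
    (n_gt0 : (0 < n)%N) (Omega_bd : bounded_domain Omega) (p_ge1 : 1 <= p) :
  C11_loc Omega (Kp Omega p) /\
  forall z : 'rV[CC R]_n, Omega z ->
    (forall j : 'I_(n + n),
       dx (Kp Omega p) j z
       = p * complex.Re (dxC (fun zeta => Kp_off Omega p zeta z) j z)) /\
    (forall k : 'I_n,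
       dz (fun w => (Kp Omega p w)%:C%C) k z
       = (p / 2)%:C%C * dz (fun zeta => Kp_off Omega p zeta z) k z).
Proof.
have [oO _ _ bO] := Omega_bd.
have Ap_one := Ap_one_bounded p oO bO.
pose D z := 'd (minimizer Omega p z : 'rV[CC R]_n -> (CC R)^o) z.
pose P z v := p * Kp Omega p z * complex.Re (D z v).
have PD z : {morph P z : v w / v + w} by move=> v w; rewrite /P linearD ReD mulrDr.
have PZ z (a : R) v : P z (a%:C%C *: v) = a * P z v.
  rewrite /P linearZ mulrCA; congr (_ * _).
  by case: (D z v) => x y /=; rewrite mul0r subr0.
have P_expansion := Kp_expansion oO p_ge1 Ap_one.
split; first exact: (quadratic_C11 PD PZ P_expansion).
move=> z Oz.
have dxK j : dx (Kp Omega p) j z = P z (real_direction R j).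
  by rewrite /dx (partial_quadratic PZ P_expansion) of_complexK.
have dm : differentiable (minimizer Omega p z : _ -> (CC R)^o) z.
  by have [[+ _] _ _] := minimizerP oO p_ge1 Ap_one Oz; exact.
have dxm j : dxC (fun zeta => Kp_off Omega p zeta z) j z =
    (Kp Omega p z)%:C%C * D z (real_direction R j).
  exact: dxC_holomorphic.
have dxCK j : dxC (fun w => (Kp Omega p w)%:C%C) j z = (P z (real_direction R j))%:C%C.
  rewrite -dxK /dxC; congr Complex.
  by rewrite /dx /partial; exact: derive_cst.
split=> [j|k].
  rewrite dxK dxm /P -mulrA; congr (_ * _).
  by case: (D z _) => x y /=; rewrite mul0r subr0.
rewrite /dz !dxCK !dxm real_direction_rshift /P linearZ.
move: (Kp Omega p z) (D z _) => c a.
have i2 : 'i%C * 'i%C = -1 :> CC R by rewrite -expr2 sqr_i.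
(* For complex [a], [Re a - i Re (i a) = a], whereas [a - i (i a) = 2 a]: this is the source of the
   factor [p / 2]. *)
have -> : (p * c * complex.Re a)%:C%C - 'i%C * (p * c * complex.Re ('i%C *: a))%:C%C =
    p%:C%C * (c%:C%C * a) :> CC R.
  by case: a => x y; apply/eqP; rewrite eq_complex /=; apply/andP; split; apply/eqP; ring.
have -> : (p / 2)%:C%C = p%:C%C / 2 :> CC R by rewrite fmorph_div rmorph_nat.
have -> : c%:C%C * a - 'i%C * (c%:C%C * ('i%C *: a)) = 2 * (c%:C%C * a) :> CC R.
  have -> : 'i%C * (c%:C%C * ('i%C * a)) = ('i%C * 'i%C) * (c%:C%C * a) :> CC R by ring.
  by rewrite i2; ring.
by field.
Qed.
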